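(* Let $T>0$, $d\ge1$, and assume $\sigma\in L^\infty(0,T)$ with $\epsilon\le\sigma(s)\le\epsilon^{-1}$ for a.e. $s$ and some $\epsilon>0$. Let $X=(X_t)_{t\in[0,T]}$ be the solution of $$dX_t=-\beta(t)X_t\,dt+\sigma(t)\,dW_t,\qquad X_0\sim\mu_0,$$ where $\beta\in L^\infty(0,T)$ and $\mu_0$ is a probability measure on $\mathbb{R}^d$ with compact support $\operatorname{supp}\mu_0\subset B_R$ (no absolute continuity, regularity or log-concavity of $\mu_0$ is assumed). Let $0<\delta<T$ and $$m_s:=e^{-\int_0^s\beta},\quad \varsigma_s^2:=m_s^2\int_0^s\sigma(r)^2m_r^{-2}\,dr,\quad \varsigma_{\min}^2:=\inf_{s\in[\delta,T]}\varsigma_s^2>0,\quad m_{\max}:=\sup_{s\le T}m_s<\infty.$$ Then the density $p_t$ of $X_t$ satisfies properties (S1)--(S4) of the context on $[\delta,T]$, with the explicit bounds, for $s\in[\delta,T]$ and $x\in\mathbb{R}^d$, $$\|[\Delta\log p_s]^+\|_{L^\infty}\le d\Big(\frac{m_s^2R^2}{\varsigma_s^4}-\frac1{\varsigma_s^2}\Big)^+\le d\,m_{\max}^2R^2\varsigma_{\min}^{-4}\quad(\text{giving (S3)}),$$ $$\|\nabla^2\log p_s\|_{\mathrm{op}}\le\varsigma_s^{-2}+m_s^2R^2\varsigma_s^{-4}\le\varsigma_{\min}^{-2}+m_{\max}^2R^2\varsigma_{\min}^{-4}\quad(\text{giving (S2)}),$$ $$|\nabla\log p_s(x)|\le\varsigma_{\min}^{-2}\max\{1,m_{\max}R\}(1+|x|)\quad(\text{giving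 (S4)}).$$ In addition, $$\nabla^2\log p_s\ge-\varsigma_s^{-2}I,\qquad\|[\Delta\log p_s]^-\|_{L^\infty}\le d\,\varsigma_{\min}^{-2}.$$
   Context: $W$ is a $d$-dimensional Brownian motion, $\mathcal{L}^d$ Lebesgue measure, $B_R$ the ball of radius $R$ centred at $0$, $[g]^\pm=(g)^\pm$ positive/negative parts. Properties on $[\delta,T]$: (S1) $p_t>0$ a.e. for each $t\in[\delta,T]$, $p\in L^\infty((\delta,T);L^1\cap L^\infty)$, $\sup_{\delta\le t\le T}\int|x|^2p_t<\infty$, $t\mapsto p_t\mathcal{L}^d$ narrowly continuous on $[\delta,T]$; (S2) $\nabla\log p_\cdot\in L^1((\delta,T);W^{1,1}_{\mathrm{loc}}(\mathbb{R}^d;\mathbb{R}^d))$; (S3) $\|[\Delta\log p_t]^+\|_{L^\infty}\le\Lambda(t)$ for some $\Lambda\in L^1(\delta,T)$; (S4) $|\nabla\log p_s(x)|\le A(s)(1+|x|)$ for a.e. $x$, for some $A\in L^1(\delta,T)$. *)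

(* Defs.v *)
From HB Require Import structures.
From mathcomp Require Import all_boot all_order all_algebra.
From mathcomp Require Import all_classical all_reals all_analysis.

Set Implicit Arguments.
Unset Strict Implicit.
Unset Printing Implicit Defensive.
Import Order.TTheory GRing.Theory Num.Theory.
Import numFieldNormedType.Exports.
Local Open Scope classical_set_scope.
Local Open Scope ring_scope.

(* 'rV[R]_n carries the sigma-algebra generated by the coordinates, as n.-tuple
   does in the library; on R^n it is the Borel sigma-algebra *)
Section row_vector_measurable.
Context (R : realType) (n : nat).

Let coord (i : 'I_n) : 'rV[R]_n -> R := fun v => v 0 i.

Let rV_set0 : g_sigma_preimage coord set0.
Proof. exact: sigma_algebra0. Qed.

Let rV_setC A : g_sigma_preimage coord A -> g_sigma_preimage coord (~` A).
Proof. exact: sigma_algebraC. Qed.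

Let rV_bigcup (F : _^nat) : (forall i, g_sigma_preimage coord (F i)) ->
  g_sigma_preimage coord (\bigcup_i (F i)).
Proof. exact: sigma_algebra_bigcup. Qed.

HB.instance Definition _ := @isMeasurable.Build default_measure_display
  'rV[R]_n (g_sigma_preimage coord) rV_set0 rV_setC rV_bigcup.

Lemma measurable_coord (i : 'I_n) : measurable_fun setT (coord i).
Proof.
move=> _ Y mY; rewrite setTI; apply: sub_sigma_algebra => /=.
rewrite -bigcup_seq/=; exists i => /=; first by rewrite mem_index_enum.
by exists Y => //; rewrite setTI.
Qed.

Lemma measurable_fun_rV d (T : measurableType d) (f : T -> 'rV[R]_n) :
  (forall i, measurable_fun setT (fun t => f t 0 i)) -> measurable_fun setT f.
Proof.
move=> mf; apply: (measurability (\big[setU/set0]_(i < n)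
  preimage_set_system setT (coord i) measurable)) => //.
move=> /= _ [B + <-]; rewrite -bigcup_seq => -[i _ [C mC <-]].
by rewrite !setTI; have := mf i measurableT C mC; rewrite setTI.
Qed.

End row_vector_measurable.

Section lebesgue_rV.
Context (R : realType).

Definition rV_cons n (z : R * 'rV[R]_n) : 'rV[R]_n.+1 :=
  \row_i oapp (z.2 0) z.1 (unlift ord0 i).

Lemma measurable_rV_cons n : measurable_fun setT (@rV_cons n).
Proof.
apply: measurable_fun_rV => i.
have -> : (fun z => @rV_cons n z 0 i) =
    (fun z => oapp (z.2 0) z.1 (unlift ord0 i)).
  by apply/funext => z; rewrite mxE.
case: unliftP => [j _|_] /=; last exact: measurable_fst.
exact: (measurableT_comp (measurable_coord j) measurable_snd).
Qed.

Let rV_uncons n (v : 'rV[R]_n.+1) : R * 'rV[R]_n :=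
  (v 0 ord0, \row_j v 0 (lift ord0 j)).

Let measurable_rV_uncons n : measurable_fun setT (@rV_uncons n).
Proof.
apply: measurable_fun_pair => /=; first exact: measurable_coord.
apply: measurable_fun_rV => i.
by under eq_fun do rewrite mxE; exact: measurable_coord.
Qed.

Let rV_consK n : cancel (@rV_cons n) (@rV_uncons n).
Proof.
move=> [x v]; rewrite /rV_uncons /rV_cons mxE unlift_none /=; congr pair.
by apply/rowP => j; rewrite !mxE liftK.
Qed.

Section lebesgue_cons.
Context n (mu : {sigma_finite_measure set 'rV[R]_n -> \bar R}).

Let lam : {sigma_finite_measure set (measurableTypeR R) -> \bar R} := lebesgue_measure.

Definition lebesgue_cons : set 'rV[R]_n.+1 -> \bar R :=
  pushforward (lam \x mu)%E (@rV_cons n).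

Let lebesgue_cons0 : lebesgue_cons set0 = 0%E.
Proof. by rewrite /lebesgue_cons /pushforward preimage_set0 measure0. Qed.

Let lebesgue_cons_ge0 A : (0 <= lebesgue_cons A)%E.
Proof. by rewrite /lebesgue_cons /pushforward measure_ge0. Qed.

Let mpre A : measurable A -> measurable (@rV_cons n @^-1` A).
Proof. by move=> mA; rewrite -[X in measurable X]setTI; exact: measurable_rV_cons. Qed.

Let lebesgue_cons_sigma_additive : semi_sigma_additive lebesgue_cons.
Proof.
move=> F mF tF mUF; rewrite /lebesgue_cons /pushforward preimage_bigcup.
apply: measure_semi_sigma_additive.
- by move=> k; exact: mpre.
- apply/trivIsetP => /= i j _ _ ij; rewrite -preimage_setI.
  by move/trivIsetP : tF => /(_ _ _ _ _ ij) ->//; rewrite preimage_set0.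
- by rewrite -preimage_bigcup; exact: mpre.
Qed.

HB.instance Definition _ := isMeasure.Build _ _ _ lebesgue_cons
  lebesgue_cons0 lebesgue_cons_ge0 lebesgue_cons_sigma_additive.

Let lebesgue_cons_sigma_finite : sigma_finite setT lebesgue_cons.
Proof.
have /sigma_finiteP[F [TF ndF Foo]] := sigma_finiteT lam.
have /sigma_finiteP[G [TG ndG Goo]] := sigma_finiteT mu.
exists (fun k => @rV_uncons n @^-1` (F k `*` G k)).
  apply/seteqP; split => // v _.
  have [k _ Fk] : (\bigcup_k F k) (rV_uncons v).1 by rewrite -TF.
  have [l _ Gl] : (\bigcup_k G k) (rV_uncons v).2 by rewrite -TG.
  exists (maxn k l) => //; split.
  - by move: Fk; exact/subsetPset/ndF/leq_maxl.
  - by move: Gl; exact/subsetPset/ndG/leq_maxr.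
move=> k; have [mF Fk] := Foo k; have [mG Gk] := Goo k; split.
  rewrite -[X in measurable X]setTI; apply: measurable_rV_uncons => //.
  exact: measurableX.
rewrite /lebesgue_cons /pushforward -comp_preimage.
rewrite (_ : _ \o _ = id) ?preimage_id; last first.
  by apply/funext => z /=; rewrite rV_consK.
by rewrite product_measure1E// lte_mul_pinfty// ge0_fin_numE.
Qed.

HB.instance Definition _ := Measure_isSigmaFinite.Build _ _ _ lebesgue_cons
  lebesgue_cons_sigma_finite.

End lebesgue_cons.

(* L^n, by iterated products; lebesgue_rV_box gives its value on boxes *)
Fixpoint lebesgue_rV n : {sigma_finite_measure set 'rV[R]_n -> \bar R} :=
  match n with
  | 0 => \d_(0 : 'rV[R]_0)
  | n'.+1 => lebesgue_cons (lebesgue_rV n')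
  end.

Lemma lebesgue_rV_box n (A : 'I_n -> set R) : (forall i, measurable (A i)) ->
  lebesgue_rV n [set v | forall i, A i (v 0 i)] =
  (\prod_(i < n) lebesgue_measure (A i))%E.
Proof.
elim: n A => [|n IH] A mA.
  by rewrite big_ord0 /= diracE mem_set// => -[].
rewrite big_ord_recl -IH//.
have mB : measurable [set v : 'rV[R]_n | forall i, A (lift ord0 i) (v 0 i)].
  rewrite (_ : [set _ | _] = \big[setI/setT]_(i < n)
      ((fun v : 'rV[R]_n => v 0 i) @^-1` A (lift ord0 i))).
    apply: bigsetI_measurable => i _; rewrite -[X in measurable X]setTI.
    exact: measurable_coord.
  rewrite -bigcap_seq; apply/seteqP; split => v /= H i; first by move=> _; exact: H.
  by apply: H; rewrite /= mem_index_enum.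
rewrite [LHS]/= /lebesgue_cons /pushforward.
rewrite -(product_measure1E lebesgue_measure (lebesgue_rV n) (mA ord0) mB).
congr (_ _); apply/seteqP; split => [[x v]/= H|[x v] /= [H1 H2] i].
- by split; [have := H ord0|move=> j; have := H (lift ord0 j)];
    rewrite /rV_cons mxE ?unlift_none ?liftK.
- by rewrite /rV_cons mxE; case: unliftP => [j ->|->] /=.
Qed.

End lebesgue_rV.

Arguments lebesgue_rV : clear implicits.
Arguments rV_cons {R n}.

Section euclidean.
Context (R : realType) (n : nat).
Implicit Types (v : 'rV[R]_n) (A B : 'M[R]_n).

(* `|v| is the maximum norm on 'rV[R]_n; this is the Euclidean one *)
Definition enorm v : R := Num.sqrt (\sum_(i < n) v 0 i ^+ 2).

(* closed ball *)
Definition eball (r : R) : set 'rV[R]_n := [set v | enorm v <= r].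

Definition opnorm A : R := sup [set enorm (v *m A) | v in eball 1].

Definition loewner_le A B : Prop :=
  (B - A)^T = B - A /\ forall v, 0 <= (v *m (B - A) *m v^T) 0 0.

End euclidean.

Section calculus.
Context (R : realType) (n : nat).
Implicit Types f g h : 'rV[R]_n -> R.

Definition partial (i : 'I_n) f : 'rV[R]_n -> R :=
  fun x => 'D_(delta_mx 0 i) f x.

Fixpoint Ck (k : nat) f : Prop :=
  match k with
  | 0 => continuous f
  | k'.+1 => continuous f /\ forall i,
      (forall x, derivable f x (delta_mx 0 i)) /\ Ck k' (partial i f)
  end.

Definition gradient f (x : 'rV[R]_n) : 'rV[R]_n := \row_i partial i f x.

Definition hessian f (x : 'rV[R]_n) : 'M[R]_n :=
  \matrix_(i, j) partial j (partial i f) x.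

Definition laplacian f (x : 'rV[R]_n) : R := \tr (hessian f x).

Definition test_function f : Prop :=
  (forall k, Ck k f) /\ compact (closure [set x | f x != 0]).

Definition loc_integrable f : Prop := forall K : set 'rV[R]_n, compact K ->
  (lebesgue_rV R n).-integrable K (EFin \o f).

(* g is the distributional derivative of f in the direction i *)
Definition weak_partial (i : 'I_n) f g : Prop :=
  [/\ loc_integrable f, loc_integrable g &
    forall phi, test_function phi ->
      \int[lebesgue_rV R n]_x (f x * partial i phi x) =
      - \int[lebesgue_rV R n]_x (g x * phi x)].

Definition weak_gradient f (u : 'rV[R]_n -> 'rV[R]_n) : Prop :=
  forall i, weak_partial i f (fun x => u x 0 i).

Definition weak_jacobian (u : 'rV[R]_n -> 'rV[R]_n) (D : 'rV[R]_n -> 'M[R]_n) :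
    Prop :=
  forall i j, weak_partial j (fun x => u x 0 i) (fun x => D x i j).

End calculus.

Section function_spaces.
Context (R : realType) (n : nat).
Implicit Types (a b : R).

Definition Linfty a b (f : R -> R) : Prop :=
  measurable_fun `]a, b[ f /\
  exists M, {ae lebesgue_measure, forall t : R, t \in `]a, b[ -> `|f t| <= M}.

Definition L1 a b (f : R -> R) : Prop :=
  lebesgue_measure.-integrable `]a, b[ (EFin \o f).

Definition jointly_measurable a b (f : R -> 'rV[R]_n -> R) : Prop :=
  measurable_fun (`]a, b[ `*` setT) (fun z : R * 'rV[R]_n => f z.1 z.2).

(* u in L^1((a, b); W^{1,1}_loc(R^n; R^n)), Bochner measurability being expressed
   by joint measurability in (t, x) *)
Definition L1_W11loc a b (u : R -> 'rV[R]_n -> 'rV[R]_n) : Prop :=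
  exists D : R -> 'rV[R]_n -> 'M[R]_n,
  [/\ forall i, jointly_measurable a b (fun t x => u t x 0 i),
      forall i j, jointly_measurable a b (fun t x => D t x i j),
      {ae lebesgue_measure, forall t : R, t \in `]a, b[ ->
        weak_jacobian (u t) (D t)} &
      forall r : R, (\int[lebesgue_measure]_(t in `]a, b[)
        \int[lebesgue_rV R n]_(x in eball r)
          (enorm (u t x) + \sum_(i < n) \sum_(j < n) `|D t x i j|)%:E
        < +oo)%E].

End function_spaces.

Section density_properties.
Context (R : realType) (n : nat) (delta T : R) (p : R -> 'rV[R]_n -> R).

Let log_p t : 'rV[R]_n -> R := fun x => ln (p t x).

Definition narrowly_continuous : Prop :=
  forall phi : 'rV[R]_n -> R, continuous phi ->
    (exists M, forall x, `|phi x| <= M) ->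
    {within `[delta, T], continuous
      (fun t => \int[lebesgue_rV R n]_x (phi x * p t x))}.

Definition S1 : Prop :=
  [/\ forall t, t \in `[delta, T] ->
        {ae lebesgue_rV R n, forall x, 0 < p t x},
      jointly_measurable delta T p /\
        exists M : R, {ae lebesgue_measure, forall t : R, t \in `]delta, T[ ->
          ('N[lebesgue_rV R n]_1[EFin \o p t] <= M%:E)%E /\
          ('N[lebesgue_rV R n]_+oo[EFin \o p t] <= M%:E)%E},
      (ereal_sup [set \int[lebesgue_rV R n]_x (enorm x ^+ 2 * p t x)%:E
        | t in `[delta, T]] < +oo)%E &
      narrowly_continuous].

Definition S2 : Prop :=
  exists u : R -> 'rV[R]_n -> 'rV[R]_n,
    {ae lebesgue_measure, forall t : R, t \in `]delta, T[ ->
      weak_gradient (log_p t) (u t)} /\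
    L1_W11loc delta T u.

(* \Delta log p_t is the trace of the weak Jacobian of the weak gradient *)
Definition S3 : Prop :=
  exists Lambda : R -> R, L1 delta T Lambda /\
    {ae lebesgue_measure, forall t : R, t \in `]delta, T[ ->
      exists u D, [/\ weak_gradient (log_p t) u, weak_jacobian u D &
        ('N[lebesgue_rV R n]_+oo[EFin \o (fun x => \tr (D x))^\+%R]
          <= (Lambda t)%:E)%E]}.

Definition S4 : Prop :=
  exists A : R -> R, L1 delta T A /\
    {ae lebesgue_measure, forall s : R, s \in `]delta, T[ ->
      exists2 u, weak_gradient (log_p s) u &
        {ae lebesgue_rV R n, forall x, enorm (u x) <= A s * (1 + enorm x)}}.

End density_properties.

Section probability_notions.
Context (R : realType) (n : nat) d (Omega : measurableType d)
  (P : probability Omega R).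

Definition msupport (mu : set 'rV[R]_n -> \bar R) : set 'rV[R]_n :=
  [set x | forall U, open U -> U x -> (0 < mu U)%E].

Definition has_law (X : Omega -> 'rV[R]_n) (mu : set 'rV[R]_n -> \bar R) :
    Prop :=
  measurable_fun setT X /\
  forall A, measurable A -> P (X @^-1` A) = mu A.

Definition has_density (X : Omega -> 'rV[R]_n) (p : 'rV[R]_n -> R) : Prop :=
  [/\ measurable_fun setT p, forall x, 0 <= p x &
    has_law X (fun A => \int[lebesgue_rV R n]_(x in A) (p x)%:E)%E].

Definition filtration (T : R) (F : R -> set (set Omega)) : Prop :=
  [/\ forall t, t \in `[0, T] -> sigma_algebra setT (F t),
      forall t, t \in `[0, T] -> F t `<=` measurable &
      forall s t : R, 0 <= s -> s <= t -> t <= T -> F s `<=` F t].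

Definition adapted (T : R) (F : R -> set (set Omega))
    (X : R -> Omega -> 'rV[R]_n) : Prop :=
  forall t, t \in `[0, T] -> forall A, measurable A -> F t (X t @^-1` A).

Definition continuous_paths (T : R) (X : R -> Omega -> 'rV[R]_n) : Prop :=
  {ae P, forall w, {within `[0, T], continuous (fun t => X t w)}}.

(* n-dimensional Brownian motion on [0, T] relative to the filtration F;
   the second parameter of normal_prob is the standard deviation *)
Definition brownian_motion (T : R) (F : R -> set (set Omega))
    (W : R -> Omega -> 'rV[R]_n) : Prop :=
  [/\ adapted T F W,
      {ae P, forall w, W 0 w = 0},
      continuous_paths T W,
      forall s t : R, 0 <= s -> s < t -> t <= T -> forall B : 'I_n -> set R,
        (forall i, measurable (B i)) ->
        P [set w | forall i, B i ((W t \- W s) w 0 i)] =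
          (\prod_(i < n) normal_prob 0 (Num.sqrt (t - s)) (B i))%E &
      forall s t : R, 0 <= s -> s < t -> t <= T -> forall E A,
        F s E -> measurable A ->
        P (E `&` (W t \- W s) @^-1` A) =
          (P E * P ((W t \- W s)%R @^-1` A))%E].

(* the function \sum_i sf_coef i * \1_(]sf_node i, sf_node i.+1]) *)
Record step_fun := StepFun {
  sf_size : nat;
  sf_node : nat -> R;
  sf_coef : nat -> R }.

Definition step_on (t : R) (s : step_fun) : Prop :=
  [/\ 0 <= sf_node s 0, sf_node s (sf_size s) <= t &
    forall i, (i < sf_size s)%N -> sf_node s i <= sf_node s i.+1].

Definition step_eval (s : step_fun) (r : R) : R :=
  \sum_(0 <= i < sf_size s)
    sf_coef s i * \1_(`]sf_node s i, sf_node s i.+1]) r.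

Definition step_int (W : R -> Omega -> 'rV[R]_n) (s : step_fun) (w : Omega) :
    'rV[R]_n :=
  \sum_(0 <= i < sf_size s)
    sf_coef s i *: (W (sf_node s i.+1) w - W (sf_node s i) w).

(* Y = \int_0^t f dW for a deterministic square-integrable f: limit in L^2(P)
   of the integrals of step functions converging to f in L^2(0, t) *)
Definition stoch_integral (W : R -> Omega -> 'rV[R]_n) (f : R -> R) (t : R)
    (Y : Omega -> 'rV[R]_n) : Prop :=
  measurable_fun setT Y /\
  exists phi : nat -> step_fun,
  [/\ forall k, step_on t (phi k),
      (fun k => \int[lebesgue_measure]_(r in `[0%R, t])
        ((step_eval (phi k) r - f r) ^+ 2)%:E)%E @ \oo --> 0%E &
      (fun k => \int[P]_w (enorm (step_int W (phi k) w - Y w) ^+ 2)%:E)%E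
        @ \oo --> 0%E].

(* dX_t = - beta(t) X_t dt + sigma(t) dW_t on [0, T] in integrated form; since
   sigma is deterministic, its Ito integral is given by stoch_integral *)
Definition sde_solution (T : R) (F : R -> set (set Omega))
    (W : R -> Omega -> 'rV[R]_n) (beta sigma : R -> R)
    (X : R -> Omega -> 'rV[R]_n) : Prop :=
  [/\ adapted T F X, continuous_paths T X &
    forall t, t \in `[0, T] -> exists2 Y, stoch_integral W sigma t Y &
      {ae P, forall w, X t w = X 0 w
        - \row_i (\int[lebesgue_measure]_(s in `[0, t]) (beta s * X s w 0 i))
        + Y w}].

End probability_notions.

Section coefficients.
Context (R : realType) (beta sigma : R -> R).

Definition m_ (s : R) : R :=
  expR (- \int[lebesgue_measure]_(r in `[0, s]) beta r).

(* the squares of varsigma_s and varsigma_min, and m_max *)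
Definition vs2 (s : R) : R :=
  m_ s ^+ 2 *
  \int[lebesgue_measure]_(r in `[0, s]) (sigma r ^+ 2 * m_ r ^- 2).

Definition vs2_min (delta T : R) : R := inf [set vs2 s | s in `[delta, T]].

Definition m_max (T : R) : R := sup [set m_ s | s in `[0, T]].

End coefficients.

(* Main.v *)
(* Solving the linear equation, X_t = m_t X_0 + int_0^t (m_t / m_r) sigma_r dW_r, where the Wiener
   integral is independent of X_0 and Gaussian with variance vs2 t; hence p_t(y) is the average of
   the heat kernels gauss (vs2 t) (y - m_t x) over x ~ mu0.  The representation is obtained at the
   level of the expectations of gauss a (y - X_t), a > 0, which determine the law of X_t: along an
   Euler scheme the Wiener integrals of step functions are explicit, and both the scheme and the
   step functions converge.

   Writing p_t(y) = c exp (- |y|^2 / 2v) int exp (- m^2 |x|^2 / 2v + (m / v) <x, y>) mu0(dx) with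
   v = vs2 t and m = m_t shows that log p_t is a quadratic plus the log-Laplace transform of a
   compactly supported measure.  So grad log p_t = - y / v + (m / v) E and
   Hess log p_t = - I / v + (m / v)^2 Cov, where E and Cov are the mean and the covariance of X_0
   given X_t = y.  That conditional law is carried by the ball of radius R, so |E| <= R,
   0 <= Cov <= R^2 I and tr Cov <= R^2, and every bound follows. *)
Require Import Defs.
From HB Require Import structures.
From mathcomp Require Import all_boot all_order all_algebra.
From mathcomp Require Import all_classical all_reals all_analysis.
From mathcomp Require Import measurable_realfun ess_sup_inf ring lra.

Set Implicit Arguments.
Unset Strict Implicit.
Unset Printing Implicit Defensive.
Import Order.TTheory GRing.Theory Num.Theory.
Import numFieldNormedType.Exports.
Local Open Scope classical_set_scope.
Local Open Scope ring_scope.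

(** * Borel structure and Lebesgue measure on row vectors *)

(** Testing the law of X_t with Gaussian kernels rather than with characters keeps every integrand
    real, non-negative and bounded, so that Tonelli and the monotone and dominated convergence
    theorems suffice. Such kernels also react to independent Gaussian noise in the simplest way:
    averaging over an increment of length h with coefficient c turns the variance a into a + c^2 h,
    whatever the F_s-measurable remainder is. So neither conditional expectations nor the joint law
    of X_0 and the Wiener integral is needed. The Euler scheme stands in for the product rule
    applied to X / m: beta is only bounded and measurable, and the equation supplies for each t its
    own almost sure identity, with its own version of the stochastic integral. The scheme looks at
    the grids t j / (N + 1) only, that is at countably many times, and of a path it needs just a
    bound and the modulus of continuity. The bound on the positive part of the Laplacian carries a
    factor d although tr Cov <= R^2 yields m^2 R^2 / v^2 - d / v; the latter is at most d (m^2 R^2 /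
    v^2 - 1 / v) because d >= 1. *)

Section borel_rV.
Context (R : realType) (n : nat).
Implicit Types (U : set 'rV[R]_n) (f : 'rV[R]_n -> R).

Definition obox (a b : 'I_n -> R) : set 'rV[R]_n :=
  [set v | forall i, a i < v 0 i < b i].

Lemma measurable_forall_coord (A : 'I_n -> set R) :
  (forall i, measurable (A i)) ->
  measurable [set v : 'rV[R]_n | forall i, A i (v 0 i)].
Proof.
move=> mA; rewrite (_ : [set _ | _] = \big[setI/setT]_(i < n)
    ((fun v : 'rV[R]_n => v 0 i) @^-1` A i)).
  apply: bigsetI_measurable => i _; rewrite -[X in measurable X]setTI.
  exact: measurable_coord.
rewrite -bigcap_seq; apply/seteqP; split => v /= H i; first by move=> _; exact: H.
by apply: H; rewrite /= mem_index_enum.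
Qed.

Lemma measurable_obox a b : measurable (obox a b).
Proof.
rewrite (_ : obox a b = [set v | forall i, `]a i, b i[%classic (v 0 i)]).
  by apply: (measurable_forall_coord (A := fun i => `]a i, b i[%classic)).
by apply/seteqP; split => v /= H i; have := H i; rewrite in_itv.
Qed.

(** Rational boxes form a countable base of the topology. This is what links the topology with the
    sigma-algebra generated by the coordinates. *)
Lemma open_rat_box U x : open U -> U x -> exists q : {ffun 'I_n -> rat * rat},
  let B := obox (fun i => ratr (q i).1) (fun i => ratr (q i).2) in
  B x /\ B `<=` U.
Proof.
move=> oU Ux; have [P /= Px PU] : nbhs x U by exact: open_nbhs_nbhs.
have /choice[q Hq] i : exists q : rat * rat, (ratr q.1 < x 0 i < ratr q.2) /\
    forall y, ratr q.1 < y < ratr q.2 -> P 0 i y.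
  have /nbhs_ballP[e /= e0 eP] := Px 0 i.
  have /rat_in_itvoo[q1] : x 0 i - e < x 0 i by rewrite ltrBlDr ltrDl.
  have /rat_in_itvoo[q2] : x 0 i < x 0 i + e by rewrite ltrDl.
  rewrite !in_itv/= => /andP[h1 h2] /andP[h3 h4]; exists (q1, q2) => /=.
  rewrite h1 h4; split => // y /andP[h5 h6]; apply: eP.
  rewrite /ball/= /ball_ ltr_distlC; apply/andP; split.
    exact: lt_trans h5.
  exact: lt_trans h2.
exists [ffun i => q i] => /=; split.
  by move=> i; rewrite ffunE; exact: (Hq i).1.
move=> v Bv; apply: PU => i j; rewrite (ord1 i).
by apply: (Hq j).2; have := Bv j; rewrite ffunE.
Qed.

Lemma open_measurable_rV U : open U -> measurable U.
Proof.
move=> oU.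
pose B (q : {ffun 'I_n -> rat * rat}) :=
  obox (fun i => ratr (q i).1) (fun i => ratr (q i).2).
rewrite (_ : U = \bigcup_q (if `[< B q `<=` U >] then B q else set0)).
  apply: countable_bigcupT_measurable; first exact: countableP.
  by move=> q; case: ifP => // _; exact: measurable_obox.
apply/seteqP; split => [x Ux|x [q _]].
  have [q [Bx BU]] := open_rat_box oU Ux.
  by exists q => //; rewrite asboolT.
by case: asboolP => // qU Bx; exact: qU.
Qed.

Lemma closed_measurable_rV U : closed U -> measurable U.
Proof.
by move=> cU; rewrite -[U]setCK; apply: measurableC; apply: open_measurable_rV; exact: closed_openC.
Qed.

Lemma continuous_measurable_rV f : continuous f -> measurable_fun setT f.
Proof.
move=> /continuousP cf; apply: (measurability _ (RGenOpens.measurableE R)).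
move=> _ [_ [a [b ->] <-]]; rewrite setTI.
by apply: open_measurable_rV; apply: cf; exact: interval_open.
Qed.

Lemma compact_measurable_rV U : compact U -> measurable U.
Proof.
by move=> cU; apply: closed_measurable_rV; exact: compact_closed.
Qed.

(** A Lindelof argument: every point off the support has a null neighbourhood, hence lies in a null
    rational box, and there are only countably many of these. *)
Lemma measure_setC_msupport (mu : {measure set 'rV[R]_n -> \bar R}) A :
  measurable A -> msupport mu `<=` A -> mu (~` A) = 0%E.
Proof.
move=> mA sA.
pose B (q : {ffun 'I_n -> rat * rat}) :=
  obox (fun i => ratr (q i).1) (fun i => ratr (q i).2).
pose C q := if `[< mu (B q) = 0%E >] then B q else set0.
have mC q : measurable (C q).
  by rewrite /C; case: ifP => // _; exact: measurable_obox.
have C0 q : mu (C q) = 0%E.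
  by rewrite /C; case: asboolP => // _; exact: measure0.
have AC : ~` A `<=` \bigcup_q C q.
  move=> x /= Ax; have : ~ msupport mu x by move=> /sA.
  move=> /existsNP[U] /not_implyP[oU] /not_implyP[Ux] /negP.
  rewrite -leNgt measure_le0 => /eqP U0.
  have [q [Bx BU]] := open_rat_box oU Ux.
  exists q => //; rewrite /C asboolT//.
  apply/eqP; rewrite -measure_le0 -U0; apply: le_measure => //.
  - by rewrite inE; exact: measurable_obox.
  - by rewrite inE; exact: open_measurable_rV.
have : mu.-negligible (\bigcup_k (if unpickle k is Some q then C q else set0)).
  apply: negligible_bigcup => k; case: unpickle => [q|]; last exact: negligible_set0.
  by exists (C q); split => //; exact: mC.
move=> /negligibleS -/(_ (~` A)) H; apply/negligibleP; first exact: measurableC.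
apply: H => x /AC[q _ Cx]; exists (pickle q) => //.
by rewrite pickleK.
Qed.

Definition lower_box (b : 'I_n -> R) : set 'rV[R]_n := [set v | forall i, v 0 i < b i].

Lemma measurable_lower_box b : measurable (lower_box b).
Proof.
rewrite (_ : lower_box b = [set v | forall i, `]-oo, b i[%classic (v 0 i)]).
  by apply: (measurable_forall_coord (A := fun i => `]-oo, b i[%classic)).
by apply/seteqP; split => v /= H i; have := H i; rewrite in_itv.
Qed.

Lemma lt_nat_rV (v : 'rV[R]_n) : exists k : nat, forall i, `|v 0 i| < k%:R.
Proof.
exists (Num.bound (\sum_i `|v 0 i|)) => i; apply: le_lt_trans (archi_boundP _); last exact: sumr_ge0.
rewrite (bigD1 i)//= lerDl.
exact: sumr_ge0.
Qed.

(** Lower boxes are stable under intersection, exhaust the space and generate the sigma-algebra, so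
    the uniqueness theorem for measures on a pi-system applies. *)
Lemma lower_box_measure_unique (m1 m2 : {measure set 'rV[R]_n -> \bar R}) A :
  (m1 setT < +oo)%E -> (forall b, m1 (lower_box b) = m2 (lower_box b)) ->
  measurable A -> m1 A = m2 A.
Proof.
move=> m1oo m12; apply: (measure_unique [set lower_box b | b in setT]
  (fun k => lower_box (fun=> k%:R))).
- apply/seteqP; split => [B|B]; last first.
    apply; split; first exact: sigma_algebra_measurable.
    by move=> _ [b _ <-]; exact: measurable_lower_box.
  move: B; apply: smallest_sub; first exact: smallest_sigma_algebra.
  move=> B; rewrite -bigcup_seq => -[i _ [C mC <-]].
  have : @measurable_fun _ _ (g_sigma_algebraType [set lower_box b | b in setT])
      _ setT (fun v : 'rV[R]_n => v 0 i).
    apply: (measurability _ (RGenInftyO.measurableE R)).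
    move=> _ [_ [r ->] <-]; rewrite setTI.
    (* A half-space in one coordinate is the union of lower boxes whose other bounds tend to
       infinity. *)
    rewrite (_ : _ @^-1` _ = \bigcup_(k : nat)
        lower_box (fun j => if j == i then r else k%:R)).
      apply: bigcupT_measurable => k; apply: sub_sigma_algebra.
      by eexists.
    apply/seteqP; split => [v /=|v [k _ /(_ i)]]; last first.
      by rewrite eqxx /= in_itv.
    rewrite in_itv/= => vr.
    have [k Hk] := lt_nat_rV v; exists k => // j; case: eqP => [->//|_].
    exact: le_lt_trans (ler_norm _) (Hk j).
  by apply.
- move=> _ _ [a _ <-] [b _ <-]; exists (fun i => Num.min (a i) (b i)) => //.
  apply/seteqP; split => [v /= H|v /= [H1 H2] i]; last by rewrite lt_min H1 H2.
  by split => i; have := H i; rewrite lt_min => /andP[].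
- by move=> k; exists (fun=> k%:R).
- apply/seteqP; split => // v _.
  have [k Hk] := lt_nat_rV v; exists k => // j.
  exact: le_lt_trans (ler_norm _) (Hk j).
- by move=> _ [b _ <-].
- move=> k; apply: le_lt_trans m1oo; apply: le_measure => //; rewrite inE//.
  exact: measurable_lower_box.
Qed.

End borel_rV.

(** * Tonelli on row vectors and integrals of partial derivatives *)

Section lebesgue_rV_integral.
Context (R : realType).
Local Notation lam := (@lebesgue_measure R).
Local Notation L := (lebesgue_rV R).

Lemma lebesgue_rVS n : (L n.+1 : set _ -> \bar R) =
  pushforward (lam \x L n)%E (@rV_cons R n).
Proof. by []. Qed.

Lemma ge0_integral_rVS n (f : 'rV[R]_n.+1 -> \bar R) :
  measurable_fun setT f -> (forall w, 0 <= f w)%E ->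
  (\int[L n.+1]_w f w = \int[lam \x L n]_z f (rV_cons z))%E.
Proof.
move=> mf f0; rewrite lebesgue_rVS ge0_integral_pushforward//.
by apply: measurable_rV_cons.
Qed.

Lemma integral_rVS n (f : 'rV[R]_n.+1 -> \bar R) :
  measurable_fun setT f -> (lam \x L n)%E.-integrable setT (f \o rV_cons) ->
  (\int[L n.+1]_w f w = \int[lam \x L n]_z f (rV_cons z))%E.
Proof.
move=> mf f0; rewrite lebesgue_rVS integral_pushforward//.
by apply: measurable_rV_cons.
Qed.

(** Reduces the Gaussian integrals below to dimension one; as the factors are non-negative, Tonelli
    peels off one coordinate per induction step. *)
Lemma integral_rV_prod n (f : 'I_n -> R -> R) :
  (forall i, measurable_fun setT (f i)) -> (forall i x, 0 <= f i x) ->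
  (\int[L n]_v (\prod_(i < n) f i (v 0 i))%:E =
   \prod_(i < n) \int[lam]_x (f i x)%:E)%E.
Proof.
elim: n f => [|n IH] f mf f0.
  rewrite big_ord0 /=.
  under eq_integral do rewrite big_ord0.
  by rewrite integral_cst//= diracE mem_set// mule1.
have mprod k (g : 'I_k -> R -> R) : (forall i, measurable_fun setT (g i)) ->
    measurable_fun setT (fun v : 'rV[R]_k => (\prod_(i < k) g i (v 0 i))%:E).
  move=> mg; apply/measurable_EFinP; apply: measurable_prod => i _.
  by apply: (measurableT_comp (mg i)); exact: measurable_coord.
rewrite ge0_integral_rVS; last 2 first.
- exact: (mprod n.+1 f mf).
- by move=> w; rewrite lee_fin prodr_ge0.
rewrite fubini_tonelli1; last 2 first.
- by apply: (measurableT_comp (mprod n.+1 f mf)); exact: measurable_rV_cons.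
- by move=> w; rewrite lee_fin prodr_ge0.
rewrite /fubini_F big_ord_recl.
under eq_integral => x _.
  under eq_integral => v _.
    rewrite big_ord_recl EFinM [rV_cons _ 0 ord0]mxE unlift_none/=.
    under eq_bigr do rewrite mxE liftK/=.
    over.
  rewrite ge0_integralZl//=; last 3 first.
  - exact: (mprod n (fun i => f (lift ord0 i)) (fun i => mf (lift ord0 i))).
  - by move=> v _; rewrite lee_fin prodr_ge0.
  - by rewrite lee_fin.
  rewrite (IH (fun i => f (lift ord0 i)))//; over.
rewrite ge0_integralZr//; last 3 first.
- by apply/measurable_EFinP; exact: mf.
- by move=> x _; rewrite lee_fin.
- by rewrite prode_ge0// => i _; apply: integral_ge0 => x _; rewrite lee_fin.
Qed.

(** Cubes rather than balls, because [lebesgue_rV_box] gives their measure and they are compact as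
    products of segments. *)
Definition cube n (K : R) : set 'rV[R]_n := [set v | forall i, `|v 0 i| <= K].
Arguments cube : clear implicits.

Lemma cubeE n K : cube n K = [set v | forall i, `[- K, K]%classic (v 0 i)].
Proof. by apply/seteqP; split => v /= H i; have := H i; rewrite in_itv/= ler_norml. Qed.

Lemma measurable_cube n K : measurable (cube n K).
Proof. by rewrite cubeE; apply: (measurable_forall_coord (A := fun i => `[- K, K]%classic)). Qed.

Lemma compact_cube n K : compact (cube n K).
Proof.
rewrite cubeE; apply: (@rV_compact R n (fun=> `[- K, K]%classic)) => _.
exact: segment_compact.
Qed.

Lemma lebesgue_cube_lty n K : (L n (cube n K) < +oo)%E.
Proof.
rewrite cubeE (lebesgue_rV_box (A := fun i => `[- K, K]%classic))//.
rewrite -ge0_fin_numE ?prode_ge0//; elim/big_ind : _ => //.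
  by move=> x y; exact: fin_numM.
by move=> i _; rewrite lebesgue_measure_itv/=; case: ifP.
Qed.

Lemma compact_sub_cube n (A : set 'rV[R]_n) : compact A -> exists K, A `<=` cube n K.
Proof.
move=> /compact_bounded[M [_ /(_ (M + 1))]]; rewrite ltrDl ltr01 => /(_ isT) AM.
exists (M + 1) => v /AM; rewrite /Num.norm/= mx_normrE => /bigmax_leP[_ H] i.
exact: (H (0, i)).
Qed.

Lemma compact_lebesgue_lty n (A : set 'rV[R]_n) : compact A -> (L n A < +oo)%E.
Proof.
move=> cA; have [K AK] := compact_sub_cube cA.
apply: le_lt_trans (lebesgue_cube_lty n K); apply: le_measure => //; rewrite inE.
  exact: compact_measurable_rV.
exact: measurable_cube.
Qed.

Lemma continuous_compact_bounded n (A : set 'rV[R]_n) (f : 'rV[R]_n -> R) :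
  continuous f -> compact A -> exists M, forall x, A x -> `|f x| <= M.
Proof.
move=> cf cA; have /compact_bounded[M [_ /(_ (M + 1))]] : compact (f @` A).
  by apply: continuous_compact => //; exact: continuous_subspaceT.
rewrite ltrDl ltr01 => /(_ isT) H.
by exists (M + 1) => x Ax; apply: H; exists x.
Qed.

Lemma continuous_loc_integrable n (f : 'rV[R]_n -> R) :
  continuous f -> loc_integrable f.
Proof.
move=> cf A cA; apply: measurable_bounded_integrable.
- exact: compact_measurable_rV.
- exact: compact_lebesgue_lty.
- by apply: measurable_funTS; exact: continuous_measurable_rV.
- have [M HM] := continuous_compact_bounded cf cA.
  by exists M; split; [exact: num_real|move=> y My x Ax; apply: le_trans (HM x Ax) (ltW My)].
Qed.

Lemma cube_support_integrable n (f : 'rV[R]_n -> R) K :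
  continuous f -> (forall v, ~ cube n K v -> f v = 0) ->
  (L n).-integrable setT (EFin \o f).
Proof.
move=> cf f0; have -> : EFin \o f = (EFin \o f) \_ (cube n K).
  apply/funext => v; rewrite patchE; case: ifPn => //.
  by rewrite notin_setE => /f0 /= ->.
rewrite -integrable_mkcond; last exact: measurable_cube.
exact/continuous_loc_integrable/compact_cube.
Qed.

(** The two difference quotients are the same function, since moving the head of [rV_cons] is moving
    along the first basis vector. *)
Lemma is_derive_rV_cons0 n (h : 'rV[R]_n.+1 -> R) v x d :
  is_derive (rV_cons (x, v)) (delta_mx 0 ord0) h d ->
  is_derive x 1 (fun y => h (rV_cons (y, v))) d.
Proof.
have E : (fun t => t^-1 *: (((fun y => h (rV_cons (y, v))) \o shift x) (t *: 1) -
      h (rV_cons (x, v)))) =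
    (fun t => t^-1 *: ((h \o shift (rV_cons (x, v))) (t *: delta_mx 0 ord0) -
      h (rV_cons (x, v)))).
  apply/funext => t /=; congr (_ *: (h _ - _)).
  apply/rowP => j; rewrite !mxE/=; case: unliftP => [k ->|->] /=.
    by rewrite mulr0 add0r.
  by rewrite mulr1/= [_ *: 1]mulr1.
by move=> [H1 H2]; split; rewrite /derivable /derive E.
Qed.

Lemma is_derive_rV_cons_lift n i (h : 'rV[R]_n.+1 -> R) v x d :
  is_derive (rV_cons (x, v)) (delta_mx 0 (lift ord0 i)) h d ->
  is_derive v (delta_mx 0 i) (fun w => h (rV_cons (x, w))) d.
Proof.
have E : (fun t => t^-1 *: (((fun w => h (rV_cons (x, w))) \o shift v)
      (t *: delta_mx 0 i) - h (rV_cons (x, v)))) =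
    (fun t => t^-1 *: ((h \o shift (rV_cons (x, v)))
      (t *: delta_mx 0 (lift ord0 i)) - h (rV_cons (x, v)))).
  apply/funext => t /=; congr (_ *: (h _ - _)).
  apply/rowP => j; rewrite !mxE/=; case: unliftP => [k ->|->] /=.
    by rewrite !mxE/= (inj_eq lift_inj).
  by rewrite mulr0 add0r.
by move=> [H1 H2]; split; rewrite /derivable /derive E.
Qed.

Lemma cvg_rV (T : topologicalType) n (F : set_system T) (FF : Filter F) (f : T -> 'rV[R]_n)
    (l : 'rV[R]_n) :
  (forall i, f x 0 i @[x --> F] --> l 0 i) -> f x @[x --> F] --> l.
Proof.
move=> cf A [P Px PA].
have : \forall y \near F, forall i : 'I_n, P 0 i (f y 0 i).
  by apply: filter_forall => i; exact: (cf i _ (Px 0 i)).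
by apply: filterS => y Py; apply: PA => i j; rewrite (ord1 i); exact: Py.
Qed.

Lemma continuous_rV_consl n (v : 'rV[R]_n) : continuous (fun x => rV_cons (x, v)).
Proof.
move=> x; apply: cvg_rV => i; rewrite mxE.
under eq_fun do rewrite mxE.
by case: unliftP => [k _|_] /=; [exact: cvg_cst|exact: cvg_id].
Qed.

Lemma continuous_rV_consr n x : continuous (fun v : 'rV[R]_n => rV_cons (x, v)).
Proof.
move=> v; apply: (@cvg_rV _ _ _ (nbhs_filter v)) => i; rewrite mxE.
under eq_fun do rewrite mxE.
by case: unliftP => [k _|_] /=; [exact: coord_continuous|exact: cvg_cst].
Qed.

(** Fubini brings the direction [i] to the inside: coordinates before it are removed by the
    induction, and once it is the head the fundamental theorem of calculus gives a difference of
    values of [h] outside the cube. *)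
Lemma integral_partial_eq0 n (i : 'I_n) (h g : 'rV[R]_n -> R) K :
  (forall v, is_derive v (delta_mx 0 i) h (g v)) -> continuous g ->
  (forall v, ~ cube n K v -> h v = 0) -> (forall v, ~ cube n K v -> g v = 0) ->
  (\int[L n]_v (g v)%:E = 0)%E.
Proof.
elim: n i h g => [[]//|n IH] i h g dh cg h0 g0.
have mg := continuous_measurable_rV cg.
have ig := cube_support_integrable cg g0.
have ig' : (lam \x L n)%E.-integrable setT (fun z => (g (rV_cons z))%:E).
  apply/integrableP; split.
    apply/measurable_EFinP; apply: (measurableT_comp mg).
    exact: measurable_rV_cons.
  have /integrableP[_] := ig.
  by rewrite ge0_integral_rVS//; apply: measurableT_comp => //; exact/measurable_EFinP.
rewrite integral_rVS//; last exact/measurable_EFinP.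
case: (unliftP ord0 i) dh => [j|] -> dh.
  rewrite -integral12_prod_meas1// /fubini_F integral0_eq// => x _.
  apply: (IH j (fun v => h (rV_cons (x, v)))).
  - by move=> v; exact: (is_derive_rV_cons_lift (dh _)).
  - by move=> v; apply: continuous_comp; [exact: continuous_rV_consr|exact: cg].
  - move=> v Kv; apply: h0 => H; apply: Kv => k.
    by have := H (lift ord0 k); rewrite mxE liftK.
  - move=> v Kv; apply: g0 => H; apply: Kv => k.
    by have := H (lift ord0 k); rewrite mxE liftK.
rewrite -integral21_prod_meas1// /fubini_G integral0_eq// => v _.
(* Slightly larger than [K], so that the end points [- K1] and [K1] already lie outside the cube,
   where [h] and [g] vanish. *)
pose K1 := `|K| + 1.
have K10 : 0 < K1 by rewrite ltr_pwDr.
have KK1 (x : R) : K1 <= `|x| -> ~ cube n.+1 K (rV_cons (x, v)).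
  move=> Kx /(_ ord0); rewrite mxE unlift_none/=; apply/negP; rewrite -ltNge.
  by apply: lt_le_trans Kx; rewrite (le_lt_trans (ler_norm _))// ltrDl.
have dhx (x : R) : is_derive x 1 (fun y => h (rV_cons (y, v))) (g (rV_cons (x, v))).
  exact: is_derive_rV_cons0.
have -> : (fun x => (g (rV_cons (x, v)))%:E) =
    (fun x => (g (rV_cons (x, v)))%:E) \_ `[- K1, K1].
  apply/funext => x; rewrite patchE; case: ifPn => //.
  rewrite notin_setE/= in_itv/= -ler_norml => /negP; rewrite -ltNge => /ltW H.
  by rewrite g0//; exact: KK1.
rewrite -integral_mkcond.
rewrite (@continuous_FTC2 _ _ (fun x => h (rV_cons (x, v)))).
- by rewrite !h0 ?subee//; apply: KK1; rewrite ?normrN ger0_norm// ltW.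
- by rewrite gtrN.
- apply: continuous_subspaceT => x.
  by apply: continuous_comp; [exact: continuous_rV_consl|exact: cg].
- have dc (x : R) : {for x, continuous (fun x => h (rV_cons (x, v)))}.
    by apply: differentiable_continuous; apply/derivable1_diffP; exact: ex_derive.
  split => [x _||]; first exact: ex_derive.
  + exact/cvg_at_right_filter/dc.
  + exact/cvg_at_left_filter/dc.
- by move=> x _; rewrite derive1E; exact: derive_val.
Qed.

End lebesgue_rV_integral.
Arguments cube {R} n K.

(** * Classical derivatives are weak derivatives *)

Section weak_derivatives.
Context (R : realType).
Local Notation L := (lebesgue_rV R).

(** Integration by parts: [f * phi] vanishes outside a cube, so the integral of its derivative is
    zero. *)
Lemma weak_partial_C1 n (i : 'I_n) (f g : 'rV[R]_n -> R) :
  continuous f -> continuous g ->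
  (forall x, is_derive x (delta_mx 0 i) f (g x)) -> weak_partial i f g.
Proof.
move=> cf cg df; split; [exact: continuous_loc_integrable..|].
move=> phi [/(_ 1%N) [cphi dphi] cs].
have [dphii cdphi] := dphi i; have {}cdphi : continuous (partial i phi) by [].
have [K HK] := compact_sub_cube cs.
(* Vanishing near [v], and not only at [v], is what makes the derivative of [phi] vanish there
   too. *)
have phi0 v : ~ cube n K v -> \forall w \near v, phi w = 0.
  move=> Kv; have : (~` closure [set x | phi x != 0]) v by move=> /HK.
  move=> H; have := open_nbhs_nbhs (conj (closed_openC (@closed_closure _ _)) H).
  apply: filterS => w /= Hw; apply/eqP/negP => /negP w0.
  by apply: Hw; exact: subset_closure.
have phi0' v : ~ cube n K v -> phi v = 0 by move=> /phi0/nbhs_singleton.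
have dphi0 v : ~ cube n K v -> partial i phi v = 0.
  move=> /phi0 H; rewrite /partial (@near_eq_derive _ _ _ _ (cst 0))//.
  exact: derive_cst.
pose h v := f v * phi v.
pose k v := f v * partial i phi v + g v * phi v.
have cM (a b : 'rV[R]_n -> R) : continuous a -> continuous b ->
    continuous (fun x => a x * b x).
  by move=> ca cb x; exact: (@continuousM _ _ a b x (ca x) (cb x)).
have dh v : is_derive v (delta_mx 0 i) h (k v).
  have dp : is_derive v (delta_mx 0 i) phi (partial i phi v) by split.
  have -> : k v = f v *: partial i phi v + phi v *: g v by rewrite /k (mulrC (g v)).
  exact: is_deriveM.
have i1 : (L n).-integrable setT (EFin \o (fun v => f v * partial i phi v)).
  by apply: (@cube_support_integrable _ _ _ K) => [|v Kv]; [exact: cM|rewrite dphi0// mulr0].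
have i2 : (L n).-integrable setT (EFin \o (fun v => g v * phi v)).
  by apply: (@cube_support_integrable _ _ _ K) => [|v Kv]; [exact: cM|rewrite phi0'// mulr0].
have := @integral_partial_eq0 _ _ i h k K dh.
move=> H; apply/eqP; rewrite -subr_eq0 opprK -RintegralD//.
rewrite /Rintegral H//.
- by move=> x; apply: (@continuousD _ _ _ (fun v => f v * partial i phi v) (fun v => g v * phi v)); exact: cM.
- by move=> v Kv; rewrite /h phi0'// mulr0.
- by move=> v Kv; rewrite /k phi0'// dphi0// !mulr0 addr0.
Qed.

End weak_derivatives.

(** * Measures given by a density *)

Section density_measure.
Context d (T : measurableType d) (R : realType).
Variables (mu : {measure set T -> \bar R}) (p : T -> R).
Hypotheses (mp : measurable_fun setT p) (p0 : forall x, 0 <= p x).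

(** The two proofs are arguments so that the measure structure can be attached to the term
    itself. *)
Definition mdensity of measurable_fun setT p & (forall x, 0 <= p x) :=
  fun A : set T => (\int[mu]_(x in A) (p x)%:E)%E.

Local Notation nu := (mdensity mp p0).

Let mdensity0 : nu set0 = 0%E.
Proof. by rewrite /mdensity integral_set0. Qed.

Let mdensity_ge0 A : (0 <= nu A)%E.
Proof. by apply: integral_ge0 => x _; rewrite lee_fin. Qed.

Let mdensity_sigma_additive : semi_sigma_additive nu.
Proof.
move=> /= A mA tA mUA; rewrite /mdensity ge0_integral_bigcup//.
- apply: is_cvg_ereal_nneg_natsum_cond => n _ _.
  by apply: integral_ge0 => /= x ?; rewrite lee_fin.
- by apply/measurable_EFinP; exact: measurable_funTS.
- by move=> x _; rewrite lee_fin.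
Qed.

HB.instance Definition _ := isMeasure.Build _ _ _
  nu mdensity0 mdensity_ge0 mdensity_sigma_additive.

End density_measure.

Section integral_density.
Import HBNNSimple.
Context d (T : measurableType d) (R : realType).
Variables (mu nu : {measure set T -> \bar R}) (p : T -> R).
Hypotheses (mp : measurable_fun setT p) (p0 : forall x, 0 <= p x).
Hypothesis nuE : forall A, measurable A -> nu A = (\int[mu]_(x in A) (p x)%:E)%E.

(** The identity is the hypothesis [nuE] on indicators, hence holds on simple functions, and
    monotone convergence on both sides extends it. *)
Lemma ge0_integral_density (f : T -> \bar R) :
  measurable_fun setT f -> (forall x, 0 <= f x)%E ->
  (\int[nu]_x f x = \int[mu]_x (f x * (p x)%:E))%E.
Proof.
move=> mf f0; pose h := nnsfun_approx measurableT mf.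
have hnd x : {homo (fun n => (h n x)%:E) : n m / (n <= m)%N >-> (n <= m)%E}.
  by move=> a b ab; rewrite lee_fin; exact/lefP/nd_nnsfun_approx.
have -> : (\int[nu]_x f x = lim (\int[nu]_x (h n x)%:E @[n --> \oo]))%E.
  have fE x : f x = lim ((h n x)%:E @[n --> \oo])%E.
    by apply/esym/cvg_lim => //; exact: cvg_nnsfun_approx.
  under eq_integral do rewrite fE.
  apply: monotone_convergence => //.
  - by move=> n; exact/measurable_EFinP.
  - by move=> n x _; rewrite lee_fin.
have -> : (\int[mu]_x (f x * (p x)%:E) =
    lim (\int[mu]_x ((h n x)%:E * (p x)%:E) @[n --> \oo]))%E.
  have fg x : (f x * (p x)%:E = lim (((h n x)%:E * (p x)%:E) @[n --> \oo]))%E.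
    by apply/esym/cvg_lim => //; apply: cvgeZr => //; exact: cvg_nnsfun_approx.
  under eq_integral do rewrite fg.
  apply: monotone_convergence => //.
  - by move=> n; apply/measurable_EFinP/measurable_funM.
  - by move=> n x _; rewrite lee_fin mulr_ge0.
  - by move=> x _ a b ab/=; rewrite lee_wpmul2r ?lee_fin//; exact: hnd.
suff E n : (\int[nu]_x (h n x)%:E = \int[mu]_x ((h n x)%:E * (p x)%:E))%E.
  by under eq_fun do rewrite E.
rewrite integralT_nnsfun sintegralE.
under [RHS]eq_integral do rewrite fimfunE -EFinM mulr_fsuml -fsumEFin//.
rewrite ge0_integral_fsum//.
- apply: eq_fsbigr => r; rewrite inE => -[x _ <-].
  rewrite nuE// integral_mkcond -ge0_integralZl//; last by rewrite lee_fin.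
  + apply: eq_integral => y _; rewrite patchE -mulrA EFinM; congr (_ * _)%E.
    by rewrite indicE; case: ifPn => _; rewrite ?mul1r ?mul0r.
  + apply: (measurable_restrictT (fun x => (p x)%:E) _).1 => //.
    by apply/measurable_EFinP; exact: measurable_funTS.
  + by move=> y _; rewrite patchE; case: ifPn => // _; rewrite lee_fin.
- by move=> r; apply/measurable_EFinP; apply: measurable_funM => //; exact: measurable_funM.
- move=> r y _; rewrite lee_fin mulr_ge0//.
  by have := nnfun_muleindic_ge0 (h n) r y; rewrite lee_fin.
Qed.

End integral_density.

(** * Gaussian kernels *)

Lemma continuous_prod (R : realType) (T : topologicalType) (I : Type) (r : seq I)
    (F : I -> T -> R) : (forall i, continuous (F i)) ->
  continuous (fun x => \prod_(i <- r) F i x).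
Proof.
move=> cF; elim: r => [|i r IH] x.
  by under eq_fun do rewrite big_nil; exact: cvg_cst.
under eq_fun do rewrite big_cons.
by apply: cvgM; [exact: cF|exact: IH].
Qed.

Lemma continuous_sum (R : realType) (T : topologicalType) (I : Type) (r : seq I)
    (F : I -> T -> R) : (forall i, continuous (F i)) ->
  continuous (fun x => \sum_(i <- r) F i x).
Proof.
move=> cF; elim: r => [|i r IH] x.
  by under eq_fun do rewrite big_nil; exact: cvg_cst.
under eq_fun do rewrite big_cons.
by apply: cvgD; [exact: cF|exact: IH].
Qed.

Section gaussian_kernel.
Context (R : realType).
Local Notation lam := (@lebesgue_measure R).
Local Notation L := (lebesgue_rV R).
Implicit Types a c d h u x y : R.

(** The parameter is the variance, not the standard deviation as in [normal_pdf], so that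
    convolution adds parameters. *)
Definition gauss1 a x := (Num.sqrt (a * pi *+ 2))^-1 * expR (- x ^+ 2 / (a *+ 2)).

Lemma gauss1E a x y : 0 < a -> gauss1 a (x - y) = normal_pdf y (Num.sqrt a) x.
Proof.
move=> a0; have s0 : Num.sqrt a != 0 by rewrite gt_eqF// sqrtr_gt0.
by rewrite normal_pdfE// /normal_peak /normal_fun sqr_sqrtr ?ltW.
Qed.

Lemma gauss1_ge0 a x : 0 <= gauss1 a x.
Proof. by rewrite mulr_ge0 ?expR_ge0// invr_ge0 sqrtr_ge0. Qed.

Lemma continuous_gauss1 a : continuous (gauss1 a).
Proof.
move=> x; apply: cvgM; first exact: cvg_cst.
apply: (@continuous_comp _ _ _ (fun x => - x ^+ 2 / (a *+ 2)) expR).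
  apply: cvgM; last exact: cvg_cst.
  by apply: cvgN; exact: exprn_continuous.
exact: continuous_expR.
Qed.

Lemma measurable_gauss1 a : measurable_fun setT (gauss1 a).
Proof. by apply: continuous_measurable_fun; exact: continuous_gauss1. Qed.

(** Completing the square in [z]: the product of the two densities is the claimed value times a
    normal density in [z] of variance [w] and mean [k], which integrates to 1. *)
Lemma gauss1_conv a h c u y : 0 < a -> 0 < h ->
  (\int[lam]_z (gauss1 a (u - c * z) * gauss1 h (z - y))%:E =
   (gauss1 (a + c ^+ 2 * h) (u - c * y))%:E)%E.
Proof.
move=> a0 h0; set s := a + c ^+ 2 * h.
have s0 : 0 < s by rewrite ltr_wpDr// mulr_ge0 ?sqr_ge0// ltW.
pose w := a * h / s; have w0 : 0 < w by rewrite divr_gt0// mulr_gt0.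
pose k := y + c * h / s * (u - c * y).
under eq_integral => z _.
  have -> : gauss1 a (u - c * z) * gauss1 h (z - y) =
      gauss1 s (u - c * y) * gauss1 w (z - k).
    rewrite /gauss1 mulrACA -expRD [RHS]mulrACA -expRD; congr (_ * expR _); last first.
      rewrite /w /k /s; field.
      by rewrite !gt_eqF.
    rewrite -!invfM -!sqrtrM ?mulrn_wge0 ?mulr_ge0 ?pi_ge0 1?ltW//.
    congr (Num.sqrt _)^-1; rewrite /w; field.
    by rewrite gt_eqF.
  rewrite EFinM (gauss1E z k w0); over.
rewrite integralZl//; last exact: integrable_normal_pdf.
by rewrite integral_normal_pdf mule1.
Qed.

Lemma integral_gauss1 a y : 0 < a -> (\int[lam]_x (gauss1 a (x - y))%:E = 1)%E.
Proof.
move=> a0; under eq_integral do rewrite gauss1E//.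
exact: integral_normal_pdf.
Qed.

Lemma gauss1_le_peak a x : 0 < a -> gauss1 a x <= (Num.sqrt (a * pi *+ 2))^-1.
Proof.
move=> a0; rewrite ler_piMr ?invr_ge0 ?sqrtr_ge0// -expR0 ler_expR mulNr oppr_le0.
by rewrite divr_ge0 ?sqr_ge0// mulrn_wge0// ltW.
Qed.

(* the exponential of half the exponent absorbs any polynomial weight *)
Lemma gauss1_double a x : 0 < a ->
  gauss1 a x = Num.sqrt 2 * gauss1 (a *+ 2) x * expR (- x ^+ 2 / (a *+ 4)).
Proof.
move=> a0; rewrite /gauss1.
have -> : Num.sqrt (a *+ 2 * pi *+ 2) = Num.sqrt 2 * Num.sqrt (a * pi *+ 2).
  by rewrite -sqrtrM//; congr Num.sqrt; ring.
rewrite invfM !mulrA divff ?mul1r; last by rewrite gt_eqF// sqrtr_gt0.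
rewrite -mulrA -expRD; congr (_ * expR _).
by field; rewrite gt_eqF.
Qed.

(** With t = x^2 / (4a), the bound [e^(-t) <= 1/t] uses up half of the exponent; the other half
    remains as a kernel of doubled variance, so the right-hand side is still integrable. *)
Lemma gauss1_tail a d x : 0 < a -> 0 < d -> d <= `|x| ->
  gauss1 a x <= Num.sqrt 2 * (a *+ 4) / d ^+ 2 * gauss1 (a *+ 2) x.
Proof.
move=> a0 d0 dx; rewrite gauss1_double//.
have -> : Num.sqrt 2 * (a *+ 4) / d ^+ 2 * gauss1 (a *+ 2) x =
  Num.sqrt 2 * gauss1 (a *+ 2) x * ((a *+ 4) / d ^+ 2) by ring.
apply: ler_wpM2l; first by rewrite mulr_ge0 ?sqrtr_ge0 ?gauss1_ge0.
have a4 : 0 < a *+ 4 by rewrite pmulrn_lgt0.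
have dx2 : d ^+ 2 <= x ^+ 2.
  by rewrite -[leRHS]real_normK ?num_real// lerXn2r ?nnegrE ?normr_ge0// ltW.
have x2 : 0 < x ^+ 2 by apply: lt_le_trans dx2; rewrite exprn_gt0.
rewrite mulNr expRN; apply: (@le_trans _ _ (x ^+ 2 / (a *+ 4))^-1).
  rewrite lef_pV2 ?posrE ?expR_gt0 ?divr_gt0//; apply: le_trans (expR_ge1Dx _).
  by rewrite lerDr.
rewrite invf_div; apply: ler_wpM2l; first exact: ltW.
by rewrite lef_pV2// posrE exprn_gt0.
Qed.

Variable n : nat.
Implicit Types (U V W : 'rV[R]_n).

Definition gauss a U := \prod_(i < n) gauss1 a (U 0 i).

Lemma gauss_ge0 a U : 0 <= gauss a U.
Proof. by apply: prodr_ge0 => i _; exact: gauss1_ge0. Qed.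

Lemma continuous_gauss a : continuous (gauss a).
Proof.
apply: continuous_prod => i U.
by apply: (@continuous_comp _ _ _ (fun V => V 0 i)); [exact: coord_continuous|exact: continuous_gauss1].
Qed.

Lemma measurable_gauss a : measurable_fun setT (gauss a).
Proof. by apply: continuous_measurable_rV; exact: continuous_gauss. Qed.

Lemma gaussE a U : gauss a U =
  (Num.sqrt (a * pi *+ 2))^-1 ^+ n * expR (- enorm U ^+ 2 / (a *+ 2)).
Proof.
rewrite /gauss big_split/= prodr_const card_ord; congr (_ * _).
rewrite -expR_sum; congr expR.
rewrite /enorm sqr_sqrtr ?sumr_ge0// => [|i _]; last exact: sqr_ge0.
by rewrite -sumrN mulr_suml.
Qed.

Lemma gauss_conv a h c U Y : 0 < a -> 0 < h ->
  (\int[L n]_V (gauss a (U - c *: V) * gauss h (V - Y))%:E =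
   (gauss (a + c ^+ 2 * h) (U - c *: Y))%:E)%E.
Proof.
move=> a0 h0; under eq_integral => V _.
  rewrite /gauss -big_split/=.
  under eq_bigr do rewrite !mxE.
  over.
rewrite (integral_rV_prod
  (f := fun i z => gauss1 a (U 0 i - c * z) * gauss1 h (z - Y 0 i))).
- under eq_bigr do rewrite gauss1_conv//.
  by rewrite /gauss prodEFin; congr EFin; apply: eq_bigr => i _; rewrite !mxE.
- move=> i; apply: measurable_funM; last first.
    by apply: measurableT_comp; [exact: measurable_gauss1|exact: measurable_funB].
  apply: measurableT_comp; first exact: measurable_gauss1.
  by apply: measurable_funB => //; exact: measurable_funM.
- by move=> i x; rewrite mulr_ge0// gauss1_ge0.
Qed.

Lemma integral_gauss a V : 0 < a -> (\int[L n]_U (gauss a (U - V))%:E = 1)%E.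
Proof.
move=> a0; under eq_integral => U _.
  rewrite /gauss.
  under eq_bigr do rewrite !mxE.
  over.
rewrite (integral_rV_prod (f := fun i z => gauss1 a (z - V 0 i))).
- rewrite big1// => i _; under eq_integral do rewrite gauss1E//.
  exact: integral_normal_pdf.
- move=> i; apply: measurableT_comp; first exact: measurable_gauss1.
  exact: measurable_funB.
- by move=> i x; exact: gauss1_ge0.
Qed.

End gaussian_kernel.

(** * Lipschitz bounds and dependence on the variance *)

Section gaussian_estimates.
Context (R : realType).
Implicit Types a c d h u x y : R.

Lemma is_derive_gauss1 a x : is_derive x 1 (gauss1 a) (gauss1 a x * (- x *+ 2 / (a *+ 2))).
Proof.
have H : is_derive x 1 (fun z : R => - z ^+ 2 / (a *+ 2)) (- x *+ 2 / (a *+ 2)).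
  have E : (fun z : R => - z ^+ 2 / (a *+ 2)) = (- (a *+ 2)^-1) \*: (fun z => z ^+ 2).
    by apply/funext => z /=; rewrite /GRing.scale/= mulrC mulrN mulNr.
  rewrite E; apply: is_derive_eq.
  by rewrite /GRing.scale/= mulr1 -mulr2n mulrC mulrN mulNrn mulNr.
rewrite /gauss1.
have := is_deriveZ (Num.sqrt (a * pi *+ 2))^-1 (is_derive1_comp (is_derive_expR _) H).
by rewrite -mulrA.
Qed.

Lemma gauss1_lipschitz a : 0 < a ->
  exists2 C, 0 <= C & forall x y, `|gauss1 a x - gauss1 a y| <= C * `|x - y|.
Proof.
move=> a0; set K := (Num.sqrt (a * pi *+ 2))^-1.
have K0 : 0 <= K by rewrite invr_ge0 sqrtr_ge0.
(* The derivative has absolute value K e^(-x^2/2a) |x| / a, and |x| <= 1 + x^2 <= (1 + 2a)(1 +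
   x^2/2a) <= (1 + 2a) e^(x^2/2a). *)
exists (K * (1 + a *+ 2) / a); first by rewrite !mulr_ge0 ?invr_ge0 ?addr_ge0 ?mulrn_wge0 // ltW.
have db x : `|gauss1 a x * (- x *+ 2 / (a *+ 2))| <= K * (1 + a *+ 2) / a.
  rewrite normrM ger0_norm ?gauss1_ge0// /gauss1 -/K -!mulrA ler_wpM2l//.
  have -> : `|- x *+ 2 / (a *+ 2)| = `|x| / a.
    rewrite (_ : - x *+ 2 / (a *+ 2) = - (x / a)); last by field; rewrite gt_eqF.
    by rewrite normrN normrM normfV (gtr0_norm a0).
  rewrite mulrA ler_wpM2r ?invr_ge0 ?(ltW a0)// mulNr expRN.
  rewrite ler_pdivrMl ?expR_gt0// mulrC.
  have e1 : 1 + x ^+ 2 / (a *+ 2) <= expR (x ^+ 2 / (a *+ 2)) := expR_ge1Dx _.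
  apply: le_trans (ler_wpM2l _ e1); last by rewrite addr_ge0// mulrn_wge0// ltW.
  have x2 : 0 <= x ^+ 2 / (a *+ 2) by rewrite divr_ge0 ?sqr_ge0// mulrn_wge0// ltW.
  have -> : (1 + a *+ 2) * (1 + x ^+ 2 / (a *+ 2)) =
      1 + x ^+ 2 + a *+ 2 + x ^+ 2 / (a *+ 2) by field; rewrite gt_eqF.
  have : `|x| <= 1 + x ^+ 2 by rewrite -[x ^+ 2]real_normK ?num_real//; nra.
  have : 0 <= a *+ 2 by rewrite mulrn_wge0// ltW.
  lra.
have lip x y : x <= y -> `|gauss1 a y - gauss1 a x| <= K * (1 + a *+ 2) / a * `|y - x|.
  move=> xy; have [c _ ->] := MVT_segment xy (fun z _ => is_derive_gauss1 a z)
    (continuous_subspaceT (@continuous_gauss1 _ a)).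
  by rewrite normrM ler_wpM2r.
move=> x y; have [/lip|/ltW/lip //] := leP x y.
by rewrite distrC (distrC y).
Qed.

(** The factors are exchanged one at a time while the others are bounded by the peak, which is why
    the distance is the sum of the coordinate distances. *)
Lemma gauss_lipschitz n a : 0 < a -> exists2 C, 0 <= C & forall U V : 'rV[R]_n,
  `|gauss a U - gauss a V| <= C * \sum_(i < n) `|U 0 i - V 0 i|.
Proof.
move=> a0; have [C C0 HC] := gauss1_lipschitz a0.
set K := (Num.sqrt (a * pi *+ 2))^-1; have K0 : 0 <= K by rewrite invr_ge0 sqrtr_ge0.
suff H : forall r : seq 'I_n, exists2 M, 0 <= M & forall U V : 'rV[R]_n,
    `|\prod_(i <- r) gauss1 a (U 0 i) - \prod_(i <- r) gauss1 a (V 0 i)| <=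
    M * \sum_(i <- r) `|U 0 i - V 0 i| by exact: H.
have bd (r : seq 'I_n) (U : 'rV[R]_n) : `|\prod_(i <- r) gauss1 a (U 0 i)| <= K ^+ size r.
  elim: r => [|i r IH]; first by rewrite big_nil normr1.
  rewrite big_cons normrM exprS ler_pM// ger0_norm ?gauss1_ge0//.
  exact: gauss1_le_peak.
elim=> [|i r [M M0 IH]].
  by exists 0 => // U V; rewrite !big_nil subrr normr0 mulr0.
exists (C * K ^+ size r + K * M); first by rewrite addr_ge0// mulr_ge0// exprn_ge0.
move=> U V; rewrite !big_cons.
set A := \prod_(j <- r) _; set B := \prod_(j <- r) _; set S := \sum_(j <- r) _.
have S0 : 0 <= S by apply: sumr_ge0.
have -> : gauss1 a (U 0 i) * A - gauss1 a (V 0 i) * B =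
  (gauss1 a (U 0 i) - gauss1 a (V 0 i)) * A + gauss1 a (V 0 i) * (A - B) by ring.
apply: le_trans (ler_normD _ _) _.
rewrite (normrM (_ - _)) (normrM (gauss1 _ _)).
apply: (@le_trans _ _ (C * `|U 0 i - V 0 i| * K ^+ size r + K * (M * S))).
  apply: lerD; first by apply: ler_pM => //; exact: bd.
  apply: ler_pM => //; last exact: IH.
  by rewrite ger0_norm ?gauss1_ge0// gauss1_le_peak.
rewrite mulrDr.
have : 0 <= C * K ^+ size r * S by rewrite !mulr_ge0// exprn_ge0.
have : 0 <= K * M * `|U 0 i - V 0 i| by rewrite !mulr_ge0.
set D := `|_|; set KK := K ^+ _; lra.
Qed.

Lemma gauss_le_peak n a (U : 'rV[R]_n) : 0 < a ->
  gauss a U <= (Num.sqrt (a * pi *+ 2))^-1 ^+ n.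
Proof.
move=> a0; rewrite /gauss -[n in X in _ <= X]card_ord -prodr_const.
by apply: ler_prod => i _; rewrite gauss1_ge0 gauss1_le_peak.
Qed.

(** A bound common to all variances at least [a], to serve as dominating constant when the variance
    moves. *)
Lemma gauss_le_peak2 n a h (U : 'rV[R]_n) : 0 < a -> a <= h ->
  gauss h U <= (Num.sqrt (a * pi *+ 2))^-1 ^+ n.
Proof.
move=> a0 ah; have h0 := lt_le_trans a0 ah.
apply: le_trans (gauss_le_peak U h0) _; apply: lerXn2r.
- by rewrite nnegrE invr_ge0 sqrtr_ge0.
- by rewrite nnegrE invr_ge0 sqrtr_ge0.
- rewrite lef_pV2 ?posrE ?sqrtr_gt0 ?pmulrn_lgt0 ?mulr_gt0 ?pi_gt0//.
  rewrite ler_sqrt; last by rewrite mulrn_wge0// mulr_ge0 ?pi_ge0// ltW.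
  by rewrite lerMn2r/= ler_wpM2r ?pi_ge0.
Qed.

Lemma cvg_gauss n (s : nat -> R) a (U : 'rV[R]_n) : 0 < a ->
  s k @[k --> \oo] --> a -> gauss (s k) U @[k --> \oo] --> gauss a U.
Proof.
move=> a0 sa; under eq_fun do rewrite gaussE; rewrite gaussE.
have s2 : (s k *+ 2)^-1 @[k --> \oo] --> (a *+ 2)^-1.
  apply: cvgV; first by rewrite gt_eqF// pmulrn_lgt0.
  by under eq_fun do rewrite mulr2n; rewrite mulr2n; exact: cvgD.
apply: cvgM.
  apply: (@cvg_comp _ _ _ (fun k => (Num.sqrt (s k * pi *+ 2))^-1) (fun x => x ^+ n)); last exact: exprn_continuous.
  apply: cvgV; first by rewrite gt_eqF// sqrtr_gt0 pmulrn_lgt0// mulr_gt0// pi_gt0.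
  apply: (@cvg_comp _ _ _ (fun k => (s k * pi *+ 2)) Num.sqrt); last exact: sqrt_continuous.
  under eq_fun do rewrite mulr2n; rewrite mulr2n.
  exact: (cvgD (cvgM sa (cvg_cst _)) (cvgM sa (cvg_cst _))).
apply: (@cvg_comp _ _ _ (fun k => - enorm U ^+ 2 / (s k *+ 2)) expR); last exact: continuous_expR.
exact: (cvgM (cvg_cst _) s2).
Qed.

End gaussian_estimates.

(** * Gaussian smoothing determines a probability measure *)

Section gauss_kernel_unique.
Context (R : realType).
Local Notation lam := (@lebesgue_measure R).
Local Notation L := (lebesgue_rV R).

(** The variance [a_] decays faster than the square of the margin [d_], so the tail constant a / d^2
    of [gauss1_tail] is of order 1 / k. *)
Let a_ (k : nat) : R := k.+1%:R ^- 3.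
Let d_ (k : nat) : R := k.+1%:R^-1.

Let a_gt0 k : 0 < a_ k. Proof. by rewrite invr_gt0 exprn_gt0. Qed.
Let d_gt0 k : 0 < d_ k. Proof. by rewrite invr_gt0. Qed.

(** The half-line is shortened by the margin [d_ k] to make the limit at x = b equal to 0 instead of
    1/2; the limit is then the indicator of the open half-line at every point. *)
Let smoothed k (b x : R) : \bar R :=
  (\int[lam]_y (\1_`]-oo, (b - d_ k)[ y * gauss1 (a_ k) (y - x))%:E)%E.

Let mgauss1 a x : measurable_fun setT (fun y : R => gauss1 a (y - x)).
Proof.
by apply: measurableT_comp; [exact: measurable_gauss1|exact: measurable_funB].
Qed.

Let smoothedC k (b x : R) : (smoothed k b x +
  \int[lam]_y (\1_`[(b - d_ k), +oo[ y * gauss1 (a_ k) (y - x))%:E = 1)%E.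
Proof.
rewrite /smoothed -ge0_integralD//.
- rewrite -(integral_gauss1 x (a_gt0 k)); apply: eq_integral => y _.
  rewrite -EFinD -mulrDl !indicE !mem_setE !in_itv/= andbT.
  by case: ltP => _; rewrite ?addr0 ?add0r mul1r.
- by move=> y _; rewrite lee_fin mulr_ge0// gauss1_ge0.
- by apply/measurable_EFinP/measurable_funM => //; exact: mgauss1.
- by move=> y _; rewrite lee_fin mulr_ge0// gauss1_ge0.
- by apply/measurable_EFinP/measurable_funM => //; exact: mgauss1.
Qed.

Let smoothed_ge0 k b x : (0 <= smoothed k b x)%E.
Proof. by apply: integral_ge0 => y _; rewrite lee_fin mulr_ge0// gauss1_ge0. Qed.

Let smoothed_le1 k b x : (smoothed k b x <= 1)%E.
Proof.
rewrite -(smoothedC k b x) leeDl//.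
by apply: integral_ge0 => y _; rewrite lee_fin mulr_ge0// gauss1_ge0.
Qed.

Let smoothed_fin k b x : smoothed k b x \is a fin_num.
Proof. by rewrite ge0_fin_numE//; apply: le_lt_trans (smoothed_le1 k b x) _; rewrite ltry. Qed.

Let C_ (k : nat) : R := Num.sqrt 2 * 4 * k.+1%:R^-1.

Let C_cvg0 : C_ k @[k --> \oo] --> 0.
Proof.
rewrite -[X in _ --> X](mulr0 (Num.sqrt 2 * 4)); apply: cvgM; first exact: cvg_cst.
exact: cvg_harmonic.
Qed.

Let tail_le k (A : set R) x : measurable A -> (forall y, A y -> d_ k <= `|y - x|) ->
  (\int[lam]_y (\1_A y * gauss1 (a_ k) (y - x))%:E <= (C_ k)%:E)%E.
Proof.
move=> mA Ad; have -> : C_ k = Num.sqrt 2 * (a_ k *+ 4) / d_ k ^+ 2.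
  rewrite /C_ /a_ /d_; field.
  by rewrite addrC natr1 pnatr_eq0.
set C := _ / _; have C0 : 0 <= C.
  by rewrite divr_ge0 ?mulr_ge0 ?sqrtr_ge0 ?mulrn_wge0 ?sqr_ge0// ltW.
apply: (@le_trans _ _ (\int[lam]_y (C * gauss1 (a_ k *+ 2) (y - x))%:E))%E.
  apply: ge0_le_integral => //.
  - by move=> y _; rewrite lee_fin mulr_ge0// gauss1_ge0.
  - by apply/measurable_EFinP/measurable_funM => //; exact: mgauss1.
  - by apply/measurable_EFinP/measurable_funM => //; exact: mgauss1.
  - move=> y _; rewrite lee_fin indicE; case: (boolP (y \in A)) => [|_].
      by rewrite inE mul1r => /Ad; exact: gauss1_tail.
    by rewrite mul0r mulr_ge0// gauss1_ge0.
under eq_integral do rewrite EFinM.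
rewrite ge0_integralZl//.
- by rewrite integral_gauss1 ?mule1// pmulrn_lgt0.
- by apply/measurable_EFinP; exact: mgauss1.
- by move=> y _; rewrite lee_fin gauss1_ge0.
Qed.

Let smoothed_cvg b x : fine (smoothed k b x) @[k --> \oo] --> ((x < b)%R%:R : R).
Proof.
have [bx|xb] := leP b x.
  apply: (@squeeze_cvgr _ _ _ _ (fun=> 0) C_) => //; last exact: cvg_cst.
  apply: nearW => k; rewrite fine_ge0// -lee_fin fineK//=.
  apply: tail_le => // y; rewrite /= in_itv/= => yb.
  rewrite distrC ler_normr; apply/orP; left.
  by rewrite lerBrDr -lerBrDl; apply: le_trans (ltW yb) _; rewrite lerB.
apply: (@squeeze_cvgr _ _ _ _ (fun k => 1 - C_ k) (fun=> 1)); last 2 first.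
- by rewrite -[X in _ --> X]subr0; apply: cvgB => //; exact: cvg_cst.
- exact: cvg_cst.
have : d_ k @[k --> \oo] --> 0 by exact: cvg_harmonic.
move=> /cvgrPdist_lt /(_ ((b - x) / 2)).
rewrite divr_gt0 ?subr_gt0// => /(_ isT); apply: filterS => k.
rewrite sub0r normrN gtr0_norm// => dk.
rewrite -!lee_fin fineK// smoothed_le1 andbT EFinB leeBlDr//.
rewrite -{1}(smoothedC k b x) leeD2l//; apply: tail_le => // y.
rewrite /= in_itv/= andbT => yb.
by rewrite ler_normr; apply/orP; left; lra.
Qed.

Variable n : nat.

Let mjoint a (B : set 'rV[R]_n) : measurable B ->
  measurable_fun setT (fun z : 'rV[R]_n * 'rV[R]_n =>
    (\1_B z.2 * gauss a (z.2 - z.1))%:E).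
Proof.
move=> mB; apply/measurable_EFinP; apply: measurable_funM.
  by apply: measurableT_comp => //; exact: measurable_indic.
apply: measurableT_comp; first exact: measurable_gauss.
apply: measurable_fun_rV => i; under eq_fun do rewrite !mxE.
apply: measurable_funB.
  by apply: (measurableT_comp (measurable_coord i)).
by apply: (measurableT_comp (measurable_coord i)).
Qed.

(** The indicator of a lower box is the bounded pointwise limit of its smoothings [Psi k], and by
    Tonelli the integral of [Psi k] against a measure involves that measure only through the
    Gaussian integrals of the hypothesis. *)
Lemma gauss_kernel_unique (m1 m2 : probability 'rV[R]_n R) :
  (forall (a : R) (y : 'rV[R]_n), 0 < a -> (\int[m1]_x (gauss a (y - x))%:E =
     \int[m2]_x (gauss a (y - x))%:E)%E) ->
  forall A, measurable A -> m1 A = m2 A.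
Proof.
move=> m12 A mA; apply: lower_box_measure_unique => // [|b].
  by rewrite fin_num_fun_lty//; exact: fin_num_measure.
pose B k := lower_box (fun i => b i - d_ k).
have mB k : measurable (B k) by exact: measurable_lower_box.
pose Psi k (x : 'rV[R]_n) : \bar R := (\int[L n]_y (\1_(B k) y * gauss (a_ k) (y - x))%:E)%E.
have PsiE k x : Psi k x = (\prod_(i < n) fine (smoothed k (b i) (x 0 i)))%:E.
  rewrite -prodEFin /Psi; under [RHS]eq_bigr do rewrite fineK//.
  rewrite -(integral_rV_prod (f := fun i y => \1_`]-oo, (b i - d_ k)[ y * gauss1 (a_ k) (y - x 0 i))).
  - apply: eq_integral => y _; rewrite big_split/=; congr (_ * _)%:E.
      rewrite indicE; case: (boolP (y \in B k)) => [|yB].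
        rewrite inE => yB; rewrite big1// => i _.
        by rewrite indicE mem_set//= in_itv/=; exact: yB.
      apply/esym/eqP/prodf_eq0.
      move: yB; rewrite notin_setE => /existsNP[i yi]; exists i => //.
      by rewrite indicE memNset//= in_itv/=.
    by apply: eq_bigr => i _; rewrite !mxE.
  - by move=> i; apply: measurable_funM => //; exact: mgauss1.
  - by move=> i y; rewrite mulr_ge0// gauss1_ge0.
have Psi_int (m : probability 'rV[R]_n R) k :
    (\int[m]_x Psi k x = \int[L n]_y (\int[m]_x (\1_(B k) y * gauss (a_ k) (y - x))%:E))%E.
  rewrite /Psi (fubini_tonelli (fun z : 'rV[R]_n * 'rV[R]_n => (\1_(B k) z.2 * gauss (a_ k) (z.2 - z.1))%:E))//.
    exact: mjoint.
  by move=> z; rewrite lee_fin mulr_ge0// gauss_ge0.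
have mgs a (y : 'rV[R]_n) : measurable_fun setT (fun x : 'rV[R]_n => (gauss a (y - x))%:E).
  apply/measurable_EFinP/measurableT_comp; first exact: measurable_gauss.
  apply: measurable_fun_rV => i; under eq_fun do rewrite !mxE.
  by apply: measurable_funB => //; exact: measurable_coord.
have Psi12 k : (\int[m1]_x Psi k x = \int[m2]_x Psi k x)%E.
  rewrite !Psi_int; apply: eq_integral => y _.
  under eq_integral do rewrite EFinM.
  rewrite ge0_integralZl//; last by move=> x _; rewrite lee_fin gauss_ge0.
  under [RHS]eq_integral do rewrite EFinM.
  rewrite ge0_integralZl//; last by move=> x _; rewrite lee_fin gauss_ge0.
  by rewrite m12.
have Psi_cvg x : Psi k x @[k --> \oo] --> (\1_(lower_box b) x)%:E.
  under eq_fun do rewrite PsiE.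
  have -> : \1_(lower_box b) x = \prod_(i < n) ((x 0 i < b i)%R%:R : R).
    rewrite indicE; case: (boolP (x \in lower_box b)) => [|xB].
      by rewrite inE => xB; rewrite big1// => i _; rewrite xB.
    apply/esym/eqP/prodf_eq0.
    move: xB; rewrite notin_setE => /existsNP[i xi]; exists i => //.
    by move/negP/negbTE : xi => ->.
  apply: cvg_EFin; first exact: nearW.
  elim: (index_enum _) => [|i r IH].
    by rewrite big_nil; under eq_fun do rewrite big_nil; exact: cvg_cst.
  rewrite big_cons; under eq_fun do rewrite big_cons.
  by apply: cvgM => //; exact: smoothed_cvg.
have cvg (m : probability 'rV[R]_n R) : (\int[m]_x Psi k x)%E @[k --> \oo] --> m (lower_box b).
  have -> : m (lower_box b) = (\int[m]_x (\1_(lower_box b) x)%:E)%E.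
    by rewrite integral_indic ?setIT//; exact: measurable_lower_box.
  have mPsi k : measurable_fun setT (Psi k).
    apply: (measurable_fun_fubini_tonelli_F (m2 := L n)
      (fun z : 'rV[R]_n * 'rV[R]_n => (\1_(B k) z.2 * gauss (a_ k) (z.2 - z.1))%:E)) => //.
      exact: mjoint.
    by move=> z; rewrite lee_fin mulr_ge0// gauss_ge0.
  apply: (@dominated_cvg _ _ _ m _ measurableT _ _ (fun=> 1%E)) => //.
  - exact: finite_measure_integrable_cst.
  - move=> k x _; rewrite gee0_abs PsiE lee_fin; last by apply: prodr_ge0 => i _; exact: fine_ge0.
    apply: prodr_ile1 => i; rewrite fine_ge0//= -lee_fin fineK//.
transitivity (limn (fun k => \int[m1]_x Psi k x))%E.
  by apply/esym/cvg_lim => //; exact: cvg.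
by under eq_fun do rewrite Psi12; apply/cvg_lim => //; exact: cvg.
Qed.

End gauss_kernel_unique.

(** * Wiener integrals *)

Section measurable_rV_ops.
Context (R : realType) (n : nat) d (T : measurableType d).
Implicit Types f g : T -> 'rV[R]_n.

Lemma measurable_rVD f g : measurable_fun setT f -> measurable_fun setT g ->
  measurable_fun setT (fun x => f x + g x).
Proof.
move=> mf mg; apply: measurable_fun_rV => i; under eq_fun do rewrite mxE.
by apply: measurable_funD; apply: (measurableT_comp (measurable_coord i)).
Qed.

Lemma measurable_rVZ c f : measurable_fun setT f ->
  measurable_fun setT (fun x => c *: f x).
Proof.
move=> mf; apply: measurable_fun_rV => i; under eq_fun do rewrite mxE.
by apply: measurable_funM => //; apply: (measurableT_comp (measurable_coord i)).
Qed.

Lemma measurable_rVB f g : measurable_fun setT f -> measurable_fun setT g ->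
  measurable_fun setT (fun x => f x - g x).
Proof.
move=> mf mg; under eq_fun do rewrite -scaleN1r.
by apply: measurable_rVD => //; exact: measurable_rVZ.
Qed.

Lemma measurable_rV_sum (I : Type) (r : seq I) (F : I -> T -> 'rV[R]_n) :
  (forall i, measurable_fun setT (F i)) ->
  measurable_fun setT (fun x => \sum_(i <- r) F i x).
Proof.
move=> mF; elim: r => [|i r IH].
  by under eq_fun do rewrite big_nil; exact: measurable_cst.
by under eq_fun do rewrite big_cons; exact: measurable_rVD.
Qed.

Lemma measurable_EFin_gauss a f : measurable_fun setT f ->
  measurable_fun setT (fun x => (gauss a (f x))%:E).
Proof.
by move=> mf; apply/measurable_EFinP/measurableT_comp => //; exact: measurable_gauss.
Qed.

End measurable_rV_ops.

Section independence.
Context (R : realType) d (Omega : measurableType d) (P : probability Omega R).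
Context d1 d2 (T1 : measurableType d1) (T2 : measurableType d2).

Definition mfun_of d' (T' : measurableType d') (f : Omega -> T') (mf : measurable_fun setT f) :
  {RV P >-> T'} := HB.pack f (isMeasurableFun.Build _ _ _ _ f mf).

(** Independence on rectangles makes the joint law the product of the marginal laws; Tonelli does
    the rest. *)
Lemma ge0_integral_indep (Z : Omega -> T1) (D : Omega -> T2) (f : T1 * T2 -> \bar R) :
  measurable_fun setT Z -> measurable_fun setT D ->
  (forall A B, measurable A -> measurable B ->
    P (Z @^-1` A `&` D @^-1` B) = (P (Z @^-1` A) * P (D @^-1` B))%E) ->
  measurable_fun setT f -> (forall z, 0 <= f z)%E ->
  (\int[P]_w f (Z w, D w) = \int[P]_w \int[P]_w' f (Z w, D w'))%E.
Proof.
move=> mZ mD ind mf f0.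
pose Z' := mfun_of mZ; pose D' := mfun_of mD.
have mZD : measurable_fun setT (fun w => (Z w, D w)) by exact: measurable_fun_pair.
pose ZD := mfun_of mZD.
have E : forall X, measurable X -> (distribution P Z' \x distribution P D')%E X = distribution P ZD X.
  apply: product_measure_unique => A B mA mB.
  by rewrite /distribution/= /pushforward/= -ind.
transitivity (\int[distribution P Z' \x distribution P D']_z f z)%E.
  rewrite -(ge0_integral_distribution ZD)//; apply: eq_measure_integral => A mA _.
  exact: (esym (E A mA)).
rewrite fubini_tonelli1// /fubini_F ge0_integral_distribution//.
- apply: eq_integral => w _ /=; rewrite ge0_integral_distribution//.
  by apply: measurableT_comp => //; exact: measurable_pair1.
- exact: measurable_fun_fubini_tonelli_F.
- by move=> y; exact: integral_ge0.
Qed.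

End independence.

(** * Brownian increments tested with Gaussian kernels *)

Section brownian_kernel.
Context (R : realType) (n : nat) d (Omega : measurableType d)
  (P : probability Omega R) (T : R) (F : R -> set (set Omega))
  (W : R -> Omega -> 'rV[R]_n).
Hypotheses (hF : filtration T F) (hW : brownian_motion P T F W).
Local Notation L := (lebesgue_rV R n).

(** The sub-sigma-algebra [F s] is seen as the type it generates, so that the closure lemmas for
    measurable functions apply; [FmeasP] shows that generating adds no sets. *)
Definition Fmeas s (f : Omega -> 'rV[R]_n) :=
  @measurable_fun _ _ (g_sigma_algebraType (F s)) _ setT f.

Lemma FmeasP s f : 0 <= s <= T ->
  Fmeas s f <-> (forall A, measurable A -> F s (f @^-1` A)).
Proof.
move=> sT; have [/(_ s) sF _ _] := hF.
have E : <<s F s >> = F s by apply: sigma_algebra_id; apply: sF; rewrite in_itv.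
split => [mf A mA|mf _ A mA]; last first.
  by rewrite setTI; apply: sub_sigma_algebra; exact: mf.
by rewrite -E; have := mf measurableT A mA; rewrite setTI.
Qed.

Lemma Fmeas_le s t f : 0 <= s -> s <= t -> t <= T -> Fmeas s f -> Fmeas t f.
Proof.
move=> s0 st tT; have [_ _ H] := hF.
move=> /FmeasP H1; apply/FmeasP; first by rewrite tT (le_trans s0).
by move=> A mA; apply: (H s t) => //; apply: H1; rewrite ?s0 ?(le_trans st).
Qed.

Lemma Fmeas_measurable s f : 0 <= s <= T -> Fmeas s f -> measurable_fun setT f.
Proof.
move=> sT /FmeasP H _ A mA; have [_ FT _] := hF.
by rewrite setTI; apply: (FT s); [rewrite in_itv|exact: H].
Qed.

Lemma Fmeas_W s t : 0 <= s -> s <= t -> t <= T -> Fmeas t (W s).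
Proof.
move=> s0 st tT; have [aW _ _ _ _] := hW.
apply: (Fmeas_le s0 st tT); apply/FmeasP; first by rewrite s0 (le_trans st).
by move=> A mA; apply: aW => //; rewrite in_itv/= s0 (le_trans st).
Qed.

Lemma measurable_W s : 0 <= s <= T -> measurable_fun setT (W s).
Proof.
move=> /andP[s0 sT]; apply: (@Fmeas_measurable s); first by rewrite s0.
exact: Fmeas_W.
Qed.

(** The definition of Brownian motion prescribes the law on products of sets only; lower boxes are
    such products and determine the law. *)
Lemma increment_law s t : 0 <= s -> s < t -> t <= T -> forall A, measurable A ->
  P ((fun w => W t w - W s w) @^-1` A) =
  (\int[L]_(V in A) (gauss (t - s) V)%:E)%E.
Proof.
move=> s0 st tT A mA; have [_ _ _ lawW _] := hW.
have h0 : 0 < t - s by rewrite subr_gt0.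
have mD : measurable_fun setT (fun w => W t w - W s w).
  by apply: measurable_rVB; apply: measurable_W; rewrite ?s0 ?(le_trans s0 (ltW st))//= (le_trans (ltW st)).
pose D := mfun_of P mD.
pose m2 := mdensity L (@measurable_gauss R n (t - s)) (gauss_ge0 (t - s)).
apply: (@lower_box_measure_unique _ _ (distribution P D) m2 A) => // [|b].
  by rewrite fin_num_fun_lty//; exact: fin_num_measure.
transitivity (P [set w | forall i, `]-oo, b i[%classic ((W t \- W s) w 0 i)]).
  congr (P _); apply/seteqP; split => w /= H i; have := H i; by rewrite !mxE in_itv.
rewrite (lawW s t s0 st tT (fun i => `]-oo, b i[%classic))//.
transitivity (\int[L]_(V in lower_box b) (gauss (t - s) V)%:E)%E; last by [].
rewrite integral_mkcond.
under eq_bigr => i _ do rewrite /normal_prob integral_mkcond.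
transitivity (\prod_(i < n) \int[lebesgue_measure]_x (\1_`]-oo, b i[ x * gauss1 (t - s) x)%:E)%E.
  apply: eq_bigr => i _; apply: eq_integral => x _.
  rewrite patchE -(gauss1E x 0 h0) subr0 indicE.
  by case: ifPn => _; rewrite ?mul1r ?mul0r.
rewrite -(integral_rV_prod (f := fun i x => \1_`]-oo, b i[ x * gauss1 (t - s) x)); last 2 first.
- by move=> i; apply: measurable_funM => //; exact: measurable_gauss1.
- by move=> i x; rewrite mulr_ge0// gauss1_ge0.
apply: eq_integral => V _; rewrite big_split/= patchE; case: ifPn => [|VB].
  by rewrite inE => VB; rewrite big1 ?mul1r// => i _; rewrite indicE mem_set//= in_itv/=; exact: VB.
rewrite (_ : \prod_(i < n) _ = 0) ?mul0r//; apply/eqP/prodf_eq0.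
move: VB; rewrite notin_setE => /existsNP[i Vi]; exists i => //.
by rewrite indicE memNset//= in_itv/=.
Qed.

Lemma increment_gauss s t a c U : 0 <= s -> s <= t -> t <= T -> 0 < a ->
  (\int[P]_w (gauss a (U - c *: (W t w - W s w)))%:E =
   (gauss (a + c ^+ 2 * (t - s)) U)%:E)%E.
Proof.
move=> s0 st tT a0; have [<-|nst] := eqVneq s t.
  under eq_integral do rewrite subrr scaler0 subr0.
  by rewrite subrr mulr0 addr0 integral_cst//= probability_setT mule1.
have {nst}slt : s < t by rewrite lt_neqAle nst.
have h0 : 0 < t - s by rewrite subr_gt0.
have mD : measurable_fun setT (fun w => W t w - W s w).
  by apply: measurable_rVB; apply: measurable_W; rewrite ?s0 ?(le_trans s0 st)//= (le_trans st).
have mG : measurable_fun setT (fun V : 'rV[R]_n => (gauss a (U - c *: V))%:E).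
  by apply: measurable_EFin_gauss; apply: measurable_rVB => //; exact: measurable_rVZ.
transitivity (\int[distribution P (mfun_of P mD)]_V (gauss a (U - c *: V))%:E)%E.
  by rewrite ge0_integral_distribution// => V; rewrite lee_fin gauss_ge0.
rewrite (ge0_integral_density (mu := L) (measurable_gauss (t - s)) (gauss_ge0 (t - s)))//.
- have := gauss_conv c U 0 a0 h0; rewrite scaler0 subr0 => <-.
  by apply: eq_integral => V _; rewrite subr0.
- by move=> A mA; rewrite /distribution/= /pushforward/=; exact: increment_law.
- by move=> V; rewrite lee_fin gauss_ge0.
Qed.

(** Since the increment is independent of [F s], it can be averaged out with [xi] frozen;
    [increment_gauss] then turns it into additional variance of the kernel. *)
Lemma indep_increment_gauss s t a c xi : 0 <= s -> s <= t -> t <= T -> 0 < a ->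
  Fmeas s xi ->
  (\int[P]_w (gauss a (xi w - c *: (W t w - W s w)))%:E =
   \int[P]_w (gauss (a + c ^+ 2 * (t - s)) (xi w))%:E)%E.
Proof.
move=> s0 st tT a0 mxi; have [sE|nst] := eqVneq s t.
  rewrite -sE; apply: eq_integral => w _.
  by rewrite !subrr scaler0 subr0 mulr0 addr0.
have slt : s < t by rewrite lt_neqAle nst.
have sT : 0 <= s <= T by rewrite s0 (le_trans st).
have mD : measurable_fun setT (fun w => W t w - W s w).
  by apply: measurable_rVB; apply: measurable_W; rewrite ?s0 ?(le_trans s0 st)//= (le_trans st).
have [_ _ _ _ indW] := hW.
rewrite (ge0_integral_indep (P := P) (Z := xi) (D := fun w => W t w - W s w)
  (f := fun z => (gauss a (z.1 - c *: z.2))%:E)).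
- by apply: eq_integral => w _ /=; rewrite increment_gauss.
- exact: Fmeas_measurable mxi.
- exact: mD.
- move=> A B mA mB; apply: (indW s t) => //.
  by move/(FmeasP _ sT) : mxi; exact.
- by apply: measurable_EFin_gauss; apply: measurable_rVB => //; exact: measurable_rVZ.
- by move=> z; rewrite lee_fin gauss_ge0.
Qed.

(** The last increment is removed first: what is left is measurable for [F (u N)], of which that
    increment is independent. *)
Lemma step_gauss N (u C : nat -> R) a xi : 0 <= u 0%N -> u N <= T ->
  (forall i, (i < N)%N -> u i <= u i.+1) -> 0 < a -> Fmeas (u 0%N) xi ->
  (\int[P]_w (gauss a (xi w - \sum_(0 <= i < N) C i *: (W (u i.+1) w - W (u i) w)))%:E =
   \int[P]_w (gauss (a + \sum_(0 <= i < N) C i ^+ 2 * (u i.+1 - u i)) (xi w))%:E)%E.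
Proof.
move=> u0; elim: N a => [|N IH] a uT ui a0 mxi.
  by apply: eq_integral => w _; rewrite !big_geq// subr0 addr0.
have u0N k : (k <= N)%N -> u 0%N <= u k.
  elim: k => // k IHk kN; apply: le_trans (IHk (ltnW kN)) _.
  by apply: ui; exact: leq_trans kN _.
have uN0 : 0 <= u N by apply: le_trans u0 _; exact: u0N.
have uNS : u N <= u N.+1 by exact: ui.
have uNT : u N <= T by exact: le_trans uT.
under eq_integral => w _.
  rewrite big_nat_recr//= opprD addrA; over.
rewrite (@indep_increment_gauss (u N) (u N.+1) a (C N)
  (fun w => xi w - \sum_(0 <= i < N) C i *: (W (u i.+1) w - W (u i) w)))//.
- rewrite IH//.
  + by rewrite big_nat_recr//= -addrA [X in a + X]addrC.
  + by move=> i iN; apply: ui; exact: ltnW.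
  + by rewrite ltr_wpDr// mulr_ge0 ?sqr_ge0// subr_ge0.
- apply: measurable_rVB; first by apply: (Fmeas_le u0 _ _ mxi) => //; exact: u0N.
  (* [measurable_rV_sum] asks for measurability at every index, so the summand is set to 0 beyond
     the range. *)
  rewrite (_ : (fun _ => _) = (fun w => \sum_(i <- index_iota 0 N)
      (if (i < N)%N then C i *: (W (u i.+1) w - W (u i) w) else 0))); last first.
    by apply/funext => w; rewrite big_nat_cond [RHS]big_nat_cond; apply: eq_bigr => i /andP[/andP[_ iN] _]; rewrite iN.
  apply: measurable_rV_sum => i; have [iN|_] := ltnP i N; last exact: measurable_cst.
  have mono j k : (j <= k)%N -> (k <= N)%N -> u j <= u k.
    move=> jk kN; elim: k jk kN => [|k IHk]; first by rewrite leqn0 => /eqP->.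
    rewrite leq_eqVlt => /orP[/eqP->//|jk] kN.
    by apply: le_trans (IHk jk (ltnW kN)) _; apply: ui; exact: ltnW.
  apply: measurable_rVZ; apply: measurable_rVB; apply: Fmeas_W => //.
  + exact: le_trans u0 (mono _ _ (leq0n _) _).
  + exact: mono.
  + by apply: le_trans u0 (mono _ _ (leq0n _) _); exact: ltnW.
  + by apply: mono => //; exact: ltnW.
Qed.

End brownian_kernel.

(** * Sums over intervals rewritten on a common grid *)

Section refinement.
Context (R : realType).

(* clipping the nodes to [a, b] turns the weighted sum into a telescoping one *)
Lemma telescope_clip (V : lmodType R) (G : R -> V) (u : nat -> R) N a b :
  (forall i, (i < N)%N -> u i <= u i.+1) ->
  (forall i, (i < N)%N -> a < u i.+1 -> a <= u i) ->
  (forall i, (i < N)%N -> b < u i.+1 -> b <= u i) ->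
  u 0%N <= a -> a <= b -> b <= u N ->
  \sum_(0 <= i < N) (\1_`]a, b] (u i.+1) : R) *: (G (u i.+1) - G (u i)) = G b - G a.
Proof.
move=> ui ua ub ua0 ab ubN; pose cl x := Num.max a (Num.min b x).
have clN : cl (u N) = b by rewrite /cl min_l// max_r.
have cl0 : cl (u 0%N) = a by rewrite /cl min_r ?(le_trans ua0)// max_l.
rewrite -{2}clN -{2}cl0 -(telescope_sumr (fun i => G (cl (u i)))) //.
rewrite big_nat_cond [RHS]big_nat_cond; apply: eq_bigr => i /andP[/andP[_ iN] _].
have {ui}uii := ui i iN; have {ua}uai := ua i iN; have {ub}ubi := ub i iN.
rewrite indicE; case: (boolP (u i.+1 \in `]a, b]%classic)).
  rewrite inE/= in_itv/= => /andP[au bu].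
  rewrite scale1r; congr (G _ - G _); rewrite /cl.
    by rewrite min_r// max_r// ltW.
  by rewrite min_r ?max_r ?uai// (le_trans uii).
rewrite notin_setE/= in_itv/= => /negP; rewrite negb_and -leNgt -ltNge.
rewrite scale0r; case/orP => H.
  by rewrite /cl !min_r ?max_l ?subrr// ?(le_trans H)// ?(le_trans uii)// (le_trans H).
by rewrite /cl (min_l (ubi H)) (min_l (ltW H)) subrr.
Qed.

Lemma integral_step (f : R -> R) (u : nat -> R) N :
  measurable_fun setT f ->
  (forall i, (i < N)%N -> u i <= u i.+1) ->
  (forall i r, (i < N)%N -> u i < r -> r <= u i.+1 -> f r = f (u i.+1)) ->
  (\int[lebesgue_measure]_(r in `]u 0%N, u N]) (f r ^+ 2)%:E =
   (\sum_(0 <= i < N) f (u i.+1) ^+ 2 * (u i.+1 - u i))%:E)%E.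
Proof.
move=> mf; elim: N => [|N IH] ui fi.
  by rewrite set_itvoc0 integral_set0 big_geq.
have u0N k : (k <= N)%N -> u 0%N <= u k.
  elim: k => // k IHk kN; apply: le_trans (IHk (ltnW kN)) _.
  by apply: ui; exact: leq_trans kN _.
have mf2 : measurable_fun setT (fun r => (f r ^+ 2)%:E).
  by apply/measurable_EFinP/measurable_funX.
have -> : `]u 0%N, u N.+1]%classic = `]u 0%N, u N]%classic `|` `]u N, u N.+1]%classic.
  by rewrite -itv_bndbnd_setU ?bnd_simp//; [exact: u0N|exact: ui].
rewrite ge0_integral_setU//; last 3 first.
- exact: measurable_funTS.
- by move=> r _; rewrite lee_fin sqr_ge0.
- apply/disj_setPS => r [] /=; rewrite !in_itv/= => /andP[_ h1] /andP[h2 _].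
  by have := lt_le_trans h2 h1; rewrite ltxx.
rewrite IH; last 2 first.
- by move=> i iN; apply: ui; exact: ltnW.
- by move=> i r iN; apply: fi; exact: ltnW.
rewrite big_nat_recr//= EFinD; congr (_ + _)%E.
transitivity (\int[lebesgue_measure]_(r in `]u N, u N.+1]) (f (u N.+1) ^+ 2)%:E)%E.
  by apply: eq_integral => r; rewrite inE/= in_itv/= => /andP[h1 h2]; rewrite (fi N).
rewrite integral_cst//= lebesgue_measure_itv/= lte_fin.
have [|] := ltP (u N) (u N.+1); first by rewrite EFinM.
have := ui N (ltnSn N) => h1 h2; have -> : u N.+1 = u N by apply/eqP; rewrite eq_le h1 h2.
by rewrite subrr mulr0 mule0.
Qed.

End refinement.

Section interval_lists.
Context (R : realType) (n : nat) d (Omega : measurableType d)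
  (P : probability Omega R) (T : R) (F : R -> set (set Omega))
  (W : R -> Omega -> 'rV[R]_n).
Hypotheses (hF : filtration T F) (hW : brownian_motion P T F W) (T0 : 0 <= T).
Implicit Types s : seq (R * R * R).

(* (a, b, c) stands for c \1_(]a, b]) *)
Definition in_0T s := all (fun x => [&& 0 <= x.1.1, x.1.1 <= x.1.2 & x.1.2 <= T]) s.

Definition list_int s w := \sum_(x <- s) x.2 *: (W x.1.2 w - W x.1.1 w).

Definition list_eval s (r : R) : R := \sum_(x <- s) x.2 * \1_`]x.1.1, x.1.2] r.

Lemma measurable_list_eval s : measurable_fun setT (list_eval s).
Proof.
rewrite /list_eval; apply: measurable_sum => x.
by apply: measurable_funM => //; exact: measurable_indic.
Qed.

(** The intervals of the list may overlap, so their variances cannot simply be added. All end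
    points, together with 0 and [T], are sorted into one grid, on whose cells the integrand is
    constant and [step_gauss] applies. *)
Lemma list_gauss s a xi : in_0T s -> 0 < a -> Fmeas F 0 xi ->
  (\int[P]_w (gauss a (xi w - list_int s w))%:E =
   \int[P]_w (gauss (a + \int[lebesgue_measure]_(r in `]0, T]) (list_eval s r ^+ 2))%R (xi w))%:E)%E.
Proof.
move=> /allP sT a0 mxi.
pose l := sort <=%R (0 :: T :: flatten [seq [:: x.1.1; x.1.2] | x <- s]).
pose u := nth 0 l; pose N := (size l).-1.
have lS : size l = N.+1 by rewrite /N /l size_sort.
have lin x : x \in l -> 0 <= x <= T.
  rewrite mem_sort !inE => /or3P[/eqP->|/eqP->|]; rewrite ?lexx ?T0//.
  move=> /flattenP[_ /mapP[y /sT /and3P[y1 y2 y3] ->]].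
  by rewrite !inE => /orP[] /eqP->; rewrite ?y1 ?(le_trans y2)// y3 (le_trans y1).
have l0 : 0 \in l by rewrite mem_sort inE eqxx.
have lT : T \in l by rewrite mem_sort !inE eqxx orbT.
have ls x : x \in s -> (x.1.1 \in l) * (x.1.2 \in l).
  move=> xs; split; rewrite mem_sort !inE; apply/orP; right; apply/orP; right;
    apply/flattenP; exists [:: x.1.1; x.1.2]; rewrite ?inE ?eqxx ?orbT//;
    by apply/mapP; exists x.
have lsorted : sorted <=%R l by apply: sort_sorted; exact: le_total.
have mono i j : (i <= j)%N -> (j <= N)%N -> u i <= u j.
  move=> ij jN; apply: (sorted_leq_nth le_trans lexx 0 lsorted) => //.
    by rewrite inE lS ltnS (leq_trans ij).
  by rewrite inE lS ltnS.
have ui i : (i < N)%N -> u i <= u i.+1 by move=> iN; apply: mono.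
(* No end point lies strictly inside a cell of the grid; this is the condition required by
   [telescope_clip]. *)
have consec x i : x \in l -> (i < N)%N -> x < u i.+1 -> x <= u i.
  move=> /(nthP 0)[j jl <-] iN; rewrite -/(u j) => ji.
  have [ij|ji'] := ltnP i j; last by apply: mono => //; exact: ltnW.
  have := mono i.+1 j ij; rewrite -ltnS -lS => /(_ jl) H.
  by have := lt_le_trans ji H; rewrite ltxx.
have uin i : (i <= N)%N -> u i \in l by move=> iN; rewrite mem_nth// lS ltnS.
have u0 : u 0%N = 0.
  apply/eqP; rewrite eq_le; have /andP[-> _] := lin _ (uin 0%N (leq0n _)).
  rewrite andbT; move: l0 => /(nthP 0)[j jl <-].
  by apply: mono => //; rewrite -ltnS -lS.
have uN : u N = T.
  apply/eqP; rewrite eq_le; have /andP[_ ->] := lin _ (uin N (leqnn _)) => /=.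
  move: lT => /(nthP 0)[j jl <-].
  by apply: mono => //; rewrite -ltnS -lS.
have E1 w : list_int s w =
    \sum_(0 <= i < N) list_eval s (u i.+1) *: (W (u i.+1) w - W (u i) w).
  under eq_bigr do rewrite /list_eval scaler_suml.
  rewrite exchange_big/= /list_int big_seq [RHS]big_seq; apply: eq_bigr => x xs.
  under eq_bigr do rewrite -scalerA.
  have [xl1 xl2] := ls _ xs; have /and3P[x1 x2 x3] := sT _ xs.
  rewrite -scaler_sumr (telescope_clip (fun r => W r w))//.
  - by move=> i; exact: consec.
  - by move=> i; exact: consec.
  - by rewrite u0.
  - by rewrite uN.
have E2 : (\int[lebesgue_measure]_(r in `]0, T]) (list_eval s r ^+ 2) =
    \sum_(0 <= i < N) list_eval s (u i.+1) ^+ 2 * (u i.+1 - u i))%R.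
  rewrite /Rintegral -{1}u0 -{1}uN integral_step//; first exact: measurable_list_eval.
  move=> i r iN h1 h2; rewrite /list_eval big_seq [RHS]big_seq; apply: eq_bigr => x xs.
  have [xl1 xl2] := ls _ xs; congr (_ * _); rewrite !indicE; congr (_%:R); congr nat_of_bool.
  apply/idP/idP; rewrite !inE/= !in_itv/= => /andP[h3 h4].
    rewrite (lt_le_trans h3)//= leNgt; apply/negP => /(consec _ _ xl2 iN) h5.
    by have := le_lt_trans (le_trans h4 h5) h1; rewrite ltxx.
  by rewrite (le_trans h2)// andbT; apply: le_lt_trans h1; exact: consec.
rewrite E2; under eq_integral do rewrite E1.
by rewrite (step_gauss hF hW)// ?u0// uN.
Qed.

End interval_lists.

Section enorm_basics.
Context (R : realType) (n : nat).
Implicit Types u v : 'rV[R]_n.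

Lemma enorm_ge0 u : 0 <= enorm u. Proof. exact: sqrtr_ge0. Qed.

Lemma enorm_sqr u : enorm u ^+ 2 = \sum_i u 0 i ^+ 2.
Proof. by rewrite sqr_sqrtr// sumr_ge0// => i _; exact: sqr_ge0. Qed.

Lemma enormZ_sqr c u : enorm (c *: u) ^+ 2 = c ^+ 2 * enorm u ^+ 2.
Proof.
by rewrite !enorm_sqr mulr_sumr; apply: eq_bigr => i _; rewrite mxE exprMn.
Qed.

Lemma enormD_sqr u v : enorm (u + v) ^+ 2 <= 2 * enorm u ^+ 2 + 2 * enorm v ^+ 2.
Proof.
rewrite !enorm_sqr !mulr_sumr -big_split/=; apply: ler_sum => i _; rewrite mxE.
have := sqr_ge0 (u 0 i - v 0 i); nra.
Qed.

Lemma norm_coord_le_enorm u i : `|u 0 i| <= enorm u.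
Proof.
rewrite -(@ler_pXn2r _ 2) ?nnegrE ?enorm_ge0// enorm_sqr real_normK ?num_real//.
by rewrite (bigD1 i)//= lerDl sumr_ge0// => j _; exact: sqr_ge0.
Qed.

Lemma continuous_enorm : continuous (@enorm R n).
Proof.
move=> u; apply: (@continuous_comp _ _ _ (fun v : 'rV[R]_n => \sum_(i < n) v 0 i ^+ 2) Num.sqrt).
  apply: continuous_sum => i v.
  by apply: (@continuous_comp _ _ _ (fun w : 'rV[R]_n => w 0 i) (fun x : R => x ^+ 2)); [exact: coord_continuous|exact: exprn_continuous].
exact: sqrt_continuous.
Qed.

Lemma measurable_enorm : measurable_fun setT (@enorm R n).
Proof. by apply: continuous_measurable_rV; exact: continuous_enorm. Qed.

Lemma measurable_eball r : measurable (eball r : set 'rV[R]_n).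
Proof.
have := measurable_enorm measurableT (measurable_itv `]-oo, r]).
by rewrite setTI; congr measurable; apply/seteqP; split => v /=; rewrite in_itv.
Qed.

Lemma eball_sub_cube r : eball r `<=` (cube n r : set 'rV[R]_n).
Proof. by move=> v vr i; apply: le_trans (norm_coord_le_enorm v i) vr. Qed.

End enorm_basics.

(** * Limits from estimates with a free parameter *)

Section limits.
Context (R : realType).

(** The parameter is fixed first, small enough for [eta * A], and only then does [k] grow, which
    kills the other term despite the division by [eta]. *)
Lemma cvg_eta (x e : nat -> R) (y A B : R) : 0 <= A -> 0 <= B ->
  (forall k, 0 <= e k) -> e k @[k --> \oo] --> 0 ->
  (\forall k \near \oo, forall eta, 0 < eta -> eta <= 1 ->
     `|x k - y| <= eta * A + B / eta * e k) ->
  x k @[k --> \oo] --> y.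
Proof.
move=> A0 B0 e0 ecvg H; apply/cvgrPdist_le => /= eps eps0.
pose eta := Num.min 1 (eps / (2 * (A + 1))).
have A1 : 0 < 2 * (A + 1) by lra.
have eta0 : 0 < eta by rewrite lt_min ltr01 divr_gt0.
have eta1 : eta <= 1 by rewrite ge_min lexx.
have etaA : eta * A <= eps / 2.
  have : eta * (2 * (A + 1)) <= eps by rewrite -ler_pdivlMr// ge_min lexx orbT.
  nra.
have : 0 <= B / eta by rewrite divr_ge0 ?(ltW eta0).
have {}H : \forall k \near \oo, `|x k - y| <= eta * A + B / eta * e k.
  by apply: filterS H => k; exact.
move: (B / eta) H => b H b0; have b1 : 0 < 2 * (b + 1) by lra.
move/cvgrPdist_lt : ecvg => /(_ (eps / (2 * (b + 1)))).
rewrite divr_gt0// => /(_ isT); apply: filterS2 H => k Hk.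
rewrite sub0r normrN ger0_norm// => ek.
rewrite distrC; apply: le_trans Hk _.
have : e k * (2 * (b + 1)) <= eps by rewrite -ler_pdivlMr// ltW.
have := e0 k; nra.
Qed.

(** Convergence in L^2 implies convergence of the squared norms. A weighted Young inequality takes
    the place of the triangle inequality for the norm. *)
Lemma cvg_integral_sqr d (T : measurableType d) (mu : {measure set T -> \bar R})
    (D : set T) (g : nat -> T -> R) (f : T -> R) :
  measurable D -> (forall k, measurable_fun D (g k)) -> measurable_fun D f ->
  (\int[mu]_(x in D) (f x ^+ 2)%:E < +oo)%E ->
  (fun k => \int[mu]_(x in D) ((g k x - f x) ^+ 2)%:E)%E @ \oo --> 0%E ->
  \int[mu]_(x in D) (g k x ^+ 2) @[k --> \oo] --> \int[mu]_(x in D) (f x ^+ 2).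
Proof.
move=> mD mg mf foo gf; set V := \int[mu]_(x in D) (f x ^+ 2).
pose e k := fine (\int[mu]_(x in D) ((g k x - f x) ^+ 2)%:E)%E.
have i0 (h : T -> R) : (0 <= \int[mu]_(x in D) (h x ^+ 2)%:E)%E.
  by apply: integral_ge0 => x _; rewrite lee_fin sqr_ge0.
have VE : (\int[mu]_(x in D) (f x ^+ 2)%:E = V%:E)%E.
  by rewrite /V /Rintegral fineK// ge0_fin_numE.
have [gffin ecvg] := (fine_cvgP _ _).1 gf.
(* From a^2 <= (1 + eta) b^2 + (1 + 1/eta) (a - b)^2, integrated; it is used in both directions. *)
have ineq (h1 h2 : T -> R) eta : 0 < eta -> measurable_fun D h1 -> measurable_fun D h2 ->
   (\int[mu]_(x in D) (h1 x ^+ 2)%:E <=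
    (1 + eta)%:E * \int[mu]_(x in D) (h2 x ^+ 2)%:E +
    (1 + eta^-1)%:E * \int[mu]_(x in D) ((h1 x - h2 x) ^+ 2)%:E)%E.
  move=> eta0 m1 m2.
  have ei0 : 0 < eta^-1 by rewrite invr_gt0.
  have mm : measurable_fun D (fun x => ((h1 x - h2 x) ^+ 2)%:E).
    by apply/measurable_EFinP/measurable_funX/measurable_funB.
  have mm2 : measurable_fun D (fun x => (h2 x ^+ 2)%:E) by exact/measurable_EFinP/measurable_funX.
  rewrite -!ge0_integralZl//; try by move=> x _; rewrite lee_fin sqr_ge0.
  - rewrite -ge0_integralD//.
    + apply: ge0_le_integral => //.
      * by move=> x _; rewrite lee_fin sqr_ge0.
      * exact/measurable_EFinP/measurable_funX.
      * by apply: emeasurable_funD; exact: measurable_funeM.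
      * move=> x _; rewrite -!EFinM -EFinD lee_fin.
        set a := h1 x; set b := h2 x.
        have H : 0 <= eta^-1 * (a - b - eta * b) ^+ 2 by rewrite mulr_ge0 ?sqr_ge0// ltW.
        have E : eta^-1 * (a - b - eta * b) ^+ 2 =
          eta^-1 * (a - b) ^+ 2 - 2 * (a - b) * b + eta * b ^+ 2 by field; rewrite gt_eqF.
        rewrite E in H; nra.
    + by move=> x _; rewrite mule_ge0// lee_fin ?sqr_ge0//; lra.
    + exact: measurable_funeM.
    + by move=> x _; rewrite mule_ge0// lee_fin ?sqr_ge0//; lra.
    + exact: measurable_funeM.
  - by rewrite lee_fin; lra.
  - by rewrite lee_fin; lra.
(* The lower estimate is the costly one: the bound on G is inserted into eta G, and for eta <= 1 one
   has eta (1 + eta) <= 2 eta and 2 + eta + 1/eta <= 4/eta. *)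
apply: (@cvg_eta _ e V (2 * V) 4) => //.
- by rewrite mulr_ge0// -lee_fin -VE.
- by move=> k; rewrite fine_ge0.
apply: filterS gffin => k gfk eta eta0 eta1.
have ekE : (\int[mu]_(x in D) ((g k x - f x) ^+ 2)%:E = (e k)%:E)%E by rewrite /e fineK.
have e0 : 0 <= e k by rewrite fine_ge0.
have V0 : 0 <= V by rewrite -lee_fin -VE.
have H1 := ineq (g k) f eta eta0 (mg k) mf.
rewrite VE ekE -!EFinM -EFinD in H1.
have Gfin : (\int[mu]_(x in D) (g k x ^+ 2)%:E)%E \is a fin_num.
  by rewrite ge0_fin_numE//; apply: le_lt_trans H1 _; rewrite ltry.
set G := \int[mu]_(x in D) (g k x ^+ 2).
have GE : (\int[mu]_(x in D) (g k x ^+ 2)%:E = G%:E)%E by rewrite /G /Rintegral fineK.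
rewrite GE lee_fin in H1.
have H2 := ineq f (g k) eta eta0 mf (mg k).
have E2 : (\int[mu]_(x in D) ((f x - g k x) ^+ 2)%:E = (e k)%:E)%E.
  by rewrite -ekE; apply: eq_integral => x _; rewrite -sqrrN opprB.
rewrite VE E2 GE -!EFinM -EFinD lee_fin in H2.
have G0 : 0 <= G by rewrite -lee_fin -GE.
have ei : 1 <= eta^-1 by rewrite invf_ge1.
have ie : eta^-1 * eta = 1 by rewrite mulVf// gt_eqF.
have P1 : 0 <= e k * (eta^-1 - 1) by rewrite mulr_ge0// subr_ge0.
have P2 : 0 <= e k * (1 - eta) by rewrite mulr_ge0// subr_ge0.
have P3 : 0 <= V * (1 - eta) by rewrite mulr_ge0// subr_ge0.
have P4 : 0 <= V * (1 - eta) * eta by rewrite mulr_ge0// ltW.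
have P5 : eta * G <= eta * ((1 + eta) * V + (1 + eta^-1) * e k) by rewrite ler_wpM2l// ltW.
have P6 : eta * ((1 + eta) * V + (1 + eta^-1) * e k) =
  eta * V + eta ^+ 2 * V + eta * e k + (eta^-1 * eta) * e k by ring.
rewrite ie in P6.
rewrite ler_norml; apply/andP; split; rewrite mulrAC -mulrA; nra.
Qed.

End limits.

(** * Wiener integrals as limits in L^2 *)

Section wiener_pairs.
Context (R : realType) (n : nat) d (Omega : measurableType d)
  (P : probability Omega R) (T : R) (F : R -> set (set Omega))
  (W : R -> Omega -> 'rV[R]_n).
Hypotheses (hF : filtration T F) (hW : brownian_motion P T F W) (T0 : 0 <= T).
Local Notation lam := (@lebesgue_measure R).
Implicit Types (s : seq (R * R * R)) (Z : Omega -> 'rV[R]_n) (f : R -> R).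

(* Z is the Wiener integral of f over ]0, T] *)
Definition wiener_pair Z f :=
  [/\ measurable_fun setT Z, measurable_fun setT f,
      exists M, forall r, `|f r| <= M &
   exists s : nat -> seq (R * R * R),
   [/\ forall k, in_0T T (s k),
      (fun k => \int[lam]_(r in `]0%R, T]) ((list_eval (s k) r - f r) ^+ 2)%:E)%E
        @ \oo --> 0%E &
      (fun k => \int[P]_w (enorm (list_int W (s k) w - Z w) ^+ 2)%:E)%E
        @ \oo --> 0%E]].

Lemma measurable_list_int s : in_0T T s -> measurable_fun setT (list_int W s).
Proof.
rewrite /list_int; elim: s => [_|x s IH].
  by under eq_fun do rewrite big_nil; exact: measurable_cst.
move=> /= /andP[/and3P[x1 x2 x3] sT].
under eq_fun do rewrite big_cons.
apply: measurable_rVD; last exact: IH.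
apply: measurable_rVZ; apply: measurable_rVB; apply: (measurable_W hF hW).
  by rewrite x3 (le_trans x1).
by rewrite x1 (le_trans x2).
Qed.

Lemma measurable_enorm_sqr d' (T' : measurableType d') (f : T' -> 'rV[R]_n) :
  measurable_fun setT f -> measurable_fun setT (fun w => (enorm (f w) ^+ 2)%:E).
Proof.
move=> mf; apply/measurable_EFinP/measurable_funX.
by apply: measurableT_comp => //; exact: measurable_enorm.
Qed.

Lemma integrable_gauss a (xi : Omega -> 'rV[R]_n) : 0 < a -> measurable_fun setT xi ->
  P.-integrable setT (EFin \o (fun w => gauss a (xi w))).
Proof.
move=> a0 mxi; apply: measurable_bounded_integrable => //.
- by rewrite fin_num_fun_lty//; exact: fin_num_measure.
- by apply: measurableT_comp => //; exact: measurable_gauss.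
- exists ((Num.sqrt (a * pi *+ 2))^-1 ^+ n); split; first exact: num_real.
  move=> M HM w _; apply: le_trans (ltW HM).
  by rewrite ger0_norm ?gauss_ge0// gauss_le_peak.
Qed.

(** The kernel is Lipschitz, and z <= eta + z^2 / eta bounds the distance by its square, so
    convergence of second moments is enough. *)
Lemma cvg_gauss_L2 a (xi : Omega -> 'rV[R]_n) (I : nat -> Omega -> 'rV[R]_n) Z :
  0 < a -> measurable_fun setT xi -> (forall k, measurable_fun setT (I k)) ->
  measurable_fun setT Z ->
  (fun k => \int[P]_w (enorm (I k w - Z w) ^+ 2)%:E)%E @ \oo --> 0%E ->
  \int[P]_w (gauss a (xi w - I k w)) @[k --> \oo] --> \int[P]_w (gauss a (xi w - Z w)).
Proof.
move=> a0 mxi mI mZ IZ; have [C C0 HC] := gauss_lipschitz n a0.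
pose e k := fine (\int[P]_w (enorm (I k w - Z w) ^+ 2)%:E)%E.
have [efin ecvg] := (fine_cvgP _ _).1 IZ.
apply: (@cvg_eta _ _ e _ (C * n%:R) (C * n%:R)) => //; try by rewrite mulr_ge0.
  by move=> k; rewrite fine_ge0// integral_ge0// => w _; rewrite lee_fin sqr_ge0.
apply: filterS efin => k ek eta eta0 _.
have i1 := integrable_gauss a0 (measurable_rVB mxi (mI k)).
have i2 := integrable_gauss a0 (measurable_rVB mxi mZ).
rewrite -RintegralB//.
have i3 : P.-integrable setT (EFin \o (fun w => gauss a (xi w - I k w) - gauss a (xi w - Z w))).
  by have := integrableB measurableT i1 i2; apply: eq_integrable => // w _; rewrite /= EFinB.
apply: le_trans (le_normr_Rintegral measurableT i3) _.
rewrite -lee_fin /Rintegral fineK; last first.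
  exact: (integrable_fin_num measurableT (integrable_norm i3)).
apply: (@le_trans _ _ (\int[P]_w ((eta * (C * n%:R))%:E + (C * n%:R / eta)%:E * (enorm (I k w - Z w) ^+ 2)%:E))%E).
  apply: ge0_le_integral => //.
  - apply/measurable_EFinP/measurableT_comp => //.
    apply: measurable_funB.
      by apply: measurableT_comp; [exact: measurable_gauss|exact: measurable_rVB].
    by apply: measurableT_comp; [exact: measurable_gauss|exact: measurable_rVB].
  - apply: emeasurable_funD => //; apply: measurable_funeM.
    by apply: measurable_enorm_sqr; exact: measurable_rVB.
  - move=> w _; rewrite -EFinM -EFinD lee_fin.
    apply: le_trans (HC _ _) _.
    set q := enorm _ ^+ 2.
    have -> : eta * (C * n%:R) + C * n%:R / eta * q = C * \sum_(i < n) (eta + q / eta).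
      by rewrite sumr_const card_ord -mulr_natr; ring.
    apply: ler_wpM2l => //; apply: ler_sum => i _.
    have -> : (xi w - I k w) 0 i - (xi w - Z w) 0 i = - (I k w - Z w) 0 i.
      by rewrite !mxE; ring.
    rewrite normrN; apply: le_trans (norm_coord_le_enorm _ _) _; rewrite /q; set z := enorm _.
    have -> : eta + z ^+ 2 / eta = z + (eta^-1 * (z - eta / 2) ^+ 2 + eta * 3 / 4).
      by field; rewrite gt_eqF.
    rewrite lerDl addr_ge0//; first by rewrite mulr_ge0 ?sqr_ge0// invr_ge0 ltW.
    by rewrite divr_ge0// mulr_ge0// ltW.
rewrite ge0_integralD//.
- rewrite integral_cst//= probability_setT mule1 ge0_integralZl//.
  + by rewrite -[X in (_ + _ * X <= _)%E]fineK// -EFinM -EFinD lee_fin.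
  + by apply: measurable_enorm_sqr; exact: measurable_rVB.
  + by move=> w _; rewrite lee_fin sqr_ge0.
  + by rewrite lee_fin divr_ge0 ?mulr_ge0// ltW.
- by move=> w _; rewrite lee_fin mulr_ge0 ?mulr_ge0// ltW.
- by move=> w _; rewrite mule_ge0// lee_fin ?sqr_ge0// divr_ge0 ?mulr_ge0// ltW.
- by apply: measurable_funeM; apply: measurable_enorm_sqr; exact: measurable_rVB.
Qed.

Lemma cvg_gauss_var (a v : R) (vk : nat -> R) (xi : Omega -> 'rV[R]_n) :
  0 < a -> 0 <= v -> (forall k, 0 <= vk k) -> measurable_fun setT xi ->
  vk k @[k --> \oo] --> v ->
  \int[P]_w (gauss (a + vk k) (xi w)) @[k --> \oo] --> \int[P]_w (gauss (a + v) (xi w)).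
Proof.
move=> a0 v0 vk0 mxi vkv; rewrite /Rintegral; apply: fine_cvg.
have i1 := integrable_gauss (ltr_wpDr v0 a0) mxi.
rewrite fineK; last exact: (integrable_fin_num measurableT i1).
apply: (@dominated_cvg _ _ _ P _ measurableT _ _ (fun=> ((Num.sqrt (a * pi *+ 2))^-1 ^+ n)%:E)) => //.
- by move=> k; exact: measurable_EFin_gauss.
- move=> w _; apply: cvg_EFin; first exact: nearW.
  apply: cvg_gauss; first by rewrite ltr_wpDr.
  by apply: cvgD => //; exact: cvg_cst.
- exact: finite_measure_integrable_cst.
- move=> k w _; rewrite gee0_abs ?lee_fin ?gauss_ge0//.
  by apply: gauss_le_peak2 => //; rewrite lerDl.
Qed.

Lemma wiener_pair_sqr_lty Z f : wiener_pair Z f ->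
  (\int[lam]_(r in `]0%R, T]) (f r ^+ 2)%:E < +oo)%E.
Proof.
move=> [_ mf [M HM] _].
apply: (@le_lt_trans _ _ (\int[lam]_(r in `]0%R, T]) (M ^+ 2)%:E)%E).
  apply: ge0_le_integral => //.
  - by move=> r _; rewrite lee_fin sqr_ge0.
  - by apply/measurable_EFinP/measurable_funTS/measurable_funX.
  - move=> r _; rewrite lee_fin -real_normK ?num_real// lerXn2r ?nnegrE//.
    exact: le_trans (HM r).
by rewrite integral_cst//= lebesgue_measure_itv/=; case: ifPn; rewrite ?mule0 -?EFinB -?EFinM ltry.
Qed.

(** Both sides of [list_gauss] pass to the limit. In this form the statement expresses at once that
    [Z] is Gaussian with that variance and that it is independent of [F 0]. *)
Lemma wiener_pair_gauss Z f a xi : wiener_pair Z f -> 0 < a -> Fmeas F 0 xi ->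
  \int[P]_w (gauss a (xi w - Z w)) =
  \int[P]_w (gauss (a + \int[lam]_(r in `]0%R, T]) (f r ^+ 2)) (xi w)).
Proof.
move=> wZ a0 Fxi; have foo := wiener_pair_sqr_lty wZ.
have [mZ mf _ [s [sT sf sZ]]] := wZ.
have mxi : measurable_fun setT xi by apply: (Fmeas_measurable hF _ Fxi); rewrite lexx.
have v0 g : 0 <= \int[lam]_(r in `]0%R, T]) (g r ^+ 2).
  by apply: Rintegral_ge0 => r _; exact: sqr_ge0.
have c1 := cvg_gauss_L2 a0 mxi (fun k => measurable_list_int (sT k)) mZ sZ.
have c2 : \int[lam]_(r in `]0%R, T]) (list_eval (s k) r ^+ 2) @[k --> \oo] -->
    \int[lam]_(r in `]0%R, T]) (f r ^+ 2).
  apply: cvg_integral_sqr => //.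
  - by move=> k; apply: measurable_funTS; exact: measurable_list_eval.
  - exact: measurable_funTS.
have c3 := cvg_gauss_var a0 (v0 f) (fun k => v0 (list_eval (s k))) mxi c2.
have E : (fun k => \int[P]_w (gauss a (xi w - list_int W (s k) w))) = (fun k => \int[P]_w
    (gauss (a + \int[lam]_(r in `]0%R, T]) (list_eval (s k) r ^+ 2)) (xi w))).
  by apply/funext => k; rewrite /Rintegral (list_gauss hF hW T0 (sT k) a0 Fxi).
rewrite E in c1.
by rewrite -(cvg_lim _ c1)// -(cvg_lim _ c3).
Qed.

(** Approximating lists are concatenated, after scaling the coefficients of the second one. Lists of
    possibly overlapping intervals make this possible without a common grid. *)
Lemma wiener_pairDZ Z Z' f f' c : wiener_pair Z f -> wiener_pair Z' f' ->
  wiener_pair (fun w => Z w + c *: Z' w) (fun r => f r + c * f' r).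
Proof.
move=> [mZ mf [M HM] [s [sT sf sZ]]] [mZ' mf' [M' HM'] [s' [sT' sf' sZ']]].
split.
- by apply: measurable_rVD => //; exact: measurable_rVZ.
- by apply: measurable_funD => //; exact: measurable_funM.
- exists (M + `|c| * M') => r; apply: le_trans (ler_normD _ _) _.
  by rewrite lerD// normrM ler_wpM2l.
pose sc k := s k ++ [seq (x.1, c * x.2) | x <- s' k].
have evE k r : list_eval (sc k) r = list_eval (s k) r + c * list_eval (s' k) r.
  rewrite /list_eval big_cat/= big_map; congr (_ + _); rewrite mulr_sumr.
  by apply: eq_bigr => x _; rewrite /= mulrA.
have inE' k w : list_int W (sc k) w = list_int W (s k) w + c *: list_int W (s' k) w.
  rewrite /list_int big_cat/= big_map; congr (_ + _); rewrite scaler_sumr.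
  by apply: eq_bigr => x _; rewrite /= scalerA.
have lim2 (x y : nat -> \bar R) : x @ \oo --> 0%E -> y @ \oo --> 0%E ->
    (2%:E * x k + (2 * c ^+ 2)%:E * y k)%E @[k --> \oo] --> 0%E.
  move=> x0 y0; rewrite -[X in _ --> X]adde0; apply: cvgeD => //.
    by rewrite -[X in _ --> X](mule0 2%:E); apply: cvgeZl.
  by rewrite -[X in _ --> X](mule0 (2 * c ^+ 2)%:E); apply: cvgeZl.
exists sc; split.
- by move=> k; rewrite /in_0T all_cat all_map; apply/andP; split; [exact: sT|exact: sT'].
- apply: (@squeeze_cvge _ _ _ _ (fun=> 0%E) _ (fun k =>
      (2%:E * (\int[lam]_(r in `]0%R, T]) ((list_eval (s k) r - f r) ^+ 2)%:E) +
      (2 * c ^+ 2)%:E * (\int[lam]_(r in `]0%R, T]) ((list_eval (s' k) r - f' r) ^+ 2)%:E))%E));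
    [|exact: cvg_cst|exact: lim2].
  apply: nearW => k; rewrite integral_ge0/=; last by move=> r _; rewrite lee_fin sqr_ge0.
  have m1 (g h : R -> R) : measurable_fun setT g -> measurable_fun setT h ->
      measurable_fun `]0%R, T] (fun r => ((g r - h r) ^+ 2)%:E).
    by move=> mg mh; apply/measurable_EFinP/measurable_funX/measurable_funTS/measurable_funB.
  have me s1 := @measurable_list_eval R s1.
  have c20 : (0 <= (2 * c ^+ 2)%:E)%E by rewrite lee_fin mulr_ge0// sqr_ge0.
  rewrite -ge0_integralZl//; [|exact: m1|by move=> r _; rewrite lee_fin sqr_ge0].
  rewrite -ge0_integralZl//; [|exact: m1|by move=> r _; rewrite lee_fin sqr_ge0].
  rewrite -ge0_integralD//; last 4 first.
  + by move=> r _; rewrite mule_ge0// lee_fin sqr_ge0.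
  + by apply: measurable_funeM; exact: m1.
  + by move=> r _; rewrite mule_ge0// lee_fin sqr_ge0.
  + by apply: measurable_funeM; exact: m1.
  apply: ge0_le_integral => //.
  + by move=> r _; rewrite lee_fin sqr_ge0.
  + by apply: m1 => //; apply: measurable_funD => //; exact: measurable_funM.
  + by apply: emeasurable_funD; apply: measurable_funeM; exact: m1.
  + move=> r _; rewrite -!EFinM -EFinD lee_fin evE.
    set x := list_eval _ _; set y := list_eval _ _.
    have -> : x + c * y - (f r + c * f' r) = (x - f r) + c * (y - f' r) by ring.
    have := sqr_ge0 ((x - f r) - c * (y - f' r)); nra.
- apply: (@squeeze_cvge _ _ _ _ (fun=> 0%E) _ (fun k =>
      (2%:E * (\int[P]_w (enorm (list_int W (s k) w - Z w) ^+ 2)%:E) +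
      (2 * c ^+ 2)%:E * (\int[P]_w (enorm (list_int W (s' k) w - Z' w) ^+ 2)%:E))%E));
    [|exact: cvg_cst|exact: lim2].
  apply: nearW => k; rewrite integral_ge0/=; last by move=> r _; rewrite lee_fin sqr_ge0.
  have m1 s1 (Y : Omega -> 'rV[R]_n) : in_0T T s1 -> measurable_fun setT Y ->
      measurable_fun setT (fun w => (enorm (list_int W s1 w - Y w) ^+ 2)%:E).
    move=> s1T mY; apply: measurable_enorm_sqr; apply: measurable_rVB => //.
    exact: measurable_list_int.
  have c20 : (0 <= (2 * c ^+ 2)%:E)%E by rewrite lee_fin mulr_ge0// sqr_ge0.
  rewrite -ge0_integralZl//; [|exact: m1|by move=> r _; rewrite lee_fin sqr_ge0].
  rewrite -ge0_integralZl//; [|exact: m1|by move=> r _; rewrite lee_fin sqr_ge0].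
  rewrite -ge0_integralD//; last 4 first.
  + by move=> r _; rewrite mule_ge0// lee_fin sqr_ge0.
  + by apply: measurable_funeM; exact: m1.
  + by move=> r _; rewrite mule_ge0// lee_fin sqr_ge0.
  + by apply: measurable_funeM; exact: m1.
  apply: ge0_le_integral => //.
  + by move=> r _; rewrite lee_fin sqr_ge0.
  + apply: m1; first by rewrite /in_0T all_cat all_map; apply/andP; split; [exact: sT|exact: sT'].
    by apply: measurable_rVD => //; exact: measurable_rVZ.
  + by apply: emeasurable_funD; apply: measurable_funeM; exact: m1.
  + move=> w _; rewrite -!EFinM -EFinD lee_fin inE'.
    set x := list_int _ _ _; set y := list_int _ _ _.
    have -> : x + c *: y - (Z w + c *: Z' w) = (x - Z w) + c *: (y - Z' w).
      by rewrite scalerBr opprD addrACA.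
    by apply: le_trans (enormD_sqr _ _) _; rewrite enormZ_sqr mulrA.
Qed.

Lemma wiener_pair0 : wiener_pair (fun=> 0) (fun=> 0).
Proof.
split => //; first by exists 0 => r; rewrite normr0.
exists (fun=> [::]); split => //.
- rewrite (_ : (fun k => _) = (fun=> 0%E)); first exact: cvg_cst.
  by apply/funext => k; rewrite integral0_eq// => r _; rewrite /list_eval big_nil subrr expr0n.
- rewrite (_ : (fun k => _) = (fun=> 0%E)); first exact: cvg_cst.
  apply/funext => k; rewrite integral0_eq// => w _.
  rewrite /list_int big_nil subrr /enorm big1 ?sqrtr0 ?expr0n// => i _.
  by rewrite mxE expr0n.
Qed.

Lemma wiener_pair_sum N (c : nat -> R) (Z : nat -> Omega -> 'rV[R]_n) (f : nat -> R -> R) :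
  (forall j, (j < N)%N -> wiener_pair (Z j) (f j)) ->
  wiener_pair (fun w => \sum_(0 <= j < N) c j *: Z j w) (fun r => \sum_(0 <= j < N) c j * f j r).
Proof.
elim: N => [|N IH] H.
  have E1 : (fun w => \sum_(0 <= j < 0) c j *: Z j w) = (fun=> 0) by apply/funext => w; rewrite big_geq.
  have E2 : (fun r => \sum_(0 <= j < 0) c j * f j r) = (fun=> 0) by apply/funext => w; rewrite big_geq.
  by rewrite E1 E2; exact: wiener_pair0.
have E1 : (fun w => \sum_(0 <= j < N.+1) c j *: Z j w) = (fun w => \sum_(0 <= j < N) c j *: Z j w + c N *: Z N w).
  by apply/funext => w; rewrite big_nat_recr.
have E2 : (fun r => \sum_(0 <= j < N.+1) c j * f j r) = (fun r => \sum_(0 <= j < N) c j * f j r + c N * f N r).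
  by apply/funext => w; rewrite big_nat_recr.
by rewrite E1 E2; apply: wiener_pairDZ; [apply: IH => j jN; apply: H; exact: ltnW|exact: H].
Qed.

End wiener_pairs.

(** * Elementary estimates on the real line *)

Section real_line.
Context (R : realType).
Local Notation lam := (@lebesgue_measure R).
Implicit Types (f g x : R -> R) (a b r s t M : R).

(** Heine-Cantor: the local moduli for [eps / 2] are patched together by the near-covering form of
    compactness, with [dlt] tending to 0 from the right as the filter parameter. *)
Lemma within_uniform_continuous (A : set R) f eps : compact A ->
  {within A, continuous f} -> 0 < eps ->
  exists2 dlt, 0 < dlt & forall u v, A u -> A v -> `|u - v| < dlt -> `|f u - f v| < eps.
Proof.
move=> /compact_near_coveringP cA /subspace_continuousP cf eps0.
pose Q (dlt : R) u := A u -> forall v, A v -> `|u - v| < dlt -> `|f u - f v| < eps.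
have : \forall dlt \near 0^'+, A `<=` Q dlt.
  apply: cA => u Au; have /cvgrPdist_lt /(_ (eps / 2)) := cf u Au.
  rewrite divr_gt0// => /(_ isT); rewrite near_withinE => /nbhs_ballP[r /= r0 H].
  exists (ball u (r / 2), [set dlt | dlt < r / 2]) => /=.
    by split; [exact/nbhsx_ballx/divr_gt0|apply: nbhs_right_lt; exact: divr_gt0].
  move=> [u' dlt] /= [uu' dr] Au' v Av u'v.
  move: uu'; rewrite /ball/= => uu'.
  have h1 : `|f u - f u'| < eps / 2.
    by apply: H => //; rewrite /ball/=; apply: lt_le_trans uu' _; lra.
  have h2 : `|f u - f v| < eps / 2.
    apply: H => //; rewrite /ball/=; apply: le_lt_trans (ler_distD u' _ _) _.
    by have := lt_trans u'v dr; move: uu'; lra.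
  by apply: le_lt_trans (ler_distD (f u) _ _) _; rewrite (distrC (f u')); lra.
move=> H.
have [dlt [dlt0 Hd]] := filter_ex (filterI (nbhs_right_gt (0 : R)) H).
by exists dlt => // u v Au; exact: Hd.
Qed.

Lemma within_bounded a b f : {within `[a, b], continuous f} ->
  exists2 M, 0 <= M & forall s, s \in `[a, b] -> `|f s| <= M.
Proof.
move=> cf; have /compact_bounded[M [_ /(_ (`|M| + 1))]] : compact (f @` `[a, b]%classic).
  by apply: continuous_compact => //; exact: segment_compact.
rewrite ltr_pwDr ?ler_norm// => /(_ isT) H; exists (`|M| + 1); first by rewrite addr_ge0.
by move=> s sab; apply: H; exists s.
Qed.

Lemma bounded_itv_integrable (i : interval R) f M : (lam [set` i] < +oo)%E ->
  measurable_fun [set` i] f -> (forall s, s \in i -> `|f s| <= M) ->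
  lam.-integrable [set` i] (EFin \o f).
Proof.
move=> ioo mf fM; apply: measurable_bounded_integrable => //.
by exists M; split; [exact: num_real|move=> K MK s /fM; move/le_trans; apply; exact: ltW].
Qed.

Lemma norm_Rintegral_itvoc r s f M : r <= s -> 0 <= M -> measurable_fun `]r, s] f ->
  (forall u, u \in `]r, s] -> `|f u| <= M) ->
  `|\int[lam]_(u in `]r, s]) f u| <= M * (s - r).
Proof.
move=> rs M0 mf fM.
have loo : (lam `]r, s]%classic < +oo)%E by rewrite lebesgue_measure_itv/=; case: ifP; rewrite ?ltry// -EFinB ltry.
have fi := bounded_itv_integrable loo mf fM.
apply: le_trans (le_normr_Rintegral _ fi) _ => //.
apply: (@le_trans _ _ (\int[lam]_(u in `]r, s]) M)).
  apply: le_Rintegral => //; first exact: integrable_norm.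
  by apply: (bounded_itv_integrable (M := `|M|)) => //; exact: measurable_cst.
have lE : fine (lam `]r, s]%classic) <= s - r.
  by rewrite lebesgue_measure_itv/= lte_fin; case: ifPn => //= _; rewrite subr_ge0.
by rewrite Rintegral_cst//; exact: ler_wpM2l.
Qed.

(** Everything follows from 1 + x <= e^x taken at u and at -u: the second gives e^u (1 - u) <= 1,
    and 1 <= (1 + u + 2u^2)(1 - u) as long as u <= 1/2. *)
Lemma norm_expRB1 (u : R) : `|u| <= 1 / 2 -> `|expR u - 1 - u| <= 2 * u ^+ 2.
Proof.
rewrite ler_norml => /andP[u1 u2].
have h1 := expR_ge1Dx u; have h2 := expR_ge1Dx (- u).
have h3 : expR u * expR (- u) = 1 by rewrite expRxMexpNx_1.
have h4 := expR_gt0 u.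
rewrite ger0_norm; last by lra.
have h5 : expR u * (1 - u) <= expR u * expR (- u) by apply: ler_wpM2l; [exact: ltW|lra].
rewrite h3 in h5.
have h6 : (1 + u + 2 * u ^+ 2) * (1 - u) = 1 + u ^+ 2 * (1 - 2 * u) by ring.
have h7 : 0 <= u ^+ 2 * (1 - 2 * u) by rewrite mulr_ge0 ?sqr_ge0//; lra.
have h8 : 0 < 1 - u by lra.
have : expR u <= 1 + u + 2 * u ^+ 2.
  by rewrite -(ler_pM2r h8) h6; lra.
lra.
Qed.

End real_line.

(** * The integrating factor and the Euler scheme *)

Section integrating_factor.
Context (R : realType) (beta : R -> R) (M : R).
Hypotheses (mbeta : measurable_fun setT beta) (bM : forall r, `|beta r| <= M).
Local Notation lam := (@lebesgue_measure R).
Local Notation m := (m_ beta).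
Implicit Types r s t h : R.

Lemma lebesgue_itv_lty (b1 b2 : bool) (r s : R) :
  (lam [set` Interval (BSide b1 r) (BSide b2 s)] < +oo)%E.
Proof. by rewrite lebesgue_measure_itv/=; case: ifP => _; rewrite ?ltry// -EFinB ltry. Qed.

Lemma bound_ge0 : 0 <= M. Proof. exact: le_trans (normr_ge0 _) (bM 0). Qed.

Lemma beta_integral_diff r s : 0 <= r -> r <= s ->
  \int[lam]_(u in `[0, s]) beta u - \int[lam]_(u in `[0, r]) beta u =
  \int[lam]_(u in `]r, s]) beta u.
Proof.
move=> r0 rs; apply: Rintegral_itvB; rewrite ?bnd_simp//.
apply: (bounded_itv_integrable (M := M)) => //; first exact: lebesgue_itv_lty.
exact: measurable_funTS.
Qed.

Lemma beta_integral_lip r s : 0 <= r -> r <= s ->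
  `|\int[lam]_(u in `]r, s]) beta u| <= M * (s - r).
Proof.
move=> r0 rs; apply: norm_Rintegral_itvoc => //; first exact: bound_ge0.
exact: measurable_funTS.
Qed.

Lemma m_gt0 s : 0 < m s. Proof. exact: expR_gt0. Qed.

Lemma m0 : m 0 = 1.
Proof. by rewrite /m_ set_itv1 Rintegral_set1 oppr0 expR0. Qed.

Lemma m_ratio r s : 0 <= r -> r <= s -> m s = m r * expR (- \int[lam]_(u in `]r, s]) beta u).
Proof.
by move=> r0 rs; rewrite /m_ -expRD -beta_integral_diff//; congr expR; ring.
Qed.

Lemma m_ratio_le T r s : 0 <= r <= T -> 0 <= s <= T -> m r / m s <= expR (M * T).
Proof.
move=> /andP[r0 rT] /andP[s0 sT]; have M0 := bound_ge0.
rewrite /m_ -expRN -expRD ler_expR opprK.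
have [rs|/ltW sr] := leP r s.
  rewrite addrC beta_integral_diff//; apply: le_trans (ler_norm _) _.
  by apply: le_trans (beta_integral_lip r0 rs) _; rewrite ler_wpM2l//; lra.
rewrite addrC -opprB beta_integral_diff//; apply: le_trans (ler_norm _) _; rewrite normrN.
by apply: le_trans (beta_integral_lip s0 sr) _; rewrite ler_wpM2l//; lra.
Qed.

Lemma m_ratio_near1 r s : 0 <= r -> r <= s -> M * (s - r) <= 1 / 2 ->
  `|m s / m r - 1| <= 2 * (M * (s - r)).
Proof.
move=> r0 rs Mh; rewrite (m_ratio r0 rs) mulrAC divff ?mul1r ?gt_eqF ?m_gt0//.
set b := - _; have b1 : `|b| <= M * (s - r) by rewrite normrN beta_integral_lip.
have H := norm_expRB1 (le_trans b1 Mh).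
have b2 : b ^+ 2 = `|b| ^+ 2 by rewrite real_normK ?num_real.
have -> : expR b - 1 = (expR b - 1 - b) + b by ring.
apply: le_trans (ler_normD _ _) _.
have b0 := normr_ge0 b; rewrite b2 expr2 in H.
have : `|b| * `|b| <= `|b| * (1 / 2) by rewrite ler_wpM2l// (le_trans b1).
lra.
Qed.

(** Here [x] is one coordinate of a path, [y j] the noise accumulated up to the grid point [tau j],
    [K] a bound on [x], and [w] its modulus of continuity at the mesh [h]. *)
Variables (T t K w : R) (N : nat) (x : R -> R) (y : nat -> R).
Hypotheses (tT : 0 < t <= T) (N0 : (0 < N)%N).
Let h := t / N%:R.
Let tau (j : nat) := j%:R * h.
Hypotheses (cx : {within `[0, t], continuous x})
  (xK : forall s, s \in `[0, t] -> `|x s| <= K)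
  (xw : forall u v, u \in `[0, t] -> v \in `[0, t] -> `|u - v| <= h -> `|x u - x v| <= w)
  (Mh : M * h <= 1 / 2)
  (xE : forall j, (j <= N)%N ->
    x (tau j) = x 0 - \int[lam]_(s in `[0, tau j]) (beta s * x s) + y j).

(* Along the exact solution the scheme x_{j+1} = x_j m_{j+1} / m_j + (y_{j+1} - y_j)
   commits a local error of order h (h + w), and x / m telescopes. *)
Lemma euler_error :
  `|m t * x 0 + \sum_(0 <= j < N) m t / m (tau j.+1) * (y j.+1 - y j) - x t| <=
  expR (M * T) * (t * (2 * K * M ^+ 2 * h + M * w)).
Proof.
have M0 := bound_ge0.
have /andP[t0 tT'] := tT.
have NR : 0 < N%:R :> R by rewrite ltr0n.
have h0 : 0 < h by rewrite divr_gt0.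
have tau0 : tau 0 = 0 by rewrite /tau mul0r.
have tauN : tau N = t by rewrite /tau /h mulrC divfK// gt_eqF.
have tauS j : tau j.+1 - tau j = h by rewrite /tau -natr1; ring.
have tau_ge0 j : 0 <= tau j by rewrite mulr_ge0// ltW.
have tau_le j k : (j <= k)%N -> tau j <= tau k by move=> jk; rewrite ler_wpM2r ?ler_nat// ltW.
have tau_in j : (j <= N)%N -> tau j \in `[0, t].
  by move=> jN; rewrite in_itv/= tau_ge0 -tauN tau_le.
have K0 : 0 <= K by apply: le_trans (xK (tau_in 0%N (leq0n _))).
have mx : measurable_fun `[0, t] x by exact: subspace_continuous_measurable_fun.
have w0 : 0 <= w.
  by apply: le_trans (xw (tau_in 0%N (leq0n _)) (tau_in 0%N (leq0n _)) _); rewrite ?subrr ?normr0// ltW.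
pose b j := \int[lam]_(u in `]tau j, tau j.+1]) beta u.
(* The defect of the exact path in the scheme. Its first-order terms cancel: 1 - e^(-b) is b up to
   b^2, and the integral is b x(tau j) up to the oscillation of [x] on the cell. *)
pose e j := x (tau j) * (1 - expR (- b j)) - \int[lam]_(s in `]tau j, tau j.+1]) (beta s * x s).
have sub_itv j : (j < N)%N -> `]tau j, tau j.+1] `<=` `[0, t]%classic.
  move=> jN s; rewrite /= !in_itv/= => /andP[s1 s2].
  rewrite (le_trans (tau_ge0 j) (ltW s1))/= (le_trans s2)//.
  by rewrite -tauN tau_le.
have mbx j : (j < N)%N -> measurable_fun `]tau j, tau j.+1] (fun s => beta s * x s).
  move=> jN; apply: measurable_funM; first exact: measurable_funTS.
  by apply: measurable_funS mx => //; exact: sub_itv.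
have yE j : (j < N)%N -> y j.+1 - y j = x (tau j.+1) - x (tau j) * expR (- b j) - e j.
  move=> jN; have := xE jN; have := xE (ltnW jN); rewrite /e.
  have <- : \int[lam]_(s in `[0, tau j.+1]) (beta s * x s) - \int[lam]_(s in `[0, tau j]) (beta s * x s) =
    \int[lam]_(s in `]tau j, tau j.+1]) (beta s * x s).
    apply: Rintegral_itvB; rewrite ?bnd_simp ?tau_ge0 ?tau_le//.
    apply: (bounded_itv_integrable (M := M * K)); first exact: lebesgue_itv_lty.
      apply: measurable_funM; first exact: measurable_funTS.
      apply: measurable_funS mx => //; apply: subset_itvl; rewrite bnd_simp.
      by rewrite -tauN tau_le.
    move=> s; rewrite in_itv/= => /andP[s1 s2]; rewrite normrM ler_pM//.
    by apply: xK; rewrite in_itv/= s1 (le_trans s2)// -tauN tau_le.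
  set I1 := \int[lam]_(s in `[0, tau j.+1]) _.
  set I0 := \int[lam]_(s in `[0, tau j]) _; lra.
have eb j : (j < N)%N -> `|e j| <= (2 * K * M ^+ 2 * h + M * w) * h.
  move=> jN.
  have bh : `|b j| <= M * h by rewrite -(tauS j); apply: beta_integral_lip => //; exact: tau_le.
  have -> : e j = - x (tau j) * (expR (- b j) - 1 - - b j) -
      \int[lam]_(s in `]tau j, tau j.+1]) (beta s * (x s - x (tau j))).
    have -> : \int[lam]_(s in `]tau j, tau j.+1]) (beta s * (x s - x (tau j))) =
        \int[lam]_(s in `]tau j, tau j.+1]) (beta s * x s) - x (tau j) * b j.
      under eq_Rintegral do rewrite mulrBr.
      rewrite RintegralB//=.
      - congr (_ - _); rewrite /b -RintegralZl//.
          by apply: eq_Rintegral => s _; rewrite mulrC.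
        apply: (bounded_itv_integrable (M := M)) => //; first exact: lebesgue_itv_lty.
        exact: measurable_funTS.
      - apply: (bounded_itv_integrable (M := M * K)); [exact: lebesgue_itv_lty|exact: mbx|].
        by move=> s sj; rewrite normrM ler_pM// xK//; exact: (sub_itv j jN s).
      - apply: (bounded_itv_integrable (M := M * K)); first exact: lebesgue_itv_lty.
          by apply: measurable_funM => //; exact: measurable_funTS.
        by move=> s sj; rewrite normrM ler_pM// xK//; apply: tau_in; exact: ltnW.
    by rewrite /e; ring.
  apply: le_trans (ler_normB _ _) _.
  have h1 : `|- x (tau j) * (expR (- b j) - 1 - - b j)| <= K * (2 * (M * h) ^+ 2).
    rewrite normrM normrN ler_pM//; first by apply: xK; apply: tau_in; exact: ltnW.
    apply: le_trans (norm_expRB1 _) _; first by rewrite normrN; exact: le_trans bh Mh.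
    by rewrite sqrrN ler_wpM2l// -real_normK ?num_real// lerXn2r ?nnegrE// mulr_ge0// ltW.
  have h2 : `|\int[lam]_(s in `]tau j, tau j.+1]) (beta s * (x s - x (tau j)))| <= M * w * h.
    rewrite -[X in _ <= _ * X](tauS j); apply: norm_Rintegral_itvoc; first exact: tau_le.
    - by rewrite mulr_ge0.
    - apply: measurable_funM; first exact: measurable_funTS.
      by apply: measurable_funB => //; apply: measurable_funS mx => //; exact: sub_itv.
    - move=> s sj; rewrite normrM ler_pM// xw//; first exact: (sub_itv j jN s).
        by apply: tau_in; exact: ltnW.
      move: sj; rewrite in_itv/= => /andP[s1 s2].
      by rewrite ger0_norm ?subr_ge0 ?(ltW s1)// -(tauS j) lerB.
  nra.
(* Dividing by m(tau_{j+1}) turns the exact part of each step into a difference of consecutive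
   values of x / m, so only the defects survive. *)
have telE : \sum_(0 <= j < N) m t / m (tau j.+1) * (y j.+1 - y j) =
    x t - m t * x 0 - \sum_(0 <= j < N) m t / m (tau j.+1) * e j.
  have -> : x t - m t * x 0 = m t * (x (tau N) / m (tau N) - x (tau 0) / m (tau 0)).
    have alg (p A B : R) : p != 0 -> A - p * B = p * (A / p - B / 1) by move=> p0; field.
    by rewrite tau0 m0 tauN; apply: alg; rewrite gt_eqF// m_gt0.
  rewrite -(telescope_sumr (fun j => x (tau j) / m (tau j)))// mulr_sumr -sumrB.
  rewrite big_nat_cond [RHS]big_nat_cond; apply: eq_bigr => j /andP[/andP[_ jN] _].
  rewrite yE// (m_ratio (tau_ge0 j) (tau_le _ _ (leqnSn j))) -/(b j).
  have alg (p q E A B C : R) : q != 0 -> E != 0 ->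
    p / (q * E) * (A - B * E - C) = p * (A / (q * E) - B / q) - p / (q * E) * C.
    by move=> q0 E0; field; rewrite q0 E0.
  apply: alg; first by apply/lt0r_neq0/m_gt0.
  exact/lt0r_neq0/expR_gt0.
rewrite telE.
set S := \sum_(0 <= j < N) m t / m (tau j.+1) * e j.
have -> : m t * x 0 + (x t - m t * x 0 - S) - x t = - S by ring.
rewrite normrN; apply: le_trans (ler_norm_sum _ _ _) _.
apply: (@le_trans _ _ (\sum_(0 <= j < N) expR (M * T) * ((2 * K * M ^+ 2 * h + M * w) * h))).
  rewrite big_nat_cond [leRHS]big_nat_cond; apply: ler_sum => j /andP[/andP[_ jN] _].
  rewrite normrM ler_pM//; last exact: eb.
  rewrite ger0_norm; last by rewrite divr_ge0// ltW// m_gt0.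
  apply: m_ratio_le; first by rewrite (ltW t0).
  by have := tau_in _ jN; rewrite in_itv/= => /andP[-> /le_trans ->].
rewrite sumr_const_nat subn0 -mulr_natl.
have -> : t = N%:R * h by rewrite -tauN.
by rewrite le_eqVlt; apply/orP; left; apply/eqP; ring.
Qed.

End integrating_factor.

Section lipschitz_within.
Context (R : realType).

Lemma lipschitz_within (a b K : R) (g : R -> R) :
  (forall r s, a <= r -> r <= s -> s <= b -> `|g s - g r| <= K * (s - r)) ->
  {within `[a, b], continuous g}.
Proof.
move=> gK; apply/subspace_continuousP => u; rewrite /= in_itv/= => /andP[au ub].
apply/cvgrPdist_lt => eps eps0; rewrite near_withinE; apply/nbhs_ballP.
have K1 : 0 < `|K| + 1 by rewrite ltr_pwDr.
exists (eps / (`|K| + 1)) => /=; first exact: divr_gt0.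
move=> v; rewrite /ball/= => uv; rewrite in_itv/= => /andP[av vb].
apply: (@le_lt_trans _ _ ((`|K| + 1) * `|u - v|)).
  have KK : K <= `|K| + 1 by apply: le_trans (ler_norm K) _; rewrite lerDl.
  have [uv'|/ltW vu] := leP u v.
    rewrite distrC (distrC u); apply: le_trans (gK _ _ au uv' vb) _.
    have -> : `|v - u| = v - u by rewrite ger0_norm// subr_ge0.
    by rewrite ler_wpM2r// subr_ge0.
  apply: le_trans (gK _ _ av vu ub) _.
  have -> : `|u - v| = u - v by rewrite ger0_norm// subr_ge0.
  by rewrite ler_wpM2r// subr_ge0.
by rewrite mulrC -ltr_pdivlMr.
Qed.

Lemma within_continuous_comp (A : set R) (g k : R -> R) :
  {within A, continuous g} -> continuous k -> {within A, continuous (k \o g)}.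
Proof. by move=> cg ck x; exact: (@continuous_comp (subspace A) R R g k x (cg x) (ck (g x))). Qed.

Variables (beta : R -> R) (M : R).
Hypotheses (mbeta : measurable_fun setT beta) (bM : forall r, `|beta r| <= M).
Variable T : R.

Lemma within_beta_integral :
  {within `[0, T], continuous (fun s => \int[lebesgue_measure]_(r in `[0, s]) beta r)}.
Proof.
apply: (@lipschitz_within _ _ M) => r s r0 rs _.
by rewrite (beta_integral_diff mbeta bM)//; exact: beta_integral_lip.
Qed.

Lemma within_m : {within `[0, T], continuous (m_ beta)}.
Proof.
apply: (@within_continuous_comp _ _ (fun x => expR (- x)) within_beta_integral) => x.
by apply: (@continuous_comp _ _ _ (@GRing.opp R)); [exact: oppr_continuous|exact: continuous_expR].
Qed.

Lemma within_mV : {within `[0, T], continuous (fun s => (m_ beta s)^-1)}.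
Proof.
rewrite (_ : (fun s => _) = expR \o (fun s => \int[lebesgue_measure]_(r in `[0, s]) beta r)).
  by apply: (within_continuous_comp within_beta_integral); exact: continuous_expR.
by apply/funext => s; rewrite /m_ /= -expRN opprK.
Qed.

End lipschitz_within.

(** * The solution tested with Gaussian kernels *)

Section sde_kernel.
Context (R : realType) (n : nat) d (Omega : measurableType d)
  (P : probability Omega R) (T : R) (F : R -> set (set Omega))
  (W X : R -> Omega -> 'rV[R]_n) (beta sigma : R -> R) (M S : R).
Hypotheses (hF : filtration T F) (hW : brownian_motion P T F W) (T0 : 0 < T).
Hypotheses (mbeta : measurable_fun setT beta) (bM : forall r, `|beta r| <= M).
Hypotheses (msigma : measurable_fun setT sigma) (sS : forall r, `|sigma r| <= S).
Hypothesis hX : sde_solution P T F W beta sigma X.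
Local Notation lam := (@lebesgue_measure R).
Local Notation m := (m_ beta).

Let M0 : 0 <= M := bound_ge0 bM.

(** The integrand is extended by zero after [t], so that the integrals up to different times all
    live on ]0, T] and can be combined linearly. *)
Lemma stoch_integral_wiener t Y : 0 <= t <= T -> stoch_integral P W sigma t Y ->
  wiener_pair P T W Y (fun r => sigma r * \1_`]0, t] r).
Proof.
move=> /andP[t0 tT] [mY [phi [phit phif phiY]]].
pose s k := [seq (sf_node (phi k) i, sf_node (phi k) i.+1, sf_coef (phi k) i)
  | i <- index_iota 0 (sf_size (phi k))].
have evE k r : list_eval (s k) r = step_eval (phi k) r by rewrite /list_eval big_map.
have inE' k w : list_int W (s k) w = step_int W (phi k) w by rewrite /list_int big_map.
have node_le k i j : (i <= j)%N -> (j <= sf_size (phi k))%N ->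
    sf_node (phi k) i <= sf_node (phi k) j.
  have [_ _ H] := phit k.
  move=> ij; elim: j ij => [|j IH]; first by rewrite leqn0 => /eqP->.
  rewrite leq_eqVlt => /orP[/eqP->//|ij] jN.
  by apply: le_trans (IH ij (ltnW jN)) _; exact: H.
have node_in k i : (i <= sf_size (phi k))%N -> 0 <= sf_node (phi k) i <= t.
  move=> iN; have [n0 nt _] := phit k.
  by rewrite (le_trans n0 (node_le k _ _ (leq0n _) iN)) (le_trans (node_le k _ _ iN (leqnn _)) nt).
split => //.
- by apply: measurable_funM => //; exact: measurable_indic.
- exists S => r; rewrite normrM; have S0 : 0 <= S by apply: le_trans (sS 0).
  rewrite -[S]mulr1 ler_pM//.
  by rewrite indicE; case: (_ \in _); rewrite ?normr1 ?normr0 ?ler01.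
exists s; split.
- move=> k; rewrite /in_0T all_map; apply/allP => i; rewrite mem_index_iota => /andP[_ iN] /=.
  have /andP[-> _] := node_in k i (ltnW iN).
  by have /andP[_ /le_trans->//] := node_in k i.+1 iN; rewrite node_le.
- apply: (@squeeze_cvge _ _ _ _ (fun=> 0%E) _ _ _ _ _ phif); last exact: cvg_cst.
  apply: nearW => k; rewrite integral_ge0/=; last by move=> r _; rewrite lee_fin sqr_ge0.
  have mq : measurable_fun setT (fun r => ((step_eval (phi k) r - sigma r) ^+ 2)%:E).
    apply/measurable_EFinP/measurable_funX/measurable_funB => //.
    have -> : step_eval (phi k) = list_eval (s k) by apply/funext => r; rewrite evE.
    exact: measurable_list_eval.
  have -> : (\int[lam]_(r in `]0%R, T]) ((list_eval (s k) r - sigma r * \1_`]0, t] r) ^+ 2)%:E =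
    \int[lam]_(r in `]0%R, t]) ((step_eval (phi k) r - sigma r) ^+ 2)%:E)%E.
    rewrite [LHS]integral_mkcond [RHS]integral_mkcond; apply: eq_integral => r _.
    rewrite !patchE !mem_setE evE indicE mem_setE !in_itv/=.
    have [r0|] := boolP (0 < r) => //=; have [rt|rt] := leP r t.
      by rewrite (le_trans rt tT) mulr1.
    (* After [t] the step function vanishes too, because all its nodes are at most [t]. *)
    case: ifP => // _; rewrite mulr0 subr0 /step_eval big_nat_cond big1 ?expr0n//.
    move=> i /andP[/andP[_ iN] _]; rewrite indicE mem_setE in_itv/=.
    have /andP[_ it] := node_in k i.+1 iN.
    by rewrite (leNgt r) (le_lt_trans it rt) andbF mulr0.
  apply: ge0_subset_integral => //; [exact: measurable_funTS|by move=> r _; rewrite lee_fin sqr_ge0|].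
  by move=> r; rewrite /= !in_itv/= => /andP[/ltW->].
- by under eq_fun => k do under eq_integral do rewrite inE'.
Qed.

Lemma Fmeas_X0 : Fmeas F 0 (X 0).
Proof.
have [aX _ _] := hX; apply/(FmeasP hF); first by rewrite lexx ltW.
by move=> A mA; apply: aX => //; rewrite in_itv/= lexx ltW.
Qed.

Lemma measurable_X t : t \in `[0, T] -> measurable_fun setT (X t).
Proof.
move=> tT; have [aX _ _] := hX; apply: (Fmeas_measurable hF (s := t)).
  by move: tT; rewrite in_itv.
apply/(FmeasP hF); first by move: tT; rewrite in_itv.
by move=> A mA; exact: aX.
Qed.

Variables (t : R).
Hypothesis tT : 0 < t <= T.

Let h (N : nat) := t / N.+1%:R.
Let tau N j : R := j%:R * h N.
Let c N j := m t / m (tau N j.+1).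

Let t0 : 0 < t. Proof. by case/andP: tT. Qed.
Let tleT : t <= T. Proof. by case/andP: tT. Qed.
Let h0 N : 0 < h N. Proof. by rewrite divr_gt0. Qed.
Let tau_ge0 N j : 0 <= tau N j. Proof. by rewrite mulr_ge0// ltW. Qed.
Let tauN N : tau N N.+1 = t. Proof. by rewrite /tau /h mulrC divfK. Qed.
Let tau_le N j k : (j <= k)%N -> tau N j <= tau N k.
Proof. by move=> jk; rewrite ler_wpM2r ?ler_nat// ltW. Qed.
Let tau_in N j : (j <= N.+1)%N -> tau N j <= t.
Proof. by move=> jN; rewrite -(tauN N) tau_le. Qed.

Let h_cvg0 : h N @[N --> \oo] --> 0.
Proof.
rewrite -[X in _ --> X](mulr0 t); apply: cvgM; first exact: cvg_cst.
exact: cvg_harmonic.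
Qed.

(** [f] is the integrand of the explicit solution and [fN N] that of the noise in the scheme with N
    + 1 steps. The latter is kept as a combination of the integrands on ]0, tau_j], since these are
    what the equation supplies. *)
Let f (r : R) := sigma r * (m t / m r) * \1_`]0, t] r.
Let fN N (r : R) := \sum_(0 <= j < N.+1)
  c N j * (sigma r * \1_`]0, tau N j.+1] r + (-1) * (sigma r * \1_`]0, tau N j] r)).

Let mmV : measurable_fun `[0, T] (fun r => (m r)^-1).
Proof. by apply: subspace_continuous_measurable_fun => //; exact: (within_mV mbeta bM). Qed.

Let mf : measurable_fun `]0, T] f.
Proof.
apply: measurable_funM; last by apply: measurable_funTS; exact: measurable_indic.
apply: measurable_funM; first exact: measurable_funTS.
apply: measurable_funM => //; apply: measurable_funS mmV => //.
by move=> r; rewrite /= !in_itv/= => /andP[/ltW->].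
Qed.

(** The differences [I j.+1 - I j] are the indicators of the cells, so at a given [r] at most one
    term counts, and there m(tau_{j+1}) / m(r) is within 2 M h of 1. *)
Let fN_near N r : M * h N <= 1 / 2 -> r \in `]0, T] ->
  `|fN N r - f r| <= S * expR (M * T) * (2 * (M * h N)).
Proof.
move=> Mh; rewrite in_itv/= => /andP[r0 rT].
pose I j : R := \1_`]0, tau N j] r.
have IE j : I j = (r <= tau N j)%R%:R.
  by rewrite /I indicE mem_setE in_itv/= r0.
have I0 : I 0%N = 0 by rewrite IE /tau mul0r leNgt r0.
have D0 : 0 <= expR (M * T) * (2 * (M * h N)).
  by rewrite mulr_ge0 ?expR_ge0// mulr_ge0// mulr_ge0// ltW.
have fE : f r = sigma r * \sum_(0 <= j < N.+1) (m t / m r) * (I j.+1 - I j).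
  rewrite -mulr_sumr telescope_sumr// I0 subr0.
  by rewrite /I tauN /f !mulrA.
have -> : fN N r = sigma r * \sum_(0 <= j < N.+1) c N j * (I j.+1 - I j).
  by rewrite mulr_sumr; apply: eq_bigr => j _; rewrite -/(I j) -/(I j.+1); ring.
rewrite fE -mulrBr -sumrB normrM -mulrA ler_pM//.
have Ij j : 0 <= I j.+1 - I j.
  rewrite !IE subr_ge0 ler_nat; case: (leP r (tau N j)) => //= H.
  by rewrite (le_trans H)// tau_le.
apply: (@le_trans _ _ (\sum_(0 <= j < N.+1) expR (M * T) * (2 * (M * h N)) * (I j.+1 - I j))); last first.
  rewrite -mulr_sumr telescope_sumr// I0 subr0 ler_piMr// IE.
  by rewrite lern1 leq_b1.
apply: le_trans (ler_norm_sum _ _ _) _.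
rewrite big_nat_cond [leRHS]big_nat_cond; apply: ler_sum => j /andP[/andP[_ jN] _].
rewrite -mulrBl normrM (ger0_norm (Ij j)).
have [->|nz] := eqVneq (I j.+1 - I j) 0; first by rewrite !mulr0.
apply: ler_wpM2r => //.
have /andP[rj1 rj] : (r <= tau N j.+1) && (tau N j < r).
  move: nz; rewrite !IE; case: (leP r (tau N j)) => [H|_].
    by rewrite (le_trans H (tau_le _ (leqnSn j))) subrr eqxx.
  by case: leP; rewrite // subrr eqxx.
have tjT : tau N j.+1 <= T by apply: le_trans (tau_in jN) tleT.
have tjh : tau N j.+1 - r <= h N.
  have : tau N j.+1 - tau N j = h N by rewrite /tau -natr1; ring.
  lra.
have -> : c N j - m t / m r = m t / m (tau N j.+1) * (1 - m (tau N j.+1) / m r).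
  by rewrite /c mulrBr mulr1; congr (_ - _); rewrite mulrA divfK// gt_eqF// m_gt0.
rewrite normrM ler_pM//.
  rewrite ger0_norm; last by rewrite divr_ge0// ltW// m_gt0.
  by apply: (m_ratio_le mbeta bM); rewrite ?(ltW t0)// tau_ge0.
rewrite distrC; apply: le_trans (m_ratio_near1 mbeta bM (ltW r0) rj1 _) _.
  by apply: le_trans Mh; rewrite ler_wpM2l.
by rewrite !ler_wpM2l.
Qed.

Let S0 : 0 <= S. Proof. exact: le_trans (normr_ge0 _) (sS 0). Qed.

Let fbound r : r \in `]0, T] -> `|f r| <= S * expR (M * T).
Proof.
rewrite in_itv/= => /andP[r0 rT]; rewrite /f !normrM.
rewrite -[leRHS]mulr1; apply: ler_pM => //; last first.
  by rewrite indicE; case: (_ \in _); rewrite ?normr1 ?normr0 ?ler01.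
apply: ler_pM => //; rewrite -normrM ger0_norm; last by rewrite divr_ge0// ltW// m_gt0.
by apply: (m_ratio_le mbeta bM); rewrite ?(ltW t0)// ltW.
Qed.

Let f_lty : (\int[lam]_(r in `]0%R, T]) (f r ^+ 2)%:E < +oo)%E.
Proof.
apply: (@le_lt_trans _ _ (\int[lam]_(r in `]0%R, T]) ((S * expR (M * T)) ^+ 2)%:E)%E).
  apply: ge0_le_integral => //.
  - by move=> r _; rewrite lee_fin sqr_ge0.
  - by apply/measurable_EFinP/measurable_funX.
  - move=> r rT; rewrite lee_fin -real_normK ?num_real// lerXn2r ?nnegrE//.
      by rewrite mulr_ge0// expR_ge0.
    exact: fbound.
by rewrite integral_cst//= lebesgue_measure_itv/=; case: ifPn; rewrite ?mule0 -?EFinB -?EFinM ltry.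
Qed.

Let vs2E : \int[lam]_(r in `]0, T]) (f r ^+ 2) = vs2 beta sigma t.
Proof.
have -> : \int[lam]_(r in `]0, T]) (f r ^+ 2) =
    \int[lam]_(r in `]0, t]) (m t ^+ 2 * (sigma r ^+ 2 * m r ^- 2)).
  rewrite [LHS]Rintegral_mkcond [RHS]Rintegral_mkcond; apply: eq_Rintegral => r _.
  rewrite !patchE !mem_setE /f indicE mem_setE !in_itv/=.
  have [r0|] := boolP (0 < r) => //=; have [rt|rt] := leP r t.
    by rewrite (le_trans rt tleT) mulr1 !exprMn exprVn; ring.
  by case: ifP => // _; rewrite mulr0 expr0n.
have mi : measurable_fun `]0, t] (fun r => sigma r ^+ 2 * m r ^- 2).
  apply: measurable_funM; first by apply: measurable_funTS; exact: measurable_funX.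
  rewrite (_ : (fun r => m r ^- 2) = (fun r => (m r)^-1 ^+ 2)); last first.
    by apply/funext => r; rewrite exprVn.
  apply: measurable_funX; apply: measurable_funS mmV => //.
  by move=> r; rewrite /= !in_itv/= => /andP[/ltW-> /le_trans ->].
have ii : lam.-integrable `]0, t] (EFin \o (fun r => sigma r ^+ 2 * m r ^- 2)).
  apply: (bounded_itv_integrable (M := S ^+ 2 * expR (M * T) ^+ 2)) => //.
    exact: lebesgue_itv_lty.
  move=> r; rewrite in_itv/= => /andP[r0 rt]; rewrite normrM ler_pM//.
    by rewrite normrX lerXn2r ?nnegrE.
  rewrite normfV normrX -exprVn lerXn2r ?nnegrE ?invr_ge0 ?expR_ge0//.
  rewrite gtr0_norm ?m_gt0// -[_^-1]mul1r -(m0 beta).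
  by apply: (m_ratio_le mbeta bM); rewrite ?lexx ?(ltW T0)// (ltW r0) (le_trans rt tleT).
by rewrite RintegralZl// /vs2; congr (_ * _); rewrite Rintegral_itv_obnd_cbnd.
Qed.

Let mfN N : measurable_fun setT (fN N).
Proof.
apply: measurable_sum => j; apply: measurable_funM => //.
apply: measurable_funD; first by apply: measurable_funM => //; exact: measurable_indic.
apply: measurable_funM => //; apply: measurable_funM => //; exact: measurable_indic.
Qed.

Let VN_cvg : \int[lam]_(r in `]0, T]) (fN N r ^+ 2) @[N --> \oo] --> vs2 beta sigma t.
Proof.
rewrite -vs2E; apply: cvg_integral_sqr => //.
  by move=> N; apply: measurable_funTS; exact: mfN.
pose e N := (S * expR (M * T) * (2 * (M * h N))) ^+ 2 * T.
have ecvg : e N @[N --> \oo] --> 0.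
  have H : S * expR (M * T) * (2 * (M * h N)) @[N --> \oo] --> 0.
    rewrite -[X in _ --> X](mulr0 (S * expR (M * T) * 2 * M)).
    rewrite (_ : (fun N => _) = (fun N => (S * expR (M * T) * 2 * M) * h N)).
      by apply: cvgM => //; exact: cvg_cst.
    by apply/funext => N; ring.
  rewrite (_ : e = (fun N => (fun N => S * expR (M * T) * (2 * (M * h N))) N *
      (fun N => S * expR (M * T) * (2 * (M * h N))) N * T)).
    have -> : (0 : R) = 0 * 0 * T by rewrite mul0r mul0r.
    by apply: cvgM; [exact: cvgM|exact: cvg_cst].
  by apply/funext => N; rewrite /e expr2.
apply: (@squeeze_cvge _ _ _ _ (fun=> 0%E) _ (fun N => (e N)%:E)); last 2 first.
- exact: cvg_cst.
- by apply: cvg_EFin => //; exact: nearW.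
have hM : \forall N \near \oo, M * h N <= 1 / 2.
  have : M * h N @[N --> \oo] --> 0.
    by rewrite -[X in _ --> X](mulr0 M); apply: cvgM => //; exact: cvg_cst.
  move=> /cvgrPdist_lt /(_ (1 / 2)); rewrite divr_gt0// => /(_ isT); apply: filterS => N.
  by rewrite sub0r normrN => /ltW; apply: le_trans; exact: ler_norm.
apply: filterS hM => N Mh; rewrite integral_ge0/=; last by move=> r _; rewrite lee_fin sqr_ge0.
apply: (@le_trans _ _ (\int[lam]_(r in `]0%R, T]) ((S * expR (M * T) * (2 * (M * h N))) ^+ 2)%:E)%E).
  apply: ge0_le_integral => //.
  - by move=> r _; rewrite lee_fin sqr_ge0.
  - by apply/measurable_EFinP/measurable_funX/measurable_funB => //; apply: measurable_funTS; exact: mfN.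
  - move=> r rT; rewrite lee_fin -real_normK ?num_real// lerXn2r ?nnegrE//.
      by apply: mulr_ge0; [rewrite mulr_ge0 ?expR_ge0|rewrite mulr_ge0// mulr_ge0// ltW].
    exact: fN_near.
by rewrite integral_cst//= lebesgue_measure_itv/= lte_fin T0 -EFinB -EFinM lee_fin subr0.
Qed.

(** One sequence is given two limits. The noise [Z N] of the scheme is a Wiener integral, which
    yields the kernel with variance increased by [vs2]; along almost every path the scheme converges
    to [X t], which yields the left-hand side. *)
Lemma sde_kernel a y : 0 < a ->
  \int[P]_w (gauss a (y - X t w)) =
  \int[P]_w (gauss (a + vs2 beta sigma t) (y - m t *: X 0 w)).
Proof.
move=> a0; have [aX cX eX] := hX.
(* The choice has to be a total function of time; outside [0, T] its value is arbitrary. *)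
have /choice[Y HY] : forall s, exists Ys, s \in `[0, T] -> stoch_integral P W sigma s Ys /\
   {ae P, forall w, X s w = X 0 w
        - \row_i (\int[lebesgue_measure]_(r in `[0, s]) (beta r * X r w 0 i)) + Ys w}.
  move=> s; have [sT|sT] := boolP (s \in `[0, T]); last by exists (fun=> 0) => H; rewrite H in sT.
  by have [Ys h1 h2] := eX s sT; exists Ys.
pose Z N w := \sum_(0 <= j < N.+1) c N j *: (Y (tau N j.+1) w + (-1) *: Y (tau N j) w).
have tauT N j : (j <= N.+1)%N -> tau N j \in `[0, T].
  by move=> jN; rewrite in_itv/= tau_ge0 (le_trans (tau_in jN)).
have wY N j : (j <= N.+1)%N ->
    wiener_pair P T W (Y (tau N j)) (fun r => sigma r * \1_`]0, tau N j] r).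
  move=> jN; have jT := tauT N j jN; apply: stoch_integral_wiener; last exact: (HY _ jT).1.
  by move: jT; rewrite in_itv.
have WZ N : wiener_pair P T W (Z N) (fN N).
  apply: (wiener_pair_sum hF hW) => j jN.
  by apply: (wiener_pairDZ hF hW); apply: wY => //; exact: ltnW.
pose xi w := y - m t *: X 0 w.
have Fxi : Fmeas F 0 xi.
  by apply: measurable_rVB => //; apply: measurable_rVZ; exact: Fmeas_X0.
have mxi : measurable_fun setT xi by apply: (Fmeas_measurable hF _ Fxi); rewrite lexx ltW.
have mX : measurable_fun setT (X t) by apply: measurable_X; rewrite in_itv/= tleT ltW.
have mZ N : measurable_fun setT (Z N) by have [] := WZ N.
have v0 (g : R -> R) : 0 <= \int[lam]_(r in `]0%R, T]) (g r ^+ 2).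
  by apply: Rintegral_ge0 => r _; exact: sqr_ge0.
have c1 : \int[P]_w (gauss a (xi w - Z N w)) @[N --> \oo] -->
    \int[P]_w (gauss (a + vs2 beta sigma t) (xi w)).
  under eq_fun do rewrite (wiener_pair_gauss hF hW (ltW T0) (WZ _) a0 Fxi).
  by apply: cvg_gauss_var => //; rewrite -vs2E.
suff c2 : \int[P]_w (gauss a (xi w - Z N w)) @[N --> \oo] --> \int[P]_w (gauss a (y - X t w)).
  by rewrite -(cvg_lim _ c1)// -(cvg_lim _ c2).
(* The grids contain countably many times, so the exceptional sets of the identities at these times
   still form a null set. *)
have good : {ae P, forall w, {within `[0, T], continuous (fun s => X s w)} /\
    forall N j, (j <= N.+1)%N -> X (tau N j) w = X 0 w
        - \row_i (\int[lebesgue_measure]_(r in `[0, tau N j]) (beta r * X r w 0 i)) + Y (tau N j) w}.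
  apply: filterI; first exact: cX.
  apply: ae_foralln => N; apply: ae_foralln => j.
  have [jN|jN] := leqP j N.+1.
    by have [_] := HY _ (tauT N j jN); apply: filterS => w ->.
  by apply: aeW.
have i1 := integrable_gauss P a0 (measurable_rVB (measurable_cst y) mX).
rewrite /Rintegral; apply: fine_cvg.
rewrite fineK; last exact: (integrable_fin_num measurableT i1).
have DC := @dominated_convergence _ _ _ P _ measurableT
  (fun N w => (gauss a (xi w - Z N w))%:E) (fun w => (gauss a (y - X t w))%:E)
  (fun=> ((Num.sqrt (a * pi *+ 2))^-1 ^+ n)%:E).
case: DC; last by move=> _ _; exact.
- by move=> N; apply: measurable_EFin_gauss; exact: measurable_rVB.
- by apply: measurable_EFin_gauss; exact: measurable_rVB.
- apply: filterS good => w [cXw Xw] _.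
  apply: cvg_EFin; first exact: nearW.
  apply: (@cvg_comp _ _ _ (fun N => xi w - Z N w) (gauss a)); last exact: continuous_gauss.
  apply: cvg_rV => i.
  suff H : (xi w - Z N w) 0 i - (y - X t w) 0 i @[N --> \oo] --> 0 by apply/subr_cvg0.
  pose x s := X s w 0 i.
  have cx : {within `[0, T], continuous x}.
    by move=> z; exact: (@continuous_comp (subspace `[0, T]) _ _ (fun s => X s w) (fun v : 'rV[R]_n => v 0 i) z (cXw z) (@coord_continuous _ _ _ _ _ _)).
  have {}cx : {within `[0, t], continuous x}.
    by apply: continuous_subspaceW cx => s; rewrite /= !in_itv/= => /andP[-> /le_trans ->].
  have [K K0 xK] := within_bounded cx.
  apply/cvgrPdist_le => /= eps eps0.
  pose C := expR (M * T) * t; have C0 : 0 < C by rewrite mulr_gt0 ?expR_gt0.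
  (* In [euler_error], half of [eps] is granted to the oscillation term through [om] and half to the
     term in the mesh through the bound [N3]. *)
  pose om := eps / (2 * (C * M + 1)).
  have CM : 0 <= C * M by rewrite mulr_ge0// ltW.
  have om0 : 0 < om by rewrite divr_gt0//; lra.
  have [dlt dlt0 xdlt] := within_uniform_continuous (@segment_compact R 0 t) cx om0.
  have small b : 0 < b -> \forall N \near \oo, h N < b.
    move=> b0; have := h_cvg0 => /cvgrPdist_lt /(_ b b0); apply: filterS => N.
    by rewrite sub0r normrN; apply: le_lt_trans; exact: ler_norm.
  have b1 : 0 < 1 / 2 / (M + 1) by rewrite !divr_gt0// ltr_wpDl.
  have CKM : 0 <= C * (2 * K * M ^+ 2) by rewrite mulr_ge0 ?(ltW C0)// mulr_ge0 ?sqr_ge0// mulr_ge0.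
  have b2 : 0 < eps / (2 * (C * (2 * K * M ^+ 2) + 1)) by rewrite divr_gt0//; lra.
  near=> N.
  have N1 : h N < dlt by near: N; exact: small.
  have N2 : h N < 1 / 2 / (M + 1) by near: N; exact: small.
  have N3 : h N < eps / (2 * (C * (2 * K * M ^+ 2) + 1)) by near: N; exact: small.
  have Mh : M * h N <= 1 / 2.
    have M1 : 0 < M + 1 by rewrite ltr_wpDl.
    have : h N * (M + 1) <= 1 / 2 by rewrite -ler_pdivlMr// ltW.
    by have := h0 N; nra.
  have := @euler_error R beta M mbeta bM T t K om N.+1 x (fun j => Y (tau N j) w 0 i) tT isT cx.
  rewrite -/(h N) -/(tau N _) => /(_ xK) H.
  have {}H := H _ Mh _.
  rewrite sub0r normrN.
  have -> : (xi w - Z N w) 0 i - (y - X t w) 0 i =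
     - (m t * x 0 + \sum_(0 <= j < N.+1) m t / m (tau N j.+1) * (Y (tau N j.+1) w 0 i - Y (tau N j) w 0 i) - x t).
    rewrite !mxE summxE.
    have -> : \sum_(0 <= j < N.+1) (c N j *: (Y (tau N j.+1) w + -1 *: Y (tau N j) w)) 0 i =
      \sum_(0 <= j < N.+1) m t / m (tau N j.+1) * (Y (tau N j.+1) w 0 i - Y (tau N j) w 0 i).
      by apply: eq_bigr => j _; rewrite !mxE mulN1r.
    by rewrite /x; ring.
  rewrite normrN; apply: le_trans (H _ _) _.
  + move=> u v u0 v0' uv; apply/ltW/xdlt => //; exact: le_lt_trans uv N1.
  + by move=> j jN; have := Xw N j jN => /rowP /(_ i); rewrite !mxE.
  have e1 : h N * (2 * (C * (2 * K * M ^+ 2) + 1)) <= eps by rewrite -ler_pdivlMr ?ltW//; lra.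
  have e2 : om * (2 * (C * M + 1)) = eps by rewrite /om divfK// gt_eqF//; lra.
  have -> : expR (M * T) * (t * (2 * K * M ^+ 2 * h N + M * om)) =
     h N * (C * (2 * K * M ^+ 2)) + om * (C * M) by rewrite /C; ring.
  have := h0 N; move: (C * (2 * K * M ^+ 2)) CKM e1 => q q0 e1 hN0.
  nra.
- exact: finite_measure_integrable_cst.
- apply: aeW => w N _; rewrite gee0_abs ?lee_fin ?gauss_ge0//.
  exact: gauss_le_peak.
Unshelve. all: by end_near. Qed.

End sde_kernel.

(** * Differentiation of exponential tilts *)

Section continuous_ops.
Context (R : realType) (T : topologicalType).
Implicit Types f g : T -> R.

Lemma contD f g : continuous f -> continuous g -> continuous (fun x => f x + g x).
Proof. by move=> cf cg x; apply: cvgD; [exact: cf|exact: cg]. Qed.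

Lemma contB f g : continuous f -> continuous g -> continuous (fun x => f x - g x).
Proof. by move=> cf cg x; apply: cvgB; [exact: cf|exact: cg]. Qed.

Lemma contM f g : continuous f -> continuous g -> continuous (fun x => f x * g x).
Proof. by move=> cf cg x; apply: cvgM; [exact: cf|exact: cg]. Qed.

Lemma contN f : continuous f -> continuous (fun x => - f x).
Proof. by move=> cf x; apply: cvgN; exact: cf. Qed.

Lemma contV f : (forall x, f x != 0) -> continuous f -> continuous (fun x => (f x)^-1).
Proof. by move=> f0 cf x; apply: cvgV; [exact: f0|exact: cf]. Qed.

Lemma cont_cst (c : R) : continuous (fun _ : T => c).
Proof. by move=> x; exact: cvg_cst. Qed.

Lemma cont_norm f : continuous f -> continuous (fun x => `|f x|).
Proof. by move=> cf x; apply: cvg_norm; exact: cf. Qed.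

Lemma continuous_at_modulus f (N : T -> R) y (C r : R) : 0 < r -> 0 <= C ->
  (forall z, 0 <= N z) -> N z @[z --> y] --> 0 ->
  (forall z, N z <= r -> `|f z - f y| <= C * N z) -> {for y, continuous f}.
Proof.
move=> r0 C0 N0 cN H; apply/cvgrPdist_le => /= eps eps0.
have e0 : 0 < eps / (C + 1) by rewrite divr_gt0// ltr_wpDl.
move/cvgrPdist_lt : cN => cN; apply: filterS (filterI (cN _ r0) (cN _ e0)) => z /= [].
rewrite sub0r normrN ger0_norm// => /ltW z1 z2.
rewrite distrC; apply: le_trans (H z z1) _.
have : N z * (C + 1) <= eps by rewrite -ler_pdivlMr ?ltW// ltr_wpDl.
have := N0 z; nra.
Qed.

End continuous_ops.

Section directional_derivative.
Context (R : realType) (V : normedModType R).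
Implicit Types (f g : V -> R) (x v : V).

(** Restricting to a line makes a directional derivative a one-variable one, to which the chain rule
    applies. *)
Lemma is_derive_line f x v (l : R) :
  is_derive x v f l <-> is_derive (0 : R) 1 (fun r : R => f (r *: v + x)) l.
Proof.
have E : (fun h : R => h^-1 *: ((f \o shift x) (h *: v) - f x)) =
   (fun h : R => h^-1 *: (((fun r : R => f (r *: v + x)) \o shift 0) (h *: 1) - f (0 *: v + x))).
  apply/funext => h /=; rewrite scale0r add0r addr0.
  by congr (_ *: (f (_ *: _ + _) - _)); rewrite /GRing.scale/= mulr1.
by split=> -[H1 H2]; split; move: H1 H2; rewrite /derivable /derive ?E.
Qed.

Lemma is_derive_ln f x v (l : R) : 0 < f x -> is_derive x v f l ->
  is_derive x v (fun y => ln (f y)) (l / f x).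
Proof.
move=> fx0 /is_derive_line H; apply/is_derive_line.
have fx0' : 0 < f (0 *: v + x) by rewrite scale0r add0r.
have := is_derive1_comp (is_derive1_ln fx0') H.
by rewrite scale0r add0r mulrC.
Qed.

Lemma is_derive_div f g x v (l k : R) : g x != 0 -> is_derive x v f l -> is_derive x v g k ->
  is_derive x v (fun y => f y / g y) (l / g x - f x * k / g x ^+ 2).
Proof.
move=> gx0 df dg.
have dV : is_derive x v (fun y => (g y)^-1) (- g x ^- 2 *: k).
  split; first by apply: derivableV => //; exact: ex_derive.
  by rewrite deriveV// derive_val.
have -> : l / g x - f x * k / g x ^+ 2 = f x *: (- g x ^- 2 *: k) + (g x)^-1 *: l.
  by rewrite /GRing.scale/=; field.
exact: is_deriveM.
Qed.

(** Differentiation under the integral sign is obtained through this lemma from the uniform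
    quadratic remainder of [avg_tilt]. *)
Lemma is_derive_quadratic f x v (l C r0 : R) : 0 < r0 ->
  (forall r : R, `|r| <= r0 -> `|f (r *: v + x) - f x - r * l| <= C * r ^+ 2) ->
  is_derive x v f l.
Proof.
move=> r00 H; have cv : h^-1 *: ((f \o shift x) (h *: v) - f x) @[h --> (0:R)^'] --> l.
  apply/cvgrPdist_le => eps eps0 /=.
  have C1 : 0 < `|C| + 1 by rewrite ltr_pwDr.
  near=> h.
  have h0 : h != 0 by near: h; exact: nbhs_dnbhs_neq.
  have hr0 : `|h| <= r0.
    near: h; apply: dnbhs0_le; exact: r00.
  have he : `|h| <= eps / (`|C| + 1).
    near: h; apply: dnbhs0_le; exact: divr_gt0.
  have -> : l - h^-1 *: (f (h *: v + x) - f x) = - (h^-1 * (f (h *: v + x) - f x - h * l)).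
    by rewrite /GRing.scale/=; field.
  rewrite normrN normrM normfV ler_pdivrMl ?normr_gt0//.
  apply: le_trans (H _ hr0) _.
  rewrite -[h ^+ 2]real_normK ?num_real// expr2 mulrA mulrC ler_wpM2l//.
  have : `|h| * (`|C| + 1) <= eps by rewrite -ler_pdivlMr.
  have := ler_norm C; have := normr_ge0 h; nra.
split; first by apply/cvg_ex; exists l.
exact: cvg_lim cv.
Unshelve. all: by end_near. Qed.

End directional_derivative.

(** * Averages of functions bounded on a set *)

Section bounded_average.
Context (R : realType) d (Y : measurableType d) (mu : probability Y R) (D : set Y).
Hypothesis mD : measurable D.

(** These functions form an algebra closed under the exponential, and all are integrable on [D], so
    [avg] is linear on them without further integrability conditions. *)
Definition bmeas (g : Y -> R) := measurable_fun setT g /\ exists C, forall x, D x -> `|g x| <= C.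

Definition avg (g : Y -> R) : R := \int[mu]_(x in D) g x.

Lemma bmeas_integrable g : bmeas g -> mu.-integrable D (EFin \o g).
Proof.
move=> [mg [C HC]]; apply: measurable_bounded_integrable => //.
- by apply: le_lt_trans (probability_le1 _ mD) _; rewrite ltry.
- exact: measurable_funTS.
- by exists C; split; [exact: num_real|move=> K CK x /HC; move/le_trans; apply; exact: ltW].
Qed.

Lemma bmeas_cst c : bmeas (fun=> c).
Proof. by split; [exact: measurable_cst|exists `|c|]. Qed.

Lemma bmeasD g h : bmeas g -> bmeas h -> bmeas (fun x => g x + h x).
Proof.
move=> [mg [C HC]] [mh [K HK]]; split; first exact: measurable_funD.
by exists (C + K) => x Dx; apply: le_trans (ler_normD _ _) _; rewrite lerD ?HC ?HK.
Qed.

Lemma bmeasM g h : bmeas g -> bmeas h -> bmeas (fun x => g x * h x).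
Proof.
move=> [mg [C HC]] [mh [K HK]]; split; first exact: measurable_funM.
by exists (C * K) => x Dx; rewrite normrM ler_pM ?HC ?HK.
Qed.

Lemma bmeasZ c g : bmeas g -> bmeas (fun x => c * g x).
Proof. by move=> bg; apply: bmeasM => //; exact: bmeas_cst. Qed.

Lemma bmeasB g h : bmeas g -> bmeas h -> bmeas (fun x => g x - h x).
Proof.
move=> bg bh; have := bmeasD bg (bmeasZ (-1) bh).
by under eq_fun do rewrite mulN1r.
Qed.

Lemma bmeas_sum (I : Type) (r : seq I) (g : I -> Y -> R) :
  (forall i, bmeas (g i)) -> bmeas (fun x => \sum_(i <- r) g i x).
Proof.
move=> bg; elim: r => [|i r IH].
  by under eq_fun do rewrite big_nil; exact: bmeas_cst.
by under eq_fun do rewrite big_cons; exact: bmeasD.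
Qed.

Lemma bmeas_norm g : bmeas g -> bmeas (fun x => `|g x|).
Proof.
move=> [mg [C HC]]; split; first exact: measurableT_comp.
by exists C => x Dx; rewrite normr_id HC.
Qed.

Lemma bmeas_expR g : bmeas g -> bmeas (fun x => expR (g x)).
Proof.
move=> [mg [C HC]]; split; first exact: measurableT_comp.
exists (expR C) => x Dx; rewrite ger0_norm ?expR_ge0// ler_expR.
exact: le_trans (ler_norm _) (HC x Dx).
Qed.

Lemma avgD g h : bmeas g -> bmeas h -> avg (fun x => g x + h x) = avg g + avg h.
Proof. by move=> /bmeas_integrable ig /bmeas_integrable ih; exact: RintegralD. Qed.

Lemma avgB g h : bmeas g -> bmeas h -> avg (fun x => g x - h x) = avg g - avg h.
Proof. by move=> /bmeas_integrable ig /bmeas_integrable ih; exact: RintegralB. Qed.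

Lemma avgZ c g : bmeas g -> avg (fun x => c * g x) = c * avg g.
Proof. by move=> /bmeas_integrable ig; exact: RintegralZl. Qed.

Lemma avg_sum (I : Type) (r : seq I) (g : I -> Y -> R) : (forall i, bmeas (g i)) ->
  avg (fun x => \sum_(i <- r) g i x) = \sum_(i <- r) avg (g i).
Proof.
move=> bg; elim: r => [|i r IH].
  rewrite big_nil /avg; under eq_Rintegral do rewrite big_nil.
  by rewrite Rintegral_cst// mul0r.
rewrite big_cons -IH -avgD//; last exact: bmeas_sum.
by apply: eq_Rintegral => x _; rewrite big_cons.
Qed.

Lemma le_avg g h : bmeas g -> bmeas h -> (forall x, D x -> g x <= h x) -> avg g <= avg h.
Proof. by move=> /bmeas_integrable ig /bmeas_integrable ih; exact: le_Rintegral. Qed.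

Lemma le_norm_avg g h : bmeas g -> bmeas h -> (forall x, D x -> `|g x| <= h x) -> `|avg g| <= avg h.
Proof.
move=> bg bh gh; apply: le_trans (le_normr_Rintegral mD (bmeas_integrable bg)) _.
by apply: le_avg => //; exact: bmeas_norm.
Qed.

Lemma avg_gt0 g : (0 < mu D)%E -> bmeas g -> (exists2 c, 0 < c & forall x, D x -> c <= g x) -> 0 < avg g.
Proof.
move=> muD bg [c c0 cg]; apply: (@lt_le_trans _ _ (avg (fun=> c))).
  rewrite /avg Rintegral_cst// mulr_gt0// fine_gt0// muD.
  by apply: le_lt_trans (probability_le1 _ mD) _; rewrite ltry.
by apply: le_avg => //; exact: bmeas_cst.
Qed.

(* second-order Taylor bound of the exponential tilt, uniformly on D *)
Lemma avg_tilt g u c : bmeas g -> bmeas u -> bmeas c -> exists C, exists2 r0, 0 < r0 &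
  forall r, `|r| <= r0 ->
  `|avg (fun x => g x * expR (u x + r * c x)) - avg (fun x => g x * expR (u x)) -
    r * avg (fun x => c x * g x * expR (u x))| <= C * r ^+ 2.
Proof.
move=> bg bu bc.
have [_ [K HK]] := bc.
have K1 : 0 < `|K| + 1 by rewrite ltr_pwDr.
exists (avg (fun x => `|g x * expR (u x)| * (2 * c x ^+ 2))).
exists (1 / 2 / (`|K| + 1)); first by rewrite !divr_gt0.
move=> r rr; have beu := bmeas_expR bu.
have bruc : bmeas (fun x => u x + r * c x) by apply: bmeasD => //; exact: bmeasZ.
rewrite -avgZ; last by apply: bmeasM => //; exact: bmeasM.
rewrite -avgB; [|exact: bmeasM (bmeas_expR bruc)|exact: bmeasM].
rewrite -avgB; last 2 first.
- by apply: bmeasB; [exact: bmeasM (bmeas_expR bruc)|exact: bmeasM].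
- by apply: bmeasZ; apply: bmeasM => //; exact: bmeasM.
have bw : bmeas (fun x => `|g x * expR (u x)| * (2 * c x ^+ 2)).
  apply: bmeasM; first by apply: bmeas_norm; exact: bmeasM.
  by apply: bmeasZ; under eq_fun do rewrite expr2; exact: bmeasM.
rewrite mulrC -avgZ//; apply: le_norm_avg.
- apply: bmeasB; first by apply: bmeasB; [exact: bmeasM (bmeas_expR bruc)|exact: bmeasM].
  by apply: bmeasZ; apply: bmeasM => //; exact: bmeasM.
- exact: bmeasZ.
- move=> x Dx.
  have -> : g x * expR (u x + r * c x) - g x * expR (u x) - r * (c x * g x * expR (u x)) =
    g x * expR (u x) * (expR (r * c x) - 1 - r * c x) by rewrite expRD; ring.
  rewrite normrM [leRHS]mulrCA; apply: ler_wpM2l => //.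
  have -> : r ^+ 2 * (2 * c x ^+ 2) = 2 * (r * c x) ^+ 2 by ring.
  apply: norm_expRB1; rewrite normrM.
  apply: (@le_trans _ _ (1 / 2 / (`|K| + 1) * (`|K| + 1))); last by rewrite divfK// gt_eqF.
  apply: ler_pM => //; apply: le_trans (HK x Dx) _.
  by apply: le_trans (ler_norm _) _; rewrite lerDl.
Qed.

End bounded_average.

(** * Posterior moments and the Hessian of the log-density *)

Section dot_product.
Context (R : realType) (n : nat).
Implicit Types x y w z : 'rV[R]_n.

Definition dot x y : R := \sum_i x 0 i * y 0 i.

Lemma dotC x y : dot x y = dot y x.
Proof. by apply: eq_bigr => i _; rewrite mulrC. Qed.

Lemma dotDl x y z : dot (x + y) z = dot x z + dot y z.
Proof. by rewrite /dot -big_split/=; apply: eq_bigr => i _; rewrite mxE mulrDl. Qed.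

Lemma dotZl a x y : dot (a *: x) y = a * dot x y.
Proof. by rewrite /dot mulr_sumr; apply: eq_bigr => i _; rewrite mxE mulrA. Qed.

Lemma dotxx x : dot x x = enorm x ^+ 2.
Proof. by rewrite enorm_sqr; apply: eq_bigr => i _; rewrite expr2. Qed.

Lemma dot_delta i y : dot (delta_mx 0 i) y = y 0 i.
Proof.
rewrite /dot (bigD1 i)//= mxE !eqxx mul1r big1 ?addr0// => j ji.
by rewrite mxE eqxx (negbTE ji) mul0r.
Qed.

Lemma dot_mulmx x y : (x *m y^T) 0 0 = dot x y.
Proof. by rewrite mxE; apply: eq_bigr => i _; rewrite mxE. Qed.

Lemma enorm_shift a x y : enorm (a *: x + y) ^+ 2 =
  a ^+ 2 * enorm x ^+ 2 + 2 * a * dot x y + enorm y ^+ 2.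
Proof.
rewrite !enorm_sqr /dot !mulr_sumr -!big_split/=; apply: eq_bigr => i _.
by rewrite !mxE; ring.
Qed.

Lemma dot_sqr_le x y : dot x y ^+ 2 <= enorm x ^+ 2 * enorm y ^+ 2.
Proof.
have [y0|y0] := eqVneq (enorm y ^+ 2) 0.
  have -> : dot x y = 0.
    rewrite /dot big1// => i _; have := norm_coord_le_enorm y i.
    move/eqP: y0; rewrite sqrf_eq0 => /eqP->.
    by rewrite normr_le0 => /eqP->; rewrite mulr0.
  by rewrite expr0n mulr_ge0// sqr_ge0.
have y0' : 0 < enorm y ^+ 2 by rewrite lt_neqAle eq_sym y0 sqr_ge0.
have := sqr_ge0 (enorm (- (dot x y / enorm y ^+ 2) *: y + x)).
rewrite enorm_shift (dotC y x).
have -> : (- (dot x y / enorm y ^+ 2)) ^+ 2 * enorm y ^+ 2 +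
   2 * - (dot x y / enorm y ^+ 2) * dot x y + enorm x ^+ 2 =
   enorm x ^+ 2 - dot x y ^+ 2 / enorm y ^+ 2.
  by move: (enorm y ^+ 2) y0 => e e0; field.
by rewrite subr_ge0 ler_pdivrMr.
Qed.

Lemma dot_le x y : `|dot x y| <= enorm x * enorm y.
Proof.
rewrite -(@ler_pXn2r _ 2) ?nnegrE ?mulr_ge0 ?enorm_ge0// exprMn.
by rewrite real_normK ?num_real// dot_sqr_le.
Qed.

End dot_product.

Section posterior.
Context (R : realType) (n : nat) (mu : probability 'rV[R]_n R) (rad m v : R).
Local Notation D := (eball rad : set 'rV[R]_n).
Hypotheses (muD : mu D = 1%E) (v0 : 0 < v).
Implicit Types (q : 'rV[R]_n -> R) (y x w : 'rV[R]_n).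

Local Notation bm := (bmeas D).
Local Notation mD := (measurable_eball rad).

(** Integration is restricted to the ball, which has full mass, because moments and exponential
    tilts are bounded there; [EFin_dens] returns to the whole space. *)
Definition dens y : R := \int[mu]_(x in D) gauss v (y - m *: x).

Let s := m / v.
Let wt x : R := expR (- (m ^+ 2 * enorm x ^+ 2) / (v *+ 2)).

Definition lap q y : R := avg mu D (fun x => q x * wt x * expR (s * dot y x)).

(* expectation of q under the conditional law of X_0 given X_t = y *)
Definition post q y : R := lap q y / lap (fun=> 1) y.

Let coord i x : R := x 0 i.

Lemma rad_ge0 : 0 <= rad.
Proof.
rewrite leNgt; apply/negP => r0; suff D0 : D = set0.
  by have := muD; rewrite D0 measure0 => /esym/eqP; rewrite onee_eq0.
apply/seteqP; split => // x xr; have := le_trans (enorm_ge0 x) xr.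
by rewrite leNgt r0.
Qed.

Lemma avg_cst c : avg mu D (fun=> c) = c.
Proof.
rewrite /avg Rintegral_cst; last exact: mD.
transitivity (c * fine 1%E); last by rewrite mulr1.
congr (c * fine _); exact: muD.
Qed.

Lemma bm_coord i : bm (coord i).
Proof.
split; first exact: measurable_coord.
by exists rad => x Dx; apply: le_trans (norm_coord_le_enorm x i) Dx.
Qed.

Lemma bm_dot y : bm (dot y).
Proof. by apply: bmeas_sum => i; apply: bmeasZ; exact: bm_coord. Qed.

Lemma bm_enorm : bm (@enorm R n).
Proof.
split; first exact: measurable_enorm.
by exists rad => x Dx; rewrite ger0_norm ?enorm_ge0.
Qed.

Lemma bm_wt : bm wt.
Proof.
apply: bmeas_expR; under eq_fun do rewrite mulNr -mulrN mulrC.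
apply: bmeasZ; apply: bmeasZ; under eq_fun do rewrite expr2.
by apply: bmeasM; exact: bm_enorm.
Qed.

Lemma bm_lap q y : bm q -> bm (fun x => q x * wt x * expR (s * dot y x)).
Proof.
move=> bq; apply: bmeasM; first by apply: bmeasM => //; exact: bm_wt.
by apply: bmeas_expR; apply: bmeasZ; exact: bm_dot.
Qed.

Lemma lapD q1 q2 y : bm q1 -> bm q2 -> lap (fun x => q1 x + q2 x) y = lap q1 y + lap q2 y.
Proof.
move=> b1 b2; rewrite -avgD; [|exact: mD|exact: bm_lap|exact: bm_lap].
by apply: eq_Rintegral => x _; ring.
Qed.

Lemma lapZ c q y : bm q -> lap (fun x => c * q x) y = c * lap q y.
Proof.
move=> bq; rewrite -avgZ; [|exact: mD|exact: bm_lap].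
by apply: eq_Rintegral => x _; ring.
Qed.

Lemma lap_sum (q : 'I_n -> 'rV[R]_n -> R) y : (forall i, bm (q i)) ->
  lap (fun x => \sum_i q i x) y = \sum_i lap (q i) y.
Proof.
move=> bq; rewrite -avg_sum; [|exact: mD|by move=> i; exact: bm_lap].
by apply: eq_Rintegral => x _; rewrite !mulr_suml.
Qed.

Lemma lap_le q1 q2 y : bm q1 -> bm q2 -> (forall x, D x -> q1 x <= q2 x) -> lap q1 y <= lap q2 y.
Proof.
move=> b1 b2 q12; apply: le_avg; [exact: mD|exact: bm_lap|exact: bm_lap|].
by move=> x Dx; rewrite ler_wpM2r ?expR_ge0// ler_wpM2r ?expR_ge0// q12.
Qed.

Lemma lap1_gt0 y : 0 < lap (fun=> 1) y.
Proof.
apply: avg_gt0; [exact: mD|by rewrite muD lte01|by apply: bm_lap; exact: bmeas_cst|].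
have b : bm (fun x => - (m ^+ 2 * enorm x ^+ 2) / (v *+ 2) + s * dot y x).
  apply: bmeasD; last by apply: bmeasZ; exact: bm_dot.
  under eq_fun do rewrite mulNr -mulrN mulrC.
  apply: bmeasZ; apply: bmeasZ; under eq_fun do rewrite expr2.
  by apply: bmeasM; exact: bm_enorm.
have [_ [C HC]] := b; exists (expR (- C)); first exact: expR_gt0.
move=> x Dx; rewrite mul1r -expRD ler_expR lerNl.
by apply: le_trans (HC x Dx); rewrite -normrN ler_norm.
Qed.

Lemma is_derive_lap q y i : bm q ->
  is_derive y (delta_mx 0 i) (lap q) (s * lap (fun x => x 0 i * q x) y).
Proof.
move=> bq; have [C [r0 r00 H]] := avg_tilt mu mD (bmeasM bq bm_wt)
  (bmeasZ s (bm_dot y)) (bmeasZ s (bm_coord i)).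
apply: (@is_derive_quadratic _ _ _ _ _ _ C r0) => // r /H {H}.
have -> : avg mu D (fun x => q x * wt x * expR (s * dot y x + r * (s * coord i x))) =
    lap q (r *: delta_mx 0 i + y).
  apply: eq_Rintegral => x _; congr (_ * expR _).
  by rewrite dotDl dotZl dot_delta /coord; ring.
have -> : avg mu D (fun x => s * coord i x * (q x * wt x) * expR (s * dot y x)) =
    s * lap (fun x => x 0 i * q x) y.
  rewrite -(avgZ mu mD s); last by apply: bm_lap; apply: bmeasM => //; exact: bm_coord.
  by apply: eq_Rintegral => x _; rewrite /coord; ring.
by [].
Qed.

(** Uniformly over the ball, the exponent changes by at most [k * N1 z], and |e^a - 1| <= 2 |a| when
    |a| <= 1/2. *)
Lemma continuous_lap q : bm q -> continuous (lap q).
Proof.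
move=> bq y; have [_ [Q HQ]] := bmeas_norm (bm_lap y bq).
pose N1 (z : 'rV[R]_n) : R := \sum_i `|z 0 i - y 0 i|.
have cN : continuous N1.
  apply: continuous_sum => i; apply: cont_norm.
  by apply: contB; [exact: coord_continuous|exact: cont_cst].
have cN1 : N1 z @[z --> y] --> 0.
  by have := cN y; rewrite /continuous_at {2}/N1 big1// => i _; rewrite subrr normr0.
have r0 := rad_ge0.
pose k := `|s| * rad; have k0 : 0 <= k by rewrite mulr_ge0.
have E (z x : 'rV[R]_n) : D x -> `|s * dot z x - s * dot y x| <= k * N1 z.
  move=> Dx; rewrite -mulrBr normrM /k -mulrA ler_wpM2l// /dot -sumrB mulr_sumr.
  apply: le_trans (ler_norm_sum _ _ _) _; apply: ler_sum => i _.
  rewrite -mulrBl normrM mulrC ler_wpM2r//.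
  exact: le_trans (norm_coord_le_enorm x i) Dx.
have N10 (z : 'rV[R]_n) : 0 <= N1 z by apply: sumr_ge0.
have c1 : 0 < 1 / 2 / (k + 1) by rewrite !divr_gt0// ltr_wpDl.
apply: (@continuous_at_modulus _ _ _ N1 _ (`|Q| * (2 * k)) _ c1) => //.
  by rewrite mulr_ge0// mulr_ge0.
move=> z z1; have kN : k * N1 z <= 1 / 2.
  have : N1 z * (k + 1) <= 1 / 2 by rewrite -ler_pdivlMr// ltr_wpDl.
  have := N10 z; nra.
rewrite /lap -avgB; [|exact: mD|exact: bm_lap|exact: bm_lap].
apply: (@le_trans _ _ (avg mu D (fun=> `|Q| * (2 * (k * N1 z))))).
  apply: le_norm_avg; [exact: mD|by apply: bmeasB; exact: bm_lap|exact: bmeas_cst|].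
  move=> x Dx.
  have -> : q x * wt x * expR (s * dot z x) - q x * wt x * expR (s * dot y x) =
     q x * wt x * expR (s * dot y x) * (expR (s * dot z x - s * dot y x) - 1).
    have -> : expR (s * dot z x) = expR (s * dot y x) * expR (s * dot z x - s * dot y x).
      by rewrite -expRD addrC subrK.
    by ring.
  have e1 := le_trans (E z x Dx) kN.
  have e2 := norm_expRB1 e1.
  rewrite normrM; apply: ler_pM => //.
    by have := HQ x Dx; rewrite normr_id => /le_trans; apply; exact: ler_norm.
  set a := s * dot z x - s * dot y x in e1 e2 *.
  have -> : expR a - 1 = (expR a - 1 - a) + a by ring.
  apply: le_trans (ler_normD _ _) _.
  have a2 : a ^+ 2 = `|a| * `|a| by rewrite -expr2 real_normK ?num_real.
  have h : `|a| * `|a| <= `|a| * (1 / 2) by rewrite ler_wpM2l.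
  have := E z x Dx; rewrite -/a; rewrite a2 in e2; lra.
by rewrite avg_cst !mulrA.
Qed.

(** By the quotient rule: the tilt brings down the coordinate in the numerator, the normalisation
    subtracts the product of means, and what remains is [s] times the conditional covariance of [q]
    and the coordinate. *)
Lemma is_derive_post q y i : bm q ->
  is_derive y (delta_mx 0 i) (post q)
    (s * (post (fun x => x 0 i * q x) y - post q y * post (coord i) y)).
Proof.
move=> bq; have := is_derive_div (lt0r_neq0 (lap1_gt0 y)) (is_derive_lap y i bq)
  (is_derive_lap y i (bmeas_cst _ 1)).
have -> : lap (fun x => x 0 i * 1) y = lap (coord i) y.
  by congr lap; apply/funext => x; rewrite mulr1.
congr is_derive; rewrite /post.
by field; exact/lt0r_neq0/lap1_gt0.
Qed.

Lemma continuous_post q : bm q -> continuous (post q).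
Proof.
move=> bq; apply: contM; first exact: continuous_lap.
apply: contV => [y|]; first exact/lt0r_neq0/lap1_gt0.
by apply: continuous_lap; exact: bmeas_cst.
Qed.

Lemma densE y : dens y =
  (Num.sqrt (v * pi *+ 2))^-1 ^+ n * expR (- enorm y ^+ 2 / (v *+ 2)) * lap (fun=> 1) y.
Proof.
rewrite -avgZ; [|exact: mD|by apply: bm_lap; exact: bmeas_cst].
apply: eq_Rintegral => x _; rewrite gaussE mul1r -mulrA -!expRD; congr (_ * expR _).
have -> : y - m *: x = (- m) *: x + y by rewrite scaleNr addrC.
rewrite enorm_shift (dotC x y) /s.
by field; rewrite gt_eqF.
Qed.

Lemma dens_gt0 y : 0 < dens y.
Proof.
rewrite densE mulr_gt0 ?lap1_gt0// mulr_gt0 ?expR_gt0// exprn_gt0//.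
by rewrite invr_gt0 sqrtr_gt0 pmulrn_lgt0// mulr_gt0// pi_gt0.
Qed.

Lemma ln_densE y : ln (dens y) = ln ((Num.sqrt (v * pi *+ 2))^-1 ^+ n) -
  (v *+ 2)^-1 * enorm y ^+ 2 + ln (lap (fun=> 1) y).
Proof.
have c0 : 0 < (Num.sqrt (v * pi *+ 2))^-1 ^+ n.
  by rewrite exprn_gt0// invr_gt0 sqrtr_gt0 pmulrn_lgt0// mulr_gt0// pi_gt0.
rewrite densE lnM ?posrE ?lap1_gt0 ?mulr_gt0 ?expR_gt0//.
rewrite lnM ?posrE ?expR_gt0// expRK; congr (_ + _ + _).
by rewrite mulNr [in RHS]mulrC.
Qed.

Definition score i y : R := - (y 0 i / v) + s * post (coord i) y.

Definition score_jac i j y : R := - ((i == j)%:R / v) +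
  s ^+ 2 * (post (fun x => x 0 j * x 0 i) y - post (coord i) y * post (coord j) y).

Lemma is_derive_ln_dens y i :
  is_derive y (delta_mx 0 i) (fun z => ln (dens z)) (score i y).
Proof.
have d1 : is_derive y (delta_mx 0 i) (fun z => - (v *+ 2)^-1 * enorm z ^+ 2) (- (y 0 i / v)).
  apply: (@is_derive_quadratic _ _ _ _ _ _ (v *+ 2)^-1 1) => // r _.
  rewrite enorm_shift dot_delta.
  have -> : enorm (delta_mx 0 i : 'rV[R]_n) ^+ 2 = 1 by rewrite -dotxx dot_delta mxE !eqxx.
  have -> : - (v *+ 2)^-1 * (r ^+ 2 * 1 + 2 * r * y 0 i + enorm y ^+ 2) -
    - (v *+ 2)^-1 * enorm y ^+ 2 - r * - (y 0 i / v) = - ((v *+ 2)^-1 * r ^+ 2).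
    by field; rewrite gt_eqF.
  by rewrite normrN ger0_norm// mulr_ge0 ?sqr_ge0// invr_ge0 mulrn_wge0// ltW.
have d2 := is_derive_ln (lap1_gt0 y) (is_derive_lap y i (bmeas_cst _ 1)).
have d3 := is_deriveD (is_deriveD (is_derive_cst (ln ((Num.sqrt (v * pi *+ 2))^-1 ^+ n)) y (delta_mx 0 i)) d1) d2.
have -> : (fun z => ln (dens z)) = (cst (ln ((Num.sqrt (v * pi *+ 2))^-1 ^+ n)) \+
   (fun z => - (v *+ 2)^-1 * enorm z ^+ 2)) \+ (fun z => ln (lap (fun=> 1) z)).
  by apply/funext => z /=; rewrite ln_densE mulNr.
have -> : score i y = 0 + - (y 0 i / v) + s * lap (fun x => x 0 i * 1) y / lap (fun=> 1) y.
  rewrite /score /post add0r mulrA; congr (_ + s * lap _ y / _).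
  by apply/funext => x; rewrite mulr1.
exact: d3.
Qed.

Lemma is_derive_score y i j : is_derive y (delta_mx 0 j) (score i) (score_jac i j y).
Proof.
have d1 : is_derive y (delta_mx 0 j) (fun z : 'rV[R]_n => - (z 0 i / v)) (- ((i == j)%:R / v)).
  apply: (@is_derive_quadratic _ _ _ _ _ _ 0 1) => // r _.
  by rewrite !mxE eqxx/= mul0r normr_le0; apply/eqP; field; rewrite gt_eqF.
have d2 := is_deriveZ s (is_derive_post y j (bm_coord i)).
have := is_deriveD d1 d2.
congr is_derive; rewrite /score_jac /GRing.scale/=; ring.
Qed.

Lemma continuous_score i : continuous (score i).
Proof.
apply: contD.
  by apply: contN; apply: contM; [exact: coord_continuous|exact: cont_cst].
by apply: contM; [exact: cont_cst|apply: continuous_post; exact: bm_coord].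
Qed.

Lemma continuous_score_jac i j : continuous (score_jac i j).
Proof.
apply: contD; first exact: cont_cst.
apply: contM; first exact: cont_cst.
apply: contB; first by apply: continuous_post; apply: bmeasM; exact: bm_coord.
by apply: contM; apply: continuous_post; exact: bm_coord.
Qed.

Lemma continuous_ln_dens : continuous (fun z => ln (dens z)).
Proof.
rewrite (_ : (fun z => _) = (fun z => ln ((Num.sqrt (v * pi *+ 2))^-1 ^+ n) -
  (v *+ 2)^-1 * enorm z ^+ 2 + ln (lap (fun=> 1) z))); last first.
  by apply/funext => z; rewrite ln_densE.
apply: contD.
  apply: contB; first exact: cont_cst.
  apply: contM; first exact: cont_cst.
  by under eq_fun do rewrite expr2; apply: contM; exact: continuous_enorm.
move=> y; apply: (@continuous_comp _ _ _ (lap (fun=> 1)) (@ln R)).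
  by apply: continuous_lap; exact: bmeas_cst.
exact/continuous_ln/lap1_gt0.
Qed.

Lemma partial_ln_dens i : partial i (fun z => ln (dens z)) = score i.
Proof. by apply/funext => y; have [_] := is_derive_ln_dens y i. Qed.

Lemma partial_score i j : partial j (score i) = score_jac i j.
Proof. by apply/funext => y; have [_] := is_derive_score y i j. Qed.

Lemma Ck2_ln_dens : Ck 2 (fun z => ln (dens z)).
Proof.
split; first exact: continuous_ln_dens.
move=> i; split; first by move=> y; have [] := is_derive_ln_dens y i.
rewrite partial_ln_dens; split; first exact: continuous_score.
move=> j; split; first by move=> y; have [] := is_derive_score y i j.
by rewrite partial_score; exact: continuous_score_jac.
Qed.

Lemma hessian_ln_dens y : hessian (fun z => ln (dens z)) y = \matrix_(i, j) score_jac i j y.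
Proof. by apply/matrixP => i j; rewrite !mxE partial_ln_dens partial_score. Qed.

Lemma gradient_ln_dens y : gradient (fun z => ln (dens z)) y = \row_i score i y.
Proof. by apply/rowP => i; rewrite !mxE partial_ln_dens. Qed.

End posterior.

(** * Bounds on the conditional moments and on the derivatives of the log-density *)

Section posterior_bounds.
Context (R : realType) (n : nat) (mu : probability 'rV[R]_n R) (rad m v : R).
Local Notation D := (eball rad : set 'rV[R]_n).
Hypotheses (muD : mu D = 1%E) (v0 : 0 < v).
Implicit Types (q : 'rV[R]_n -> R) (y x w z : 'rV[R]_n).
Local Notation bm := (bmeas D).
Local Notation pst := (post mu rad m v).
Local Notation dns := (dens mu rad m v).
Local Notation H := (hessian (fun z => ln (dns z))).
Let s := m / v.
Local Notation dotr w := (fun x => dot x w).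

Lemma post_lin (a : 'I_n -> R) (q : 'I_n -> 'rV[R]_n -> R) y : (forall i, bm (q i)) ->
  pst (fun x => \sum_i a i * q i x) y = \sum_i a i * pst (q i) y.
Proof.
move=> bq; rewrite /post lap_sum//; last by move=> i; exact: bmeasZ.
by rewrite mulr_suml; apply: eq_bigr => i _; rewrite lapZ// mulrA.
Qed.

Lemma post1 y : pst (fun=> 1) y = 1.
Proof. by rewrite /post divff//; exact/lt0r_neq0/lap1_gt0. Qed.

Lemma post_le q1 q2 y : bm q1 -> bm q2 -> (forall x, D x -> q1 x <= q2 x) ->
  pst q1 y <= pst q2 y.
Proof.
move=> b1 b2 q12; rewrite /post ler_wpM2r//; last exact: lap_le.
by rewrite invr_ge0 ltW//; exact: lap1_gt0.
Qed.

Lemma postZ c q y : bm q -> pst (fun x => c * q x) y = c * pst q y.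
Proof. by move=> bq; rewrite /post lapZ// mulrA. Qed.

Lemma postD q1 q2 y : bm q1 -> bm q2 -> pst (fun x => q1 x + q2 x) y = pst q1 y + pst q2 y.
Proof. by move=> b1 b2; rewrite /post lapD// mulrDl. Qed.

Lemma bm_dotr w : bm (dotr w).
Proof.
by rewrite (_ : dotr w = dot w); [exact: bm_dot|apply/funext => x; rewrite dotC].
Qed.

Definition cov w z y := pst (fun x => dot x w * dot x z) y -
  pst (dotr w) y * pst (dotr z) y.

Lemma post_dot w y : pst (dotr w) y = \sum_i w 0 i * pst (fun x => x 0 i) y.
Proof.
rewrite -(post_lin (fun i => w 0 i) y); last exact: bm_coord.
by congr pst; apply/funext => x; rewrite /dot; apply: eq_bigr => i _; rewrite mulrC.
Qed.

(** The bounds on the Hessian are read off from this bilinear form, with w = z for the Loewner bound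
    and the trace, and two different vectors for the operator norm. *)
Lemma hessian_form w z y :
  (w *m H y *m z^T) 0 0 = - (dot w z / v) + s ^+ 2 * cov w z y.
Proof.
have -> : cov w z y = \sum_j z 0 j * \sum_i w 0 i * (pst (fun x => x 0 j * x 0 i) y -
   pst (fun x => x 0 i) y * pst (fun x => x 0 j) y).
  rewrite /cov (post_dot z) mulr_sumr.
  have -> : pst (fun x => dot x w * dot x z) y =
     \sum_j z 0 j * \sum_i w 0 i * pst (fun x => x 0 j * x 0 i) y.
    under eq_bigr => j _.
      rewrite -(post_lin (fun i => w 0 i) y); last by move=> i; apply: bmeasM; exact: bm_coord.
      over.
    rewrite -(post_lin (fun j => z 0 j) y); last first.
      by move=> j; apply: bmeas_sum => i; apply: bmeasZ; apply: bmeasM; exact: bm_coord.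
    congr pst; apply/funext => x; rewrite [dot x z]/dot mulr_sumr; apply: eq_bigr => j _.
    rewrite [dot x w]/dot mulr_suml mulr_sumr; apply: eq_bigr => i _; ring.
  rewrite -sumrB; apply: eq_bigr => j _; rewrite mulrCA -mulrBr; congr (_ * _).
  rewrite post_dot mulr_suml -sumrB; apply: eq_bigr => i _; ring.
rewrite mxE mulr_sumr.
have -> : - (dot w z / v) = \sum_j - (w 0 j * z 0 j / v).
  by rewrite sumrN /dot mulr_suml.
rewrite -big_split/=; apply: eq_bigr => j _; rewrite hessian_ln_dens// !mxE.
have -> : \sum_k w 0 k * (\matrix_(i, j) score_jac mu rad m v i j y) k j =
   - (w 0 j / v) + s ^+ 2 * \sum_i w 0 i * (pst (fun x => x 0 j * x 0 i) y -
   pst (fun x => x 0 i) y * pst (fun x => x 0 j) y).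
  have -> : - (w 0 j / v) = \sum_k w 0 k * - ((k == j)%:R / v).
    rewrite (bigD1 j)//= big1 ?addr0; first by rewrite eqxx mul1r mulrN.
    by move=> k kj; rewrite (negbTE kj) mul0r oppr0 mulr0.
  rewrite mulr_sumr -big_split/=; apply: eq_bigr => k _; rewrite mxE /score_jac.
  by rewrite /s; ring.
ring.
Qed.

Lemma cov_ge0 w y : 0 <= cov w w y.
Proof.
set c := pst (dotr w) y.
have -> : cov w w y = pst (fun x => (dot x w - c) ^+ 2) y.
  have -> : (fun x => (dot x w - c) ^+ 2) =
      (fun x => dot x w * dot x w + (- (2 * c) * dot x w + c ^+ 2 * 1)).
    by apply/funext => x; ring.
  have b1 := bmeas_cst D (1 : R); have bw := bm_dotr w.
  rewrite !postD ?postZ//; [|exact: bmeasZ|exact: bmeasZ|exact: bmeasM|].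
    by rewrite post1 /cov -/c; ring.
  by apply: bmeasD; exact: bmeasZ.
rewrite -[leLHS](_ : pst (fun=> 0) y = 0); last first.
  rewrite (_ : (fun=> 0) = (fun x => 0 * 1)); last by apply/funext => x; rewrite mul0r.
  by rewrite postZ ?mul0r//; exact: bmeas_cst.
apply: post_le; first exact: bmeas_cst.
  by under eq_fun do rewrite expr2; apply: bmeasM; apply: bmeasB; (exact: bm_dotr || exact: bmeas_cst).
by move=> x _; exact: sqr_ge0.
Qed.

Lemma post_const c y : pst (fun=> c) y = c.
Proof.
rewrite (_ : (fun=> c) = (fun x => c * 1)); last by apply/funext => x; rewrite mulr1.
by rewrite postZ ?post1 ?mulr1//; exact: bmeas_cst.
Qed.

(** A variance is at most the second moment, which Cauchy-Schwarz bounds on the ball. *)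
Lemma cov_le w y : cov w w y <= rad ^+ 2 * enorm w ^+ 2.
Proof.
rewrite /cov -[leRHS](post_const _ y) lerBlDr.
apply: (@le_trans _ _ (pst (fun=> rad ^+ 2 * enorm w ^+ 2) y)); last first.
  by rewrite lerDl -expr2 sqr_ge0.
apply: post_le; [by apply: bmeasM; exact: bm_dotr|exact: bmeas_cst|].
move=> x Dx; rewrite -expr2; apply: le_trans (dot_sqr_le _ _) _.
by rewrite ler_wpM2r ?sqr_ge0// lerXn2r ?nnegrE ?enorm_ge0// (rad_ge0 muD).
Qed.

(** With [cov_ge0] on the left, this bounds a mixed covariance by the mean of two variances. *)
Lemma covB w u y : cov (w - u) (w - u) y = cov w w y - 2 * cov w u y + cov u u y.
Proof.
have b1 a b : bm (fun x => dot x a * dot x b) by apply: bmeasM; exact: bm_dotr.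
have dB x : dot x (w - u) = dot x w + (- 1) * dot x u.
  by rewrite dotC dotDl -scaleN1r dotZl !(dotC _ x).
rewrite /cov.
have -> : dotr (w - u) = (fun x => dot x w + (- 1) * dot x u).
  by apply/funext => x; exact: dB.
rewrite (_ : (fun x => dot x (w - u) * dot x (w - u)) =
   (fun x => dot x w * dot x w + (- 2 * (dot x w * dot x u) + dot x u * dot x u))); last first.
  by apply/funext => x; rewrite dB; ring.
have b2 : bm (fun x => - 2 * (dot x w * dot x u)) by exact: bmeasZ.
have b3 : bm (fun x => (- 1) * dot x u) by apply: bmeasZ; exact: bm_dotr.
have b4 := bm_dotr w; have b5 := bm_dotr u.
rewrite !postD ?postZ//; last exact: bmeasD.
ring.
Qed.

Lemma hessian_sym y : (H y)^T = H y.
Proof.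
apply/matrixP => i j; rewrite mxE hessian_ln_dens// !mxE /score_jac eq_sym.
congr (- _ + _ * (_ - _)); last by rewrite mulrC.
by congr pst; apply/funext => x; rewrite mulrC.
Qed.

Lemma hessian_lower y : loewner_le (- v^-1)%:M (H y).
Proof.
split; first by rewrite linearB/= tr_scalar_mx hessian_sym.
move=> w; rewrite mulmxBr mulmxBl mxE.
have -> : (- (w *m (- v^-1)%:M *m w^T)) 0 0 = dot w w / v.
  by rewrite mul_mx_scalar -scalemxAl !mxE -dot_mulmx mxE; ring.
by rewrite hessian_form addrAC addNr add0r mulr_ge0 ?sqr_ge0// cov_ge0.
Qed.

(** The image z of [w] is tested against u = z / |z|, which makes its norm a value of
    [hessian_form]; there 2 cov(w, u) <= cov(w, w) + cov(u, u) <= 2 rad^2. *)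
Lemma hessian_mul_le w y : enorm w <= 1 -> enorm (w *m H y) <= v^-1 + m ^+ 2 * rad ^+ 2 / v ^+ 2.
Proof.
set B := v^-1 + _.
have r0 := rad_ge0 muD.
have B0 : 0 <= B.
  apply: addr_ge0; first by rewrite invr_ge0 ltW.
  by apply: divr_ge0; [apply: mulr_ge0; exact: sqr_ge0|exact: sqr_ge0].
move=> w1; set z := w *m H y.
have [z0|z0] := eqVneq (enorm z) 0; first by rewrite z0.
have zp : 0 < enorm z by rewrite lt_neqAle eq_sym z0 enorm_ge0.
set u := (enorm z)^-1 *: z.
have u1 : enorm u ^+ 2 = 1 by rewrite enormZ_sqr exprVn mulVf// sqrf_eq0.
have u1' : enorm u = 1.
  by apply/eqP; rewrite -(@eqrXn2 _ 2) ?enorm_ge0// u1 expr1n.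
have w2 : enorm w ^+ 2 <= 1.
  by rewrite -[1](expr1n _ 2) lerXn2r ?nnegrE ?enorm_ge0.
have zE : enorm z = (w *m H y *m u^T) 0 0.
  by rewrite -/z dot_mulmx dotC dotZl dotxx expr2 mulKf.
rewrite zE hessian_form.
have h1 : - (dot w u / v) <= v^-1.
  rewrite -mulNr ler_piMl ?invr_ge0 ?(ltW v0)//.
  apply: le_trans (ler_norm _) _; rewrite normrN; apply: le_trans (dot_le _ _) _.
  by rewrite u1' mulr1.
have h2 : cov w u y <= rad ^+ 2.
  have c1 : cov (w - u) (w - u) y = cov w w y - 2 * cov w u y + cov u u y.
    exact: covB.
  have := cov_ge0 (w - u) y; rewrite c1 => h.
  have hw : cov w w y <= rad ^+ 2.
    by apply: le_trans (cov_le w y) _; rewrite ler_piMr ?sqr_ge0.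
  have hu : cov u u y <= rad ^+ 2 by have := cov_le u y; rewrite u1 mulr1.
  lra.
rewrite /B lerD// /s expr_div_n mulrAC ler_wpM2r ?invr_ge0 ?sqr_ge0//.
by rewrite ler_wpM2l// sqr_ge0.
Qed.

Lemma hessian_opnorm y : opnorm (H y) <= v^-1 + m ^+ 2 * rad ^+ 2 / v ^+ 2.
Proof.
apply: ge_sup.
  exists (enorm (0 *m H y)); exists 0 => //; rewrite /eball/= /enorm big1 ?sqrtr0 ?ler01//.
  by move=> i _; rewrite mxE expr0n.
move=> _ [w w1 <-]; exact: hessian_mul_le.
Qed.

Lemma score_jac_bound i j y :
  `|score_jac mu rad m v i j y| <= v^-1 + m ^+ 2 * rad ^+ 2 / v ^+ 2.
Proof.
have d1 : enorm (delta_mx 0 i : 'rV[R]_n) <= 1.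
  rewrite -(@ler_pXn2r _ 2) ?nnegrE ?enorm_ge0// expr1n -dotxx dot_delta mxE !eqxx.
  exact: lexx.
apply: le_trans (hessian_mul_le y d1); apply: le_trans (norm_coord_le_enorm _ j).
by rewrite -rowE mxE hessian_ln_dens// mxE.
Qed.

Lemma laplacianE y : laplacian (fun z => ln (dns z)) y =
  - (n%:R / v) + s ^+ 2 * \sum_i cov (delta_mx 0 i) (delta_mx 0 i) y.
Proof.
rewrite /laplacian /mxtrace mulr_sumr.
have -> : - (n%:R / v) = \sum_(i < n) - v^-1.
  by rewrite sumr_const card_ord -mulr_natl; ring.
rewrite -big_split/=; apply: eq_bigr => i _.
have := hessian_form (delta_mx 0 i) (delta_mx 0 i) y.
have -> : dot (delta_mx 0 i) (delta_mx 0 i) = 1 :> R by rewrite dot_delta mxE !eqxx.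
by rewrite mul1r => <-; rewrite dot_mulmx dotC dot_delta -rowE [in RHS]mxE.
Qed.

Lemma laplacian_ge y : - (n%:R / v) <= laplacian (fun z => ln (dns z)) y.
Proof.
rewrite laplacianE lerDl mulr_ge0 ?sqr_ge0// sumr_ge0// => i _; exact: cov_ge0.
Qed.

(** The variances of the coordinates are bounded by second moments before summing. Their sum is the
    mean of |x|^2, so the total is rad^2, where coordinatewise bounds would give n rad^2. *)
Lemma laplacian_le y : laplacian (fun z => ln (dns z)) y <=
  - (n%:R / v) + m ^+ 2 * rad ^+ 2 / v ^+ 2.
Proof.
rewrite laplacianE lerD2l /s expr_div_n mulrAC ler_wpM2r ?invr_ge0 ?sqr_ge0//.
rewrite ler_wpM2l ?sqr_ge0//.
have b i : bm (fun x => x 0 i * x 0 i) by apply: bmeasM; exact: bm_coord.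
apply: (@le_trans _ _ (\sum_(i < n) 1 * pst (fun x => x 0 i * x 0 i) y)).
  apply: ler_sum => i _; rewrite /cov mul1r.
  have -> : (fun x : 'rV[R]_n => dot x (delta_mx 0 i)) = (fun x : 'rV[R]_n => x 0 i).
    by apply/funext => x; rewrite dotC dot_delta.
  have -> : (fun x : 'rV[R]_n => dot x (delta_mx 0 i) * dot x (delta_mx 0 i)) = (fun x => x 0 i * x 0 i).
    by apply/funext => x; rewrite dotC dot_delta.
  by rewrite lerBlDr lerDl -expr2 sqr_ge0.
rewrite -post_lin// -[leRHS](post_const _ y).
apply: post_le; [by apply: bmeas_sum => i; apply: bmeasZ|exact: bmeas_cst|].
move=> x Dx; under eq_bigr do rewrite mul1r -expr2.
by rewrite -enorm_sqr lerXn2r ?nnegrE ?enorm_ge0// (rad_ge0 muD).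
Qed.

(** Pairing the gradient g with itself gives |g|^2 = - <y, g> / v + s E<x, g>; Cauchy-Schwarz bounds
    both terms by multiples of |g|, which is then divided out. *)
Lemma gradient_le y : 0 <= m ->
  enorm (gradient (fun z => ln (dns z)) y) <= v^-1 * (enorm y + m * rad).
Proof.
move=> m0; set g := gradient _ y.
have r0 := rad_ge0 muD.
have [->|g0] := eqVneq (enorm g) 0.
  by rewrite mulr_ge0 ?invr_ge0 ?(ltW v0)// addr_ge0 ?enorm_ge0// mulr_ge0.
have gp : 0 < enorm g by rewrite lt_neqAle eq_sym g0 enorm_ge0.
rewrite -(ler_pM2r gp) -expr2 -dotxx.
have -> : dot g g = - (dot y g / v) + s * pst (dotr g) y.
  rewrite post_dot [dot y g]/dot mulr_suml mulr_sumr -sumrN -big_split/=.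
  rewrite {1}/dot; apply: eq_bigr => i _.
  rewrite {1}/g gradient_ln_dens// mxE /score; rewrite /s; ring.
have h1 : - (dot y g / v) <= enorm y * enorm g / v.
  rewrite -mulNr ler_wpM2r ?invr_ge0 ?(ltW v0)//.
  by apply: le_trans (ler_norm _) _; rewrite normrN dot_le.
have h2 : pst (dotr g) y <= rad * enorm g.
  rewrite -[leRHS](post_const _ y); apply: post_le; [exact: bm_dotr|exact: bmeas_cst|].
  move=> x Dx; apply: le_trans (ler_norm _) _; apply: le_trans (dot_le _ _) _.
  by rewrite ler_wpM2r ?enorm_ge0.
have s0 : 0 <= s by rewrite divr_ge0// ltW.
have h3 : s * pst (dotr g) y <= s * (rad * enorm g) by rewrite ler_wpM2l.
apply: le_trans (lerD h1 h3) _.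
by rewrite le_eqVlt; apply/orP; left; apply/eqP; rewrite /s; ring.
Qed.

End posterior_bounds.

(** * The law of the solution *)

Section density_law.
Context (R : realType) (n : nat) (mu : probability 'rV[R]_n R) (rad m v : R).
Local Notation D := (eball rad : set 'rV[R]_n).
Hypotheses (muD : mu D = 1%E) (v0 : 0 < v).
Local Notation L := (lebesgue_rV R n).
Local Notation p := (dens mu rad m v).

Let mg : measurable_fun setT (fun z : 'rV[R]_n * 'rV[R]_n => gauss v (z.1 - m *: z.2)).
Proof.
apply/measurable_EFinP/measurable_EFin_gauss/measurable_rVB; first exact: measurable_fst.
by apply: measurable_rVZ; exact: measurable_snd.
Qed.

Let mgc y : measurable_fun setT (fun x : 'rV[R]_n => (gauss v (y - m *: x))%:E).
Proof. by apply: measurable_EFin_gauss; apply: measurable_rVB => //; exact: measurable_rVZ. Qed.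

(** The complement of the ball is null, so nothing is lost in passing to the whole space, and as an
    extended integral over a full space the density is ready for Tonelli. *)
Lemma EFin_dens y : (p y)%:E = (\int[mu]_x (gauss v (y - m *: x))%:E)%E.
Proof.
have mD : measurable D by exact: measurable_eball.
have muDC : mu (~` D) = 0%E.
  have := probability_setC mu mD; rewrite [X in (_ - X)%E](_ : _ = 1%E); last exact: muD.
  by move=> h; apply: etrans h _; rewrite subee.
rewrite (ge0_negligible_integral _ measurableT (mgc y) _ muDC) ?setTD ?setCK//.
- rewrite /dens /Rintegral fineK//.
  apply: integrable_fin_num; first exact: mD.
  apply: measurable_bounded_integrable => //.
  + by apply: le_lt_trans (probability_le1 _ mD) _; rewrite ltry.
  + by apply: measurable_funTS; apply/measurable_EFinP; exact: mgc.
  + exists (((Num.sqrt (v * pi *+ 2))^-1) ^+ n); split; first exact: num_real.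
    move=> K CK x _ /=; rewrite ger0_norm ?gauss_ge0//.
    by apply: le_trans (ltW CK); exact: gauss_le_peak.
- exact: measurableC.
- by move=> x _; rewrite lee_fin gauss_ge0.
Qed.

Lemma measurable_dens : measurable_fun setT p.
Proof.
apply/measurable_EFinP; rewrite (_ : _ \o _ = fubini_F mu (fun z : 'rV[R]_n * 'rV[R]_n => (gauss v (z.1 - m *: z.2))%:E)).
  apply: measurable_fun_fubini_tonelli_F; first exact/measurable_EFinP.
  by move=> z; rewrite lee_fin gauss_ge0.
by apply/funext => y; rewrite /= EFin_dens.
Qed.

Lemma integral_dens : (\int[L]_y (p y)%:E = 1)%E.
Proof.
under eq_integral do rewrite EFin_dens.
rewrite (fubini_tonelli (fun z : 'rV[R]_n * 'rV[R]_n => (gauss v (z.1 - m *: z.2))%:E))/=; last 2 first.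
- exact/measurable_EFinP.
- by move=> z; rewrite lee_fin gauss_ge0.
under eq_integral do rewrite integral_gauss//.
by rewrite integral_cst// mul1e; exact: probability_setT.
Qed.

(** Convolving two heat kernels adds their variances. The right-hand side is the one of
    [sde_kernel], so smoothing this density and smoothing the law of the solution give the same
    function. *)
Lemma dens_conv a y : 0 < a -> (\int[L]_u (gauss a (y - u) * p u)%:E =
  \int[mu]_x (gauss (a + v) (y - m *: x))%:E)%E.
Proof.
move=> a0.
have mG : measurable_fun setT (fun z : 'rV[R]_n * 'rV[R]_n =>
    (gauss a (y - z.1) * gauss v (z.1 - m *: z.2))%:E).
  apply/measurable_EFinP/measurable_funM => //.
  apply/measurable_EFinP/measurable_EFin_gauss/measurable_rVB => //; exact: measurable_fst.
transitivity (\int[L]_u \int[mu]_x (gauss a (y - u) * gauss v (u - m *: x))%:E)%E.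
  apply: eq_integral => u _; rewrite EFinM EFin_dens -ge0_integralZl//.
  - by move=> x _; rewrite lee_fin gauss_ge0.
  - by rewrite lee_fin gauss_ge0.
rewrite (fubini_tonelli (fun z : 'rV[R]_n * 'rV[R]_n => (gauss a (y - z.1) * gauss v (z.1 - m *: z.2))%:E))//=; last first.
  by move=> z; rewrite lee_fin mulr_ge0 ?gauss_ge0.
apply: eq_integral => x _; have := gauss_conv 1 y (m *: x) a0 v0.
rewrite expr1n mul1r scale1r => <-.
by apply: eq_integral => u _; rewrite scale1r.
Qed.

Lemma dens_ge0 y : 0 <= p y. Proof. exact/ltW/dens_gt0. Qed.

Let nu := mdensity L measurable_dens dens_ge0.

Let nuT : nu setT = 1%E. Proof. exact: integral_dens. Qed.

Let dens_prob : probability 'rV[R]_n R :=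
  HB.pack (mdensity L measurable_dens dens_ge0)
    (Measure_isProbability.Build _ _ _ (mdensity L measurable_dens dens_ge0) nuT).

(** The last hypothesis is the conclusion of [sde_kernel]. With [dens_conv], the law of [X] and the
    measure with density [p] have equal Gaussian smoothings, hence agree. *)
Lemma dens_has_density d (Omega : measurableType d) (P : probability Omega R)
    (X0 X : Omega -> 'rV[R]_n) :
  has_law P X0 mu -> measurable_fun setT X ->
  (forall a y, 0 < a -> \int[P]_w (gauss a (y - X w)) =
     \int[P]_w (gauss (a + v) (y - m *: X0 w))) ->
  has_density P X p.
Proof.
move=> [mX0 X0mu] mX H.
split; [exact: measurable_dens|exact: dens_ge0|split => // A mA].
apply: (@gauss_kernel_unique _ _ (distribution P (mfun_of P mX)) dens_prob) => // a y a0.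
have E c (f : Omega -> 'rV[R]_n) : 0 < c -> measurable_fun setT f ->
    (\int[P]_w (gauss c (f w))%:E = (\int[P]_w gauss c (f w))%:E)%E.
  move=> c0 mf; rewrite /Rintegral fineK//; apply: integrable_fin_num => //.
  apply: measurable_bounded_integrable => //.
  - by apply: le_lt_trans (probability_le1 _ measurableT) _; rewrite ltry.
  - exact/measurable_EFinP/measurable_EFin_gauss.
  exists (((Num.sqrt (c * pi *+ 2))^-1) ^+ n); split; first exact: num_real.
  move=> K CK x _ /=; rewrite ger0_norm ?gauss_ge0//.
  by apply: le_trans (ltW CK); exact: gauss_le_peak.
rewrite ge0_integral_distribution/=; last 2 first.
- by apply: measurable_EFin_gauss; exact: measurable_rVB.
- by move=> x; rewrite lee_fin gauss_ge0.
rewrite E//; last exact: measurable_rVB.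
rewrite H// -E ?addr_gt0//; last by apply: measurable_rVB => //; exact: measurable_rVZ.
have mG c : measurable_fun setT (fun x : 'rV[R]_n => (gauss c (y - m *: x))%:E).
  by apply: measurable_EFin_gauss; apply: measurable_rVB => //; exact: measurable_rVZ.
transitivity (\int[distribution P (mfun_of P mX0)]_x (gauss (a + v) (y - m *: x))%:E)%E.
  by rewrite ge0_integral_distribution// => x; rewrite lee_fin gauss_ge0.
transitivity (\int[mu]_x (gauss (a + v) (y - m *: x))%:E)%E.
  by apply: eq_measure_integral => B mB _; exact: X0mu.
rewrite -dens_conv//; apply/esym.
rewrite (ge0_integral_density (mu := L) (nu := dens_prob) measurable_dens dens_ge0)//.
- by apply: measurable_EFin_gauss; exact: measurable_rVB.
- by move=> x; rewrite lee_fin gauss_ge0.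
Qed.

End density_law.

(** * Replacing the coefficients by versions bounded everywhere *)

Section coefficients_ae.
Context (R : realType).
Local Notation lam := (@lebesgue_measure R).

Lemma ae_lebesgue_imp (A B : R -> Prop) : (forall r, A r -> B r) ->
  {ae lam, forall r, A r} -> {ae lam, forall r, B r}.
Proof. by move=> AB; apply: (@filterS _ _ (ae_filter_ringOfSetsType lam)). Qed.

Lemma ae_integral_itv (f g : R -> \bar R) (T s : R) : s <= T ->
  measurable_fun `]0, s[ f -> measurable_fun `]0, s[ g ->
  {ae lam, forall r : R, r \in `]0, T[ -> f r = g r} ->
  (\int[lam]_(r in `[0%R, s]) f r = \int[lam]_(r in `[0%R, s]) g r)%E.
Proof.
move=> sT mf mg fg; rewrite !integral_itv_bndoo//; apply: ae_eq_integral => //.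
apply: ae_lebesgue_imp fg => r H; rewrite /= in_itv/= => /andP[r0 rs]; apply: H.
by rewrite in_itv/= r0 (lt_le_trans rs).
Qed.

(** The extension by zero is clipped to [a, b]; at points of ]0, T[ where the bounds hold, clipping
    changes nothing. *)
Lemma bounded_version (f : R -> R) (T a b : R) : a <= b -> measurable_fun `]0, T[ f ->
  {ae lam, forall r : R, r \in `]0, T[ -> a <= f r <= b} ->
  exists g, [/\ measurable_fun setT g, forall r, a <= g r <= b &
    {ae lam, forall r : R, r \in `]0, T[ -> f r = g r}].
Proof.
move=> ab mf fab; exists (fun r => Num.max a (Num.min b ((f \_ `]0, T[) r))); split.
- apply: measurable_maxr => //; apply: measurable_minr => //.
  by apply: (measurable_restrictT f _).1.
- by move=> r; rewrite le_max lexx/= ge_max ab ge_min lexx.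
- apply: ae_lebesgue_imp fab => r H rT; have /andP[h1 h2] := H rT.
  by rewrite patchE mem_setE rT min_r// max_r.
Qed.

Lemma eq_m_ (beta beta' : R -> R) (T s : R) : 0 <= s <= T ->
  measurable_fun `]0, T[ beta -> measurable_fun setT beta' ->
  {ae lam, forall r : R, r \in `]0, T[ -> beta r = beta' r} -> m_ beta s = m_ beta' s.
Proof.
move=> /andP[s0 sT] mb mb' bb; rewrite /m_ /Rintegral; congr (expR (- fine _)).
apply: (ae_integral_itv sT).
- apply/measurable_EFinP; apply: measurable_funS mb => //.
  by apply: subset_itvl; rewrite bnd_simp.
- by apply/measurable_EFinP; exact: measurable_funTS.
- by apply: ae_lebesgue_imp bb => r H /H ->.
Qed.

Section regular.
Variables (beta sigma : R -> R) (T M S eps : R).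
Hypotheses (T0 : 0 < T) (mbeta : measurable_fun setT beta) (bM : forall r, `|beta r| <= M).
Hypotheses (msigma : measurable_fun setT sigma) (e0 : 0 < eps) (sS : forall r, eps <= sigma r <= S).
Local Notation m := (m_ beta).
Let g r := sigma r ^+ 2 * m r ^- 2.
Let c := eps ^+ 2 * expR (M * T) ^- 2.
Let C := S ^+ 2 * expR (M * T) ^+ 2.

Let m_bnd r : 0 <= r <= T -> (expR (M * T))^-1 <= m r <= expR (M * T).
Proof.
move=> rT; have T1 : (0 : R) <= (0 : R) <= T by rewrite lexx ltW.
have h1 := m_ratio_le mbeta bM rT T1; have h2 := m_ratio_le mbeta bM T1 rT.
rewrite m0 divr1 in h1; rewrite m0 mul1r in h2; rewrite h1 andbT.
by rewrite -[leRHS]invrK lef_pV2// posrE ?expR_gt0// invr_gt0 m_gt0.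
Qed.

Let mg : measurable_fun `[0, T] g.
Proof.
apply: measurable_funM; first by apply: measurable_funTS; exact: measurable_funX.
rewrite (_ : (fun r => m r ^- 2) = (fun r => (m r)^-1 ^+ 2)); last first.
  by apply/funext => r; rewrite exprVn.
apply: measurable_funX; apply: subspace_continuous_measurable_fun => //.
exact: within_mV.
Qed.

Let g_bnd r : 0 <= r <= T -> c <= g r <= C.
Proof.
move=> rT; have /andP[h1 h2] := m_bnd rT; have /andP[s1 s2] := sS r.
have mp := m_gt0 beta r; have ep := expR_gt0 (M * T).
have S0 : 0 <= S by rewrite (le_trans (ltW e0))// (le_trans s1 s2).
apply/andP; split; apply: ler_pM.
- exact: sqr_ge0.
- by rewrite invr_ge0 sqr_ge0.
- by rewrite lerXn2r ?nnegrE ?(ltW e0)// (le_trans (ltW e0)).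
- by rewrite lef_pV2 ?posrE ?exprn_gt0// lerXn2r ?nnegrE ?(ltW mp) ?(ltW ep).
- exact: sqr_ge0.
- by rewrite invr_ge0 sqr_ge0.
- by rewrite lerXn2r ?nnegrE// (le_trans (ltW e0)).
- rewrite -[leRHS]invrK lef_pV2 ?posrE ?invr_gt0 ?exprn_gt0//.
  by rewrite -exprVn lerXn2r ?nnegrE ?invr_ge0 ?(ltW mp) ?(ltW ep).
Qed.

Let C0 : 0 <= C. Proof. by rewrite mulr_ge0// sqr_ge0. Qed.
Let c0 : 0 < c. Proof. by rewrite mulr_gt0 ?exprn_gt0// invr_gt0 exprn_gt0// expR_gt0. Qed.

Let gi s : s <= T -> lam.-integrable `[0, s] (EFin \o g).
Proof.
move=> sT; apply: (bounded_itv_integrable (M := C)); first exact: lebesgue_itv_lty.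
  by apply: measurable_funS mg => //; apply: subset_itvl; rewrite bnd_simp.
move=> r; rewrite in_itv/= => /andP[r0 rs].
have /andP[h1 h2] : c <= g r <= C by apply: g_bnd; rewrite r0 (le_trans rs).
by rewrite ger0_norm// (le_trans (ltW c0)).
Qed.

Lemma within_vs2 : {within `[0, T], continuous (vs2 beta sigma)}.
Proof.
have cI : {within `[0, T], continuous (fun s => \int[lam]_(r in `[0, s]) g r)}.
  apply: (@lipschitz_within _ _ _ C) => r s r0 rs sT.
  rewrite Rintegral_itvB; rewrite ?bnd_simp//; last exact: gi.
  apply: norm_Rintegral_itvoc => //.
    apply: measurable_funS mg => // u; rewrite /= !in_itv/= => /andP[ru us].
    by rewrite (le_trans r0 (ltW ru)) (le_trans us).
  move=> u; rewrite in_itv/= => /andP[ru us].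
  have /andP[h1 h2] : c <= g u <= C by apply: g_bnd; rewrite (le_trans r0 (ltW ru)) (le_trans us).
  by rewrite ger0_norm// (le_trans (ltW c0)).
rewrite (_ : vs2 beta sigma = (fun s => m s * m s * \int[lam]_(r in `[0, s]) g r)); last first.
  by apply/funext => s; rewrite -expr2.
have cm := within_m mbeta bM (T := T).
by apply: contM => //; exact: contM.
Qed.

(** Both the factor m_s^2 and the integrand are bounded below by positive constants. The linear
    bound degenerates only at 0, hence gives a positive infimum on [delta, T]. *)
Lemma vs2_lower : exists2 k, 0 < k & forall s, 0 <= s <= T -> k * s <= vs2 beta sigma s.
Proof.
exists (expR (M * T) ^- 2 * c); first by rewrite mulr_gt0// invr_gt0 exprn_gt0// expR_gt0.
move=> s /andP[s0 sT]; rewrite /vs2 -mulrA; apply: ler_pM.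
- by rewrite invr_ge0 sqr_ge0.
- by rewrite mulr_ge0// ltW.
- have /andP[h _] : (expR (M * T))^-1 <= m s <= expR (M * T) by apply: m_bnd; rewrite s0.
  by rewrite -exprVn lerXn2r ?nnegrE ?invr_ge0 ?expR_ge0.
- have -> : c * s = \int[lam]_(r in `[0, s]) c.
    have ls : s = fine (lam `[0, s]%classic).
      rewrite lebesgue_measure_itv/= lte_fin; case: ltP => [_|s0']; first by rewrite /= subr0.
      by apply/eqP; rewrite eq_le s0 s0'.
    by rewrite Rintegral_cst//; congr (_ * _).
  apply: le_Rintegral => //; [|exact: gi|].
    apply: (bounded_itv_integrable (M := `|c|)) => //; first exact: lebesgue_itv_lty.
  move=> r; rewrite /= in_itv/= => /andP[r0 rs].
  by have /andP[] : c <= g r <= C by apply: g_bnd; rewrite r0 (le_trans rs).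
Qed.

End regular.

End coefficients_ae.

Section sde_version.
Context (R : realType) (n : nat) d (Omega : measurableType d)
  (P : probability Omega R) (T : R) (F : R -> set (set Omega))
  (W X : R -> Omega -> 'rV[R]_n).
Local Notation lam := (@lebesgue_measure R).

Lemma measurable_step_eval (s : step_fun R) : measurable_fun setT (step_eval s).
Proof.
by apply: measurable_sum => i; apply: measurable_funM => //; exact: measurable_indic.
Qed.

(** The stochastic integral keeps its approximating step functions, as their L^2 distance to [sigma]
    ignores null sets; the drift is compared path by path. *)
Lemma sde_version (beta beta' sigma sigma' : R -> R) :
  measurable_fun `]0, T[ beta -> measurable_fun setT beta' ->
  measurable_fun `]0, T[ sigma -> measurable_fun setT sigma' ->
  {ae lam, forall r : R, r \in `]0, T[ -> beta r = beta' r} ->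
  {ae lam, forall r : R, r \in `]0, T[ -> sigma r = sigma' r} ->
  sde_solution P T F W beta sigma X -> sde_solution P T F W beta' sigma' X.
Proof.
move=> mb mb' ms ms' bb ss [aX cX eX]; split => // t tT.
have [Y [mY [phi [phi1 phi2 phi3]]] XY] := eX t tT.
have /andP[t0 tleT] : 0 <= t <= T by move: tT; rewrite in_itv.
have sub f : measurable_fun `]0, T[ f -> measurable_fun `]0, t[ f :> Prop.
  move=> mf; apply: measurable_funS mf => //.
  by apply: subset_itvl; rewrite bnd_simp.
exists Y.
  split => //; exists phi; split => //.
  rewrite (_ : (fun k => _) = (fun k => \int[lam]_(r in `[0%R, t])
     ((step_eval (phi k) r - sigma r) ^+ 2)%:E)%E)//.
  apply/funext => k; apply/esym; apply: (ae_integral_itv tleT).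
  - apply/measurable_EFinP; apply: measurable_funX; apply: measurable_funB; last exact: sub.
    by apply: measurable_funTS; exact: measurable_step_eval.
  - apply/measurable_EFinP; apply: measurable_funX; apply: measurable_funTS.
    by apply: measurable_funB => //; exact: measurable_step_eval.
  - by apply: ae_lebesgue_imp ss => r H /H ->.
apply: filterS2 cX XY => w cw ->; congr (_ - _ + _).
apply/rowP => i; rewrite !mxE /Rintegral; congr fine.
have mx : measurable_fun `]0, t[ (fun s => X s w 0 i).
  apply: (@measurable_funS _ _ _ _ `[0, T]) => //.
    by move=> s; rewrite /= !in_itv/= => /andP[/ltW-> /ltW /le_trans ->].
  apply: subspace_continuous_measurable_fun => // s.
  apply: (@continuous_comp (subspace `[0, T]) _ _ (fun t => X t w) (fun v : 'rV[R]_n => v 0 i)).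
    exact: cw.
  exact: coord_continuous.
apply: (ae_integral_itv tleT).
- by apply/measurable_EFinP; apply: measurable_funM => //; exact: sub.
- by apply/measurable_EFinP; apply: measurable_funM => //; exact: measurable_funTS.
- by apply: ae_lebesgue_imp bb => r H /H ->.
Qed.

End sde_version.

Section coefficients_regular.
Context (R : realType) (T eps : R) (beta sigma : R -> R).
Hypotheses (T0 : 0 < T) (Ls : Linfty 0 T sigma) (e0 : 0 < eps) (Lb : Linfty 0 T beta).
Local Notation lam := (@lebesgue_measure R).
Hypothesis (seps : {ae lam, forall s : R, s \in `]0, T[ -> eps <= sigma s <= eps^-1}).

Lemma coefficients_version : exists (beta' sigma' : R -> R) (M S : R),
  [/\ [/\ measurable_fun setT beta', forall r, `|beta' r| <= M,
          measurable_fun setT sigma' & forall r, eps <= sigma' r <= S],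
      (forall s, 0 <= s <= T -> m_ beta s = m_ beta' s) /\
      (forall s, 0 <= s <= T -> vs2 beta sigma s = vs2 beta' sigma' s) &
      forall (n : nat) d (Omega : measurableType d)
        (P : probability Omega R) (F : R -> set (set Omega))
        (W X : R -> Omega -> 'rV[R]_n),
      sde_solution P T F W beta sigma X -> sde_solution P T F W beta' sigma' X].
Proof.
have [mb [M0 bM0]] := Lb; have [ms _] := Ls.
have NM : - `|M0| <= `|M0| by rewrite ge0_cp.
have [beta' [mb' bb' eb]] : exists g, [/\ measurable_fun setT g,
   forall r, - `|M0| <= g r <= `|M0| & {ae lam, forall r : R, r \in `]0, T[ -> beta r = g r}].
  apply: bounded_version => //; apply: ae_lebesgue_imp bM0 => r H /H {}H.
  by rewrite -ler_norml (le_trans H)// ler_norm.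
(* The upper bound is a maximum because [bounded_version] wants ordered bounds and [eps^-1] may lie
   below [eps]. *)
have [sigma' [ms' bs' es]] : exists g, [/\ measurable_fun setT g,
   forall r, eps <= g r <= Num.max eps eps^-1 &
   {ae lam, forall r : R, r \in `]0, T[ -> sigma r = g r}].
  apply: bounded_version => //; first by rewrite le_max lexx.
  by apply: ae_lebesgue_imp seps => r H /H /andP[-> h]; rewrite le_max h orbT.
have b'M r : `|beta' r| <= `|M0| by rewrite ler_norml.
have em s : 0 <= s <= T -> m_ beta s = m_ beta' s by move=> sT; exact: eq_m_ sT mb mb' eb.
exists beta', sigma', `|M0|, (Num.max eps eps^-1); split; [by split| |by move=> n d Omega P F W X; exact: sde_version].
  split; first exact: em.
  move=> s sT; have /andP[s0 sleT] := sT.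
  apply: (f_equal2 (fun a b : R => a ^+ 2 * b) (em s sT)); apply: (f_equal fine).
  have sub : `]0, s[ `<=` `]0, T[%classic by apply: subset_itvl; rewrite bnd_simp.
  have mi (f : R -> R) : measurable_fun `]0, T[ f ->
      measurable_fun `]0, s[ (fun r => (f r ^+ 2 * m_ beta' r ^- 2)%:E).
    move=> mf; apply/measurable_EFinP; apply: measurable_funM.
      by apply: measurable_funX; apply: measurable_funS mf.
    rewrite (_ : (fun r => m_ beta' r ^- 2) = (fun r => (m_ beta' r)^-1 ^+ 2)); last first.
      by apply/funext => r; rewrite exprVn.
    apply: measurable_funX.
    apply: (@measurable_funS _ _ _ _ `[0, T]) => //.
      by move=> r; rewrite /= !in_itv/= => /andP[/ltW-> /ltW /le_trans ->].
    by apply: subspace_continuous_measurable_fun => //; exact: within_mV b'M T.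
  apply: (ae_integral_itv sleT).
  - apply: eq_measurable_fun (mi sigma ms) => r; rewrite inE/= in_itv/= => /andP[r0 rs].
    apply: (f_equal (fun a : R => (sigma r ^+ 2 * a ^- 2)%:E)); apply/esym/em.
    by rewrite (ltW r0) (le_trans (ltW rs)).
  - by apply: mi; exact: measurable_funTS.
  - apply: ae_lebesgue_imp es => r H rT; rewrite (H rT).
    apply: (f_equal (fun a : R => (sigma' r ^+ 2 * a ^- 2)%:E)); apply: em.
    by move: rT; rewrite in_itv/= => /andP[/ltW-> /ltW->].
Qed.

Lemma m_within : {within `[0, T], continuous (m_ beta)}.
Proof.
have [beta' [sigma' [M [S [[mb' bM _ _] [em _] _]]]]] := coefficients_version.
apply: (subspace_eq_continuous (f := m_ beta')); last exact: within_m bM T.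
by move=> s; rewrite inE/= in_itv/= => sT; exact/esym/em.
Qed.

Lemma vs2_within : {within `[0, T], continuous (vs2 beta sigma)}.
Proof.
have [beta' [sigma' [M [S [[mb' bM ms' bS] [_ ev] _]]]]] := coefficients_version.
apply: (subspace_eq_continuous (f := vs2 beta' sigma')); last exact: within_vs2 T0 mb' bM ms' e0 bS.
by move=> s; rewrite inE/= in_itv/= => sT; exact/esym/ev.
Qed.

Lemma vs2_linear_lower : exists2 k, 0 < k & forall s, 0 <= s <= T -> k * s <= vs2 beta sigma s.
Proof.
have [beta' [sigma' [M [S [[mb' bM ms' bS] [_ ev] _]]]]] := coefficients_version.
have [k k0 H] := vs2_lower T0 mb' bM ms' e0 bS.
exists k; first exact: k0.
by move=> s sT; exact: (eq_ind_r (fun a : R => k * s <= a) (H s sT) (ev s sT)).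
Qed.

Lemma sde_kernel_version (n : nat) d (Omega : measurableType d)
    (P : probability Omega R) (F : R -> set (set Omega)) (W X : R -> Omega -> 'rV[R]_n) :
  filtration T F -> brownian_motion P T F W -> sde_solution P T F W beta sigma X ->
  forall t a y, 0 < t <= T -> 0 < a ->
  \int[P]_w (gauss a (y - X t w)) =
  \int[P]_w (gauss (a + vs2 beta sigma t) (y - m_ beta t *: X 0 w)).
Proof.
move=> hF hW hX t a y tT a0.
have [beta' [sigma' [M [S [[mb' bM ms' bS] [em ev] hsde]]]]] := coefficients_version.
have tT' : 0 <= t <= T by case/andP: tT => /ltW ->.
have sS r : `|sigma' r| <= S.
  by have /andP[h1 h2] := bS r; rewrite ger0_norm// (le_trans (ltW e0)).
have := sde_kernel hF hW T0 mb' bM ms' sS (hsde _ _ _ _ _ _ _ hX) tT y a0.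
by rewrite -(em t tT') -(ev t tT').
Qed.

End coefficients_regular.

(** * Joint measurability and integral bounds *)

Section measurable_real_ops.
Context (R : realType) d (Z : measurableType d).

Lemma measurable_ge0_inv (f : Z -> R) : measurable_fun setT f -> (forall z, 0 <= f z) ->
  measurable_fun setT (fun z => (f z)^-1).
Proof.
move=> mf f0; rewrite (_ : (fun z => (f z)^-1) = (fun x => x `^ (-1)) \o f).
  by apply: measurableT_comp => //; exact: measurable_powR.
by apply/funext => z /=; rewrite powR_inv1.
Qed.

(** Tonelli makes the integrals of the positive and of the negative part measurable in the
    parameter, and [fine] of their difference is the real integral whether or not [f] is
    integrable. *)
Lemma measurable_Rintegral d2 (Y : measurableType d2)
    (mu : {sigma_finite_measure set Y -> \bar R}) (D : set Y) (f : Z * Y -> R) :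
  measurable D -> measurable_fun setT f ->
  measurable_fun setT (fun z => \int[mu]_(x in D) f (z, x)).
Proof.
move=> mD mf.
pose g := (fun z : Z * Y => f z * \1_D z.2).
have mg : measurable_fun setT (EFin \o g).
  apply/measurable_EFinP/measurable_funM => //.
  by apply: measurableT_comp => //; exact: measurable_indic.
have E : (fun z => \int[mu]_(x in D) f (z, x)) =
    fine \o (fun z => fubini_F mu ((EFin \o g)^\+%E) z - fubini_F mu ((EFin \o g)^\-%E) z)%E.
  apply/funext => z /=; rewrite /Rintegral.
  rewrite (_ : (\int[mu]_(x in D) (f (z, x))%:E)%E = \int[mu]_x (g (z, x))%:E)%E; last first.
    rewrite integral_mkcond; apply: eq_integral => y _; rewrite patchE /g/= indicE.
    by case: ifPn => _; rewrite ?mulr1 ?mulr0.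
  by rewrite [in LHS]integralE; congr (fine (_ - _)%E); apply: eq_integral => y _; rewrite unlock.
rewrite E; apply: measurableT_comp => //.
by apply: emeasurable_funB; apply: measurable_fun_fubini_tonelli_F => //;
  [exact: measurable_funepos|exact: measurable_funeneg].
Qed.

End measurable_real_ops.

Section measurable_posterior.
Context (R : realType) (n : nat) (mu : probability 'rV[R]_n R) (rad : R).
Context d (Z : measurableType d) (m v : Z -> R) (y : Z -> 'rV[R]_n).
Hypotheses (mm : measurable_fun setT m) (mv : measurable_fun setT v)
  (v0 : forall z, 0 <= v z) (my : measurable_fun setT y).
Local Notation D := (eball rad : set 'rV[R]_n).

Let my_coord i : measurable_fun setT (fun z => y z 0 i).
Proof. by apply: (measurableT_comp (measurable_coord i)). Qed.

Let mvV : measurable_fun setT (fun z => (v z)^-1).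
Proof. exact: measurable_ge0_inv. Qed.

Lemma measurable_lap q : measurable_fun setT q ->
  measurable_fun setT (fun z => lap mu rad (m z) (v z) q (y z)).
Proof.
move=> mq; pose f (a : Z * 'rV[R]_n) := q a.2 *
  expR (- (m a.1 ^+ 2 * enorm a.2 ^+ 2) * (v a.1)^-1 * 2^-1) *
  expR (m a.1 * (v a.1)^-1 * dot (y a.1) a.2).
have m1 g : measurable_fun setT g -> measurable_fun setT (fun a : Z * 'rV[R]_n => g a.1 : R).
  by move=> mg'; apply: measurableT_comp => //; exact: measurable_fst.
have m2 g : measurable_fun setT g -> measurable_fun setT (fun a : Z * 'rV[R]_n => g a.2 : R).
  by move=> mg'; apply: measurableT_comp => //; exact: measurable_snd.
have -> : (fun z => lap mu rad (m z) (v z) q (y z)) =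
   (fun z => \int[mu]_(x in D) f (z, x)).
  apply/funext => z; apply: eq_Rintegral => x _.
  have e a b : a * b^-1 * 2^-1 = a / (b *+ 2) :> R by rewrite -mulrA -invfM mulr_natr.
  by rewrite /f/= e.
apply: measurable_Rintegral; first exact: measurable_eball.
apply: measurable_funM.
  apply: measurable_funM; first exact: m2.
  apply: measurableT_comp => //; apply: measurable_funM => //.
  apply: measurable_funM; last exact: (m1 (fun z => (v z)^-1)).
  apply: measurableT_comp => //; apply: measurable_funM.
    by apply: measurable_funX; exact: (m1 m).
  by apply: measurable_funX; exact: m2 (@measurable_enorm R n).
apply: measurableT_comp => //; apply: measurable_funM.
  by apply: measurable_funM; [exact: (m1 m)|exact: (m1 (fun z => (v z)^-1))].
apply: measurable_sum => i; apply: measurable_funM.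
  exact: (m1 (fun z => y z 0 i)).
exact: (m2 (fun x : 'rV[R]_n => x 0 i)) (measurable_coord i).
Qed.

Lemma measurable_post q : measurable_fun setT q ->
  measurable_fun setT (fun z => post mu rad (m z) (v z) q (y z)).
Proof.
move=> mq; apply: measurable_funM; first exact: measurable_lap.
apply: measurable_ge0_inv; first exact: measurable_lap.
by move=> z; apply: Rintegral_ge0 => x _; rewrite mul1r mulr_ge0 ?expR_ge0.
Qed.

Lemma measurable_score i : measurable_fun setT (fun z => score mu rad (m z) (v z) i (y z)).
Proof.
apply: measurable_funD.
  by apply: measurableT_comp => //; exact: measurable_funM.
apply: measurable_funM; first exact: measurable_funM.
by apply: measurable_post; exact: measurable_coord.
Qed.

Lemma measurable_score_jac i j :
  measurable_fun setT (fun z => score_jac mu rad (m z) (v z) i j (y z)).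
Proof.
have mc k := @measurable_coord R n k.
apply: measurable_funD.
  by apply: measurableT_comp => //; exact: measurable_funM.
apply: measurable_funM; first by apply: measurable_funX; exact: measurable_funM.
apply: measurable_funB; first by apply: measurable_post; exact: measurable_funM.
by apply: measurable_funM; exact: measurable_post.
Qed.

Lemma measurable_dens_param : measurable_fun setT (fun z => dens mu rad (m z) (v z) (y z)).
Proof.
(* The square root is written as a power, whose measurability is [measurable_powR]. *)
pose f (a : Z * 'rV[R]_n) := ((v a.1 * pi *+ 2) `^ 2^-1)^-1 ^+ n *
  expR (- enorm (y a.1 - m a.1 *: a.2) ^+ 2 * (v a.1)^-1 * 2^-1).
have c0 z : 0 <= v z * pi *+ 2 by rewrite mulrn_wge0// mulr_ge0// pi_ge0.
have -> : (fun z => dens mu rad (m z) (v z) (y z)) = (fun z => \int[mu]_(x in D) f (z, x)).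
  apply/funext => z; apply: eq_Rintegral => x _.
  have e a b : a * b^-1 * 2^-1 = a / (b *+ 2) :> R by rewrite -mulrA -invfM mulr_natr.
  by rewrite gaussE /f/= powR12_sqrt// e.
apply: measurable_Rintegral; first exact: measurable_eball.
have m1 g : measurable_fun setT g -> measurable_fun setT (fun a : Z * 'rV[R]_n => g a.1 : R).
  by move=> mg'; apply: measurableT_comp => //; exact: measurable_fst.
apply: measurable_funM.
  apply: measurable_funX; apply: measurable_ge0_inv => [|a]; last exact: powR_ge0.
  apply: (measurableT_comp (measurable_powR _)).
  have -> : (fun a : Z * 'rV[R]_n => v a.1 * pi *+ 2) = (fun a => v a.1 * (pi *+ 2)).
    by apply/funext => a; rewrite -mulrnAr.
  by apply: measurable_funM => //; exact: (m1 v).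
apply: measurableT_comp => //; apply: measurable_funM => //.
apply: measurable_funM; last exact: (m1 (fun z => (v z)^-1)).
apply: measurableT_comp => //; apply: measurable_funX.
apply: (measurableT_comp (@measurable_enorm R n)).
apply: measurable_fun_rV => i.
have -> : (fun a : Z * 'rV[R]_n => (y a.1 - m a.1 *: a.2) 0 i) =
   (fun a => y a.1 0 i - m a.1 * a.2 0 i).
  by apply/funext => a; rewrite !mxE.
apply: measurable_funB; first exact: (m1 (fun z => y z 0 i)).
apply: measurable_funM; first exact: (m1 m).
by apply: (measurableT_comp (measurable_coord i)); exact: measurable_snd.
Qed.

End measurable_posterior.

Section integral_bounds.
Import HBNNSimple.
Context (R : realType) d (Y : measurableType d) (mu : {measure set Y -> \bar R}).

(** The integral is a supremum over simple functions below [f], each bounded by [K] on [D] and by 0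
    outside. In [pdens_S2] this handles the iterated integral, whose inner part is merely some
    function of time. *)
Lemma ge0_integral_le_cst (D : set Y) (f : Y -> \bar R) (K : R) : measurable D -> 0 <= K ->
  (forall x, D x -> 0 <= f x <= K%:E)%E -> (\int[mu]_(x in D) f x <= K%:E * mu D)%E.
Proof.
move=> mD K0 fK; rewrite integral_mkcond ge0_integralTE; last first.
  by move=> x; rewrite patchE; case: ifPn => // /set_mem /fK /andP[].
apply: ub_ereal_sup => _ [h hf <-]; rewrite -integral_cst// [leRHS]integral_mkcond -integralT_nnsfun.
apply: ge0_le_integral => //.
- by move=> x _; rewrite lee_fin.
- exact/measurable_EFinP.
- by apply: (measurable_restrictT (cst K%:E) mD).1; exact: measurable_cst.
- move=> x _; apply: le_trans (hf x) _; rewrite !patchE; case: ifPn => // /set_mem /fK.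
  by case/andP.
Qed.

Lemma Lnorm_oo_le (f : Y -> \bar R) (K : R) : 0 <= K -> (forall x, `|f x| <= K%:E)%E ->
  ('N[mu]_+oo[f] <= K%:E)%E.
Proof.
move=> K0 fK; rewrite unlock /Lnorm; case: ifPn => _; last by rewrite lee_fin.
by apply/ess_supP; apply: aeW => x; exact: fK.
Qed.

End integral_bounds.

Section second_moment.
Context (R : realType) (n : nat).
Local Notation L := (lebesgue_rV R n).

Lemma gauss_double a (U : 'rV[R]_n) : 0 < a ->
  gauss a U = Num.sqrt 2 ^+ n * gauss (a *+ 2) U * expR (- enorm U ^+ 2 / (a *+ 4)).
Proof.
move=> a0; rewrite !gaussE.
have -> : Num.sqrt (a *+ 2 * pi *+ 2) = Num.sqrt 2 * Num.sqrt (a * pi *+ 2).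
  rewrite -sqrtrM//; congr Num.sqrt; ring.
rewrite invfM exprMn !mulrA -exprMn mulfV ?expr1n ?mul1r; last by rewrite gt_eqF// sqrtr_gt0.
by rewrite -mulrA -expRD; congr (_ * expR _); field; rewrite gt_eqF.
Qed.

(** Half of the exponent absorbs the weight: t e^(-t) <= 1 for t = |U|^2 / (4a). *)
Lemma enorm_sqr_gauss_le a (U : 'rV[R]_n) : 0 < a ->
  enorm U ^+ 2 * gauss a U <= Num.sqrt 2 ^+ n * (a *+ 4) * gauss (a *+ 2) U.
Proof.
move=> a0; rewrite gauss_double//; set g := gauss _ U; set s := enorm U ^+ 2.
have a4 : 0 < a *+ 4 by rewrite pmulrn_lgt0.
have s0 : 0 <= s / (a *+ 4) by rewrite divr_ge0 ?sqr_ge0// ltW.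
have h : s / (a *+ 4) * expR (- (s / (a *+ 4))) <= 1.
  rewrite expRN ler_pdivrMr ?expR_gt0// mul1r.
  by apply: le_trans (expR_ge1Dx _); rewrite lerDr.
have -> : s * (Num.sqrt 2 ^+ n * g * expR (- s / (a *+ 4))) =
    Num.sqrt 2 ^+ n * (a *+ 4) * g * (s / (a *+ 4) * expR (- (s / (a *+ 4)))).
  rewrite mulNr; move: (expR _) => e; field; exact/lt0r_neq0.
by rewrite ler_piMr// mulr_ge0 ?gauss_ge0// mulr_ge0 ?(ltW a4)// exprn_ge0// sqrtr_ge0.
Qed.

Variables (mu : probability 'rV[R]_n R) (rad m v : R).
Hypotheses (muD : mu (eball rad) = 1%E) (v0 : 0 < v).
Local Notation D := (eball rad : set 'rV[R]_n).

Lemma bm_gauss a y : 0 < a -> bmeas D (fun x => gauss a (y - m *: x)).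
Proof.
move=> a0; split.
  by apply/measurable_EFinP/measurable_EFin_gauss/measurable_rVB => //; exact: measurable_rVZ.
exists ((Num.sqrt (a * pi *+ 2))^-1 ^+ n) => x _.
by rewrite ger0_norm ?gauss_ge0//; exact: gauss_le_peak.
Qed.

Lemma dens_le_peak a y : 0 < a -> a <= v -> dens mu rad m v y <= (Num.sqrt (a * pi *+ 2))^-1 ^+ n.
Proof.
move=> a0 av; rewrite -(avg_cst muD ((Num.sqrt (a * pi *+ 2))^-1 ^+ n)).
apply: le_avg; [exact: measurable_eball|exact: bm_gauss|exact: bmeas_cst|].
by move=> x _; exact: gauss_le_peak2.
Qed.

(** Splitting y = (y - m x) + m x under the integral: the first part is absorbed by the kernel at
    the price of doubling the variance, the second is bounded since |x| <= rad. *)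
Lemma enorm_sqr_dens_le y : enorm y ^+ 2 * dens mu rad m v y <=
  2 * (Num.sqrt 2 ^+ n * (v *+ 4)) * dens mu rad m (v *+ 2) y +
  2 * (m ^+ 2 * rad ^+ 2) * dens mu rad m v y.
Proof.
have mD : measurable D by exact: measurable_eball.
have v2 : 0 < v *+ 2 by rewrite pmulrn_lgt0.
have b1 := bm_gauss y v0; have b2 := bm_gauss y v2.
rewrite /dens -!avgZ// -avgD//; [|exact: bmeasZ..].
apply: le_avg => //; [exact: bmeasZ|by apply: bmeasD; exact: bmeasZ|].
move=> x Dx; set g := gauss v _; set u := y - m *: x.
have h : enorm y ^+ 2 <= 2 * enorm u ^+ 2 + 2 * (m ^+ 2 * rad ^+ 2).
  have -> : y = u + m *: x by rewrite /u subrK.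
  apply: le_trans (enormD_sqr _ _) _; rewrite lerD2l ler_wpM2l// enormZ_sqr.
  rewrite ler_wpM2l ?sqr_ge0// lerXn2r ?nnegrE ?enorm_ge0//.
  exact: le_trans (enorm_ge0 x) Dx.
apply: (@le_trans _ _ ((2 * enorm u ^+ 2 + 2 * (m ^+ 2 * rad ^+ 2)) * g)).
  by rewrite ler_wpM2r ?gauss_ge0.
rewrite mulrDl lerD2r -!mulrA ler_wpM2l// mulrA.
by have := enorm_sqr_gauss_le u v0; rewrite mulrA.
Qed.

Lemma second_moment_le :
  (\int[L]_x (enorm x ^+ 2 * dens mu rad m v x)%:E <=
   (2 * (Num.sqrt 2 ^+ n * (v *+ 4)) + 2 * (m ^+ 2 * rad ^+ 2))%:E)%E.
Proof.
have v2 : 0 < v *+ 2 by rewrite pmulrn_lgt0.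
have m1 := measurable_dens m muD v0.
have em1 : measurable_fun setT (fun x => (dens mu rad m v x)%:E) by apply/measurable_EFinP.
have em2 : measurable_fun setT (fun x => (dens mu rad m (v *+ 2) x)%:E).
  by apply/measurable_EFinP; exact: measurable_dens.
have c1 : 0 <= 2 * (Num.sqrt 2 ^+ n * (v *+ 4)).
  by rewrite mulr_ge0// mulr_ge0 ?exprn_ge0 ?sqrtr_ge0// mulrn_wge0// ltW.
have c2 : 0 <= 2 * (m ^+ 2 * rad ^+ 2) by rewrite mulr_ge0// mulr_ge0 ?sqr_ge0.
apply: (@le_trans _ _ (\int[L]_x ((2 * (Num.sqrt 2 ^+ n * (v *+ 4)))%:E * (dens mu rad m (v *+ 2) x)%:E +
   (2 * (m ^+ 2 * rad ^+ 2))%:E * (dens mu rad m v x)%:E))%E).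
  apply: ge0_le_integral => //.
  - by move=> x _; rewrite lee_fin mulr_ge0 ?sqr_ge0// dens_ge0.
  - apply/measurable_EFinP/measurable_funM => //.
    by apply: measurable_funX; exact: measurable_enorm.
  - by apply: emeasurable_funD; apply: emeasurable_funM.
  - by move=> x _; rewrite -!EFinM -EFinD lee_fin enorm_sqr_dens_le.
rewrite ge0_integralD//.
- rewrite !ge0_integralZl ?lee_fin//; first by rewrite !integral_dens// !mule1 -EFinD.
  + by move=> x _; rewrite lee_fin dens_ge0.
  + by move=> x _; rewrite lee_fin dens_ge0.
- by move=> x _; rewrite mule_ge0 ?lee_fin// dens_ge0.
- exact: emeasurable_funM.
- by move=> x _; rewrite mule_ge0 ?lee_fin// dens_ge0.
- exact: emeasurable_funM.
Qed.

End second_moment.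

(** * The density as a function of time *)

Section narrow_continuity.
Context (R : realType) (n : nat) d (Omega : measurableType d) (P : probability Omega R).
Local Notation L := (lebesgue_rV R n).

Lemma integral_has_density (X : Omega -> 'rV[R]_n) (p phi : 'rV[R]_n -> R) :
  has_density P X p -> measurable_fun setT phi ->
  \int[L]_x (phi x * p x) = \int[P]_w phi (X w).
Proof.
move=> [mp p0 [mX Xp]] mphi.
have H (f : 'rV[R]_n -> \bar R) : measurable_fun setT f -> (forall x, 0 <= f x)%E ->
    (\int[L]_x (f x * (p x)%:E) = \int[P]_w f (X w))%E.
  move=> mf f0; rewrite -(ge0_integral_density (nu := distribution P (mfun_of P mX)) mp p0)//.
  by rewrite ge0_integral_distribution.
have mE : measurable_fun setT (EFin \o phi) by apply/measurable_EFinP.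
rewrite /Rintegral; congr fine; rewrite integralE [RHS]integralE; congr (_ - _)%E.
- rewrite -[RHS](_ : (\int[P]_w (EFin \o phi)^\+ (X w) = _)%E); last first.
    by apply: eq_integral => w _; rewrite unlock.
  rewrite -H//; last exact: measurable_funepos.
  by apply: eq_integral => x _; rewrite !funeposE/= -!EFin_max -EFinM maxr_pMl// mul0r.
- rewrite -[RHS](_ : (\int[P]_w (EFin \o phi)^\- (X w) = _)%E); last first.
    by apply: eq_integral => w _; rewrite unlock.
  rewrite -H//; last exact: measurable_funeneg.
  by apply: eq_integral => x _; rewrite !funenegE/= -!EFin_max -EFinM maxr_pMl// mul0r mulNr.
Qed.

Lemma expectation_within_continuous (delta T : R) (X : R -> Omega -> 'rV[R]_n) (phi : 'rV[R]_n -> R) :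
  0 <= delta <= T -> (forall t, t \in `[delta, T] -> measurable_fun setT (X t)) ->
  continuous_paths P T X -> continuous phi -> (exists M, forall x, `|phi x| <= M) ->
  {within `[delta, T], continuous (fun t => \int[P]_w phi (X t w))}.
Proof.
move=> /andP[d0 dT] mX cX cphi [M phiM].
(* Clamping time to [delta, T] gives a function on the whole line, whose continuity can be tested
   along sequences, as dominated convergence requires. *)
pose c t := Num.max delta (Num.min t T).
have cin t : c t \in `[delta, T] by rewrite in_itv/= le_max lexx/= ge_max dT ge_min lexx orbT.
have cc : continuous c.
  have lip a b : `|Num.max delta (Num.min a T) - Num.max delta (Num.min b T)| <= `|a - b|.
    have nrm (x y z w : R) : - `|x - y| <= z - w <= `|x - y| -> `|z - w| <= `|x - y|.
      by rewrite ler_norml.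
    have lmax x y : `|Num.max delta x - Num.max delta y| <= `|x - y|.
      have h1 := ler_norm (x - y); have h2 := ler_norm (- (x - y)); rewrite normrN in h2.
      by apply: nrm; case: (leP delta x) => h3; case: (leP delta y) => h4; apply/andP; split; lra.
    apply: le_trans (lmax _ _) _.
    have h1 := ler_norm (a - b); have h2 := ler_norm (- (a - b)); rewrite normrN in h2.
    by apply: nrm; case: (leP a T) => h3; case: (leP b T) => h4; apply/andP; split; lra.
  move=> t; apply/cvgrPdist_lt => e e0; near=> u.
  apply: le_lt_trans (lip _ _) _; near: u; exact: cvgr_dist_lt.
have mphi := continuous_measurable_rV cphi.
pose g t := \int[P]_w phi (X (c t) w).
have mg t : measurable_fun setT (fun w => (phi (X (c t) w))%:E).
  by apply/measurable_EFinP/measurableT_comp => //; exact: mX.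
have gi t : P.-integrable setT (fun w => (phi (X (c t) w))%:E).
  apply: measurable_bounded_integrable => //.
  - by apply: le_lt_trans (probability_le1 _ measurableT) _; rewrite ltry.
  - exact/measurable_EFinP/mg.
  - by exists M; split; [exact: num_real|move=> K MK w _ /=; exact: le_trans (phiM _) (ltW MK)].
have cg : continuous g.
  move=> t; apply/continuous_withinNx/cvgr_dnbhsP => u [_ ut].
  apply: fine_cvg; rewrite /g /Rintegral fineK; last exact: (integrable_fin_num measurableT (gi t)).
  have DC := @dominated_convergence _ _ _ P _ measurableT
    (fun k w => (phi (X (c (u k)) w))%:E) (fun w => (phi (X (c t) w))%:E) (fun=> M%:E).
  case: DC; last by move=> _ _; exact.
  - by move=> k; exact: mg.
  - exact: mg.
  - apply: filterS cX => w cw _; apply: cvg_EFin; first exact: nearW.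
    apply: (@cvg_comp _ _ _ (fun k => X (c (u k)) w) phi); last exact: cphi.
    move/subspace_continuousP : cw => /(_ (c t)) H.
    apply: (@cvg_comp _ _ _ (fun k => c (u k)) (fun s => X s w) _ (within `[0, T] (nbhs (c t)))).
      move=> A; rewrite /within/= => HA.
      have cu : c (u k) @[k --> \oo] --> c t by apply: continuous_cvg ut; exact: cc.
      have E : \forall k \near \oo, `[0, T]%classic (c (u k)) -> A (c (u k)) by exact: (cu _ HA).
      apply: (@filterS _ \oo _ _ _ _ E) => k; apply.
      by have := cin (u k); rewrite /= !in_itv/= => /andP[/(le_trans d0)-> ->].
    by apply: H; have := cin t; rewrite /= !in_itv/= => /andP[/(le_trans d0)-> ->].
  - exact: finite_measure_integrable_cst.
  - by apply: aeW => w k _ /=; rewrite lee_fin.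
apply: (subspace_eq_continuous (f := g)); last exact: continuous_subspaceT.
move=> t; rewrite inE/= in_itv/= => /andP[dt tT].
by rewrite /g /c (min_l tT) (max_r dt).
Unshelve. all: by end_near. Qed.

(** Narrow continuity is read off from the continuity of the paths, through the expectation of
    phi(X_t), and not from the formula for the density. *)
Lemma density_narrowly_continuous (delta T : R) (X : R -> Omega -> 'rV[R]_n)
    (p : R -> 'rV[R]_n -> R) :
  0 <= delta <= T -> (forall t, t \in `[delta, T] -> has_density P (X t) (p t)) ->
  continuous_paths P T X -> narrowly_continuous delta T p.
Proof.
move=> dT Xp cX phi cphi phiM.
apply: (subspace_eq_continuous (f := fun t => \int[P]_w phi (X t w))).
  move=> t; rewrite inE/= => /Xp tp; apply/esym/integral_has_density => //.
  exact: continuous_measurable_rV.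
apply: expectation_within_continuous => // t /Xp [_ _ []] //.
Qed.

End narrow_continuity.

(** * Bounds uniform in time and the properties (S1)-(S4) *)

Section density_family.
Context (R : realType) (n : nat) (mu : probability 'rV[R]_n R) (rad delta T : R)
  (m v : R -> R) (mmax vmin : R).
Local Notation D := (eball rad : set 'rV[R]_n).
Local Notation L := (lebesgue_rV R n).
Local Notation I := `[delta, T].
Hypotheses (muD : mu D = 1%E) (dT : delta < T).
Hypotheses (cm : {within `[delta, T], continuous m}) (cv : {within `[delta, T], continuous v}).
Hypotheses (mI : forall t, t \in I -> 0 <= m t <= mmax)
  (vmin0 : 0 < vmin) (vI : forall t, t \in I -> vmin <= v t).
Implicit Types (t : R) (x : 'rV[R]_n).

Definition pdens t x := dens mu rad (m t) (v t) x.
Definition pscore t x : 'rV[R]_n := \row_i score mu rad (m t) (v t) i x.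
Definition pjac t x : 'M[R]_n := \matrix_(i, j) score_jac mu rad (m t) (v t) i j x.
Definition pbound := vmin^-1 + mmax ^+ 2 * rad ^+ 2 / vmin ^+ 2.

Let r0 : 0 <= rad. Proof. exact: rad_ge0 muD. Qed.
Let v0 t : t \in I -> 0 < v t. Proof. by move=> /vI; exact: lt_le_trans. Qed.
Let itvW t : t \in `]delta, T[ -> t \in I.
Proof. by rewrite !in_itv/= => /andP[/ltW-> /ltW->]. Qed.

Let mmax0 : 0 <= mmax.
Proof.
have dI : delta \in I by rewrite in_itv/= lexx ltW.
by have /andP[h1 h2] := mI dI; exact: le_trans h1 h2.
Qed.

Let vV t : t \in I -> (v t)^-1 <= vmin^-1.
Proof. by move=> tI; rewrite lef_pV2 ?posrE ?v0// vI. Qed.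

Lemma mr_v2_le t : t \in I ->
  m t ^+ 2 * rad ^+ 2 / v t ^+ 2 <= mmax ^+ 2 * rad ^+ 2 / vmin ^+ 2.
Proof.
move=> tI; have /andP[h1 h2] := mI tI; rewrite -!exprMn -!exprVn -!exprMn.
have h3 : 0 <= m t * rad / v t by rewrite mulr_ge0 ?invr_ge0 ?(ltW (v0 tI))// mulr_ge0.
have h4 : m t * rad / v t <= mmax * rad / vmin.
  by apply: ler_pM; rewrite ?mulr_ge0 ?invr_ge0 ?(ltW (v0 tI)) ?vV// ler_wpM2r.
by rewrite lerXn2r ?nnegrE// (le_trans h3 h4).
Qed.

Lemma hessian_bound_le t : t \in I ->
  (v t)^-1 + m t ^+ 2 * rad ^+ 2 / v t ^+ 2 <= pbound.
Proof. by move=> tI; apply: lerD; [exact: vV|exact: mr_v2_le]. Qed.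

Lemma laplacian_bound_le t : t \in I ->
  n%:R * Num.max (m t ^+ 2 * rad ^+ 2 / v t ^+ 2 - (v t)^-1) 0 <=
  n%:R * mmax ^+ 2 * rad ^+ 2 / vmin ^+ 2.
Proof.
move=> tI; have -> : n%:R * mmax ^+ 2 * rad ^+ 2 / vmin ^+ 2 =
    n%:R * (mmax ^+ 2 * rad ^+ 2 / vmin ^+ 2) by rewrite !mulrA.
apply: ler_wpM2l => //; rewrite ge_max; apply/andP; split.
  by apply: (le_trans _ (mr_v2_le tI)); rewrite gerBl invr_ge0 ltW// v0.
by rewrite divr_ge0 ?sqr_ge0// mulr_ge0 ?sqr_ge0.
Qed.

Lemma ln_pdens_Ck2 t : t \in I -> Ck 2 (fun x => ln (pdens t x)).
Proof. by move=> tI; apply: Ck2_ln_dens => //; exact: v0. Qed.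

Lemma hessian_pdens t x : t \in I -> hessian (fun x => ln (pdens t x)) x = pjac t x.
Proof. by move=> tI; apply: hessian_ln_dens => //; exact: v0. Qed.

Lemma pscore_le t x : t \in I ->
  enorm (pscore t x) <= vmin^-1 * (enorm x + mmax * rad).
Proof.
move=> tI; have /andP[h1 h2] := mI tI.
have := gradient_le muD (v0 tI) x h1; rewrite (gradient_ln_dens _ muD (v0 tI)).
move=> /le_trans; apply; apply: ler_pM.
- by rewrite invr_ge0 ltW// v0.
- by rewrite addr_ge0 ?enorm_ge0// mulr_ge0.
- exact: vV.
- by rewrite lerD2l ler_wpM2r.
Qed.

Lemma pscore_linear_growth t x : t \in I ->
  enorm (pscore t x) <= vmin^-1 * Num.max 1 (mmax * rad) * (1 + enorm x).
Proof.
move=> tI; apply: le_trans (pscore_le x tI) _.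
rewrite -mulrA ler_wpM2l ?invr_ge0 ?(ltW vmin0)//.
have e0 := enorm_ge0 x.
have h1 : 1 <= Num.max 1 (mmax * rad) by rewrite le_max lexx.
have h2 : mmax * rad <= Num.max 1 (mmax * rad) by rewrite le_max lexx orbT.
nra.
Qed.

Lemma pjac_le t i j x : t \in I -> `|pjac t x i j| <= pbound.
Proof.
move=> tI; rewrite /pjac mxE; apply: (le_trans _ (hessian_bound_le tI)).
exact: (score_jac_bound (m t) muD (v0 tI)).
Qed.

Lemma trace_pjac t x : t \in I -> \tr (pjac t x) = laplacian (fun x => ln (pdens t x)) x.
Proof. by move=> tI; rewrite /laplacian hessian_pdens. Qed.

Lemma laplacian_pos_le t : (0 < n)%N -> t \in I ->
  ('N[L]_+oo[EFin \o (laplacian (fun x => ln (pdens t x)))^\+%R] <=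
   (n%:R * Num.max (m t ^+ 2 * rad ^+ 2 / v t ^+ 2 - (v t)^-1) 0)%:E)%E.
Proof.
move=> n0 tI; apply: Lnorm_oo_le.
  by rewrite mulr_ge0// le_max lexx orbT.
move=> x; rewrite /= lee_fin ger0_norm; last by rewrite le_max lexx orbT.
rewrite ge_max mulr_ge0 ?le_max ?lexx ?orbT// andbT.
apply: le_trans (laplacian_le (m t) muD (v0 tI) x) _.
rewrite addrC.
set a := m t ^+ 2 * rad ^+ 2 / v t ^+ 2.
have a0 : 0 <= a by rewrite divr_ge0 ?sqr_ge0// mulr_ge0 ?sqr_ge0.
have n1 : 1 <= n%:R :> R by rewrite ler1n.
(* As n >= 1 and a >= 0, the bound a - n / v is weakened to n (a - 1 / v). *)
apply: (@le_trans _ _ (n%:R * (a - (v t)^-1))).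
  by rewrite mulrBr lerD2r ler_peMl.
by rewrite ler_wpM2l// le_max lexx.
Qed.

Lemma laplacian_neg_le t : t \in I ->
  ('N[L]_+oo[EFin \o (laplacian (fun x => ln (pdens t x)))^\-%R] <= (n%:R / vmin)%:E)%E.
Proof.
move=> tI; have b0 : 0 <= n%:R / vmin by rewrite divr_ge0// ltW.
apply: Lnorm_oo_le => // x; rewrite /= lee_fin ger0_norm; last by rewrite le_max lexx orbT.
rewrite ge_max b0 andbT lerNl.
apply: (le_trans _ (laplacian_ge (m t) muD (v0 tI) x)).
by rewrite lerN2 ler_wpM2l// vV.
Qed.

Lemma weak_gradient_pdens t : t \in I -> weak_gradient (fun x => ln (pdens t x)) (pscore t).
Proof.
move=> tI i; rewrite (_ : (fun x => pscore t x 0 i) = score mu rad (m t) (v t) i); last first.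
  by apply/funext => x; rewrite mxE.
apply: weak_partial_C1.
- exact: continuous_ln_dens muD (v0 tI).
- exact: (continuous_score muD).
- by move=> x; exact: is_derive_ln_dens muD (v0 tI) x i.
Qed.

Lemma weak_jacobian_pscore t : t \in I -> weak_jacobian (pscore t) (pjac t).
Proof.
move=> tI i j.
rewrite (_ : (fun x => pscore t x 0 i) = score mu rad (m t) (v t) i); last first.
  by apply/funext => x; rewrite mxE.
rewrite (_ : (fun x => pjac t x i j) = score_jac mu rad (m t) (v t) i j); last first.
  by apply/funext => x; rewrite mxE.
apply: weak_partial_C1.
- exact: (continuous_score muD).
- exact: (continuous_score_jac muD).
- by move=> x; exact: is_derive_score muD (v0 tI) x i j.
Qed.

(** The coefficients are extended by zero off [delta, T] to be measurable on the whole line; for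
    this reason [vv] is only known to be non-negative. *)
Lemma jointly_measurable_coef (f : R -> R -> 'rV[R]_n -> R) :
  (forall mm vv : R * 'rV[R]_n -> R, measurable_fun setT mm -> measurable_fun setT vv ->
    (forall z, 0 <= vv z) -> measurable_fun setT (fun z => f (mm z) (vv z) z.2)) ->
  jointly_measurable delta T (fun t x => f (m t) (v t) x).
Proof.
move=> mf.
have pm (g : R -> R) : {within `[delta, T], continuous g} ->
    measurable_fun setT (fun z : R * 'rV[R]_n => (g \_ `[delta, T]) z.1).
  move=> cg; apply: measurableT_comp; last exact: measurable_fst.
  by apply: (measurable_restrictT g _).1 => //; exact: subspace_continuous_measurable_fun.
have vp (z : R * 'rV[R]_n) : 0 <= (v \_ `[delta, T]) z.1.
  by rewrite patchE; case: ifPn => // /set_mem /v0/ltW.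
have := mf _ _ (pm _ cm) (pm _ cv) vp.
move=> /(measurable_funTS (D := `]delta, T[ `*` setT)).
apply: eq_measurable_fun => z; rewrite inE => -[/= /itvW zI _].
by rewrite !patchE !mem_setE zI.
Qed.

Lemma pdens_jointly_measurable : jointly_measurable delta T pdens.
Proof.
apply: (jointly_measurable_coef (f := fun a b => dens mu rad a b)) => mm vv m1 m2 h.
by apply: measurable_dens_param => //; exact: measurable_snd.
Qed.

Lemma pscore_jointly_measurable i : jointly_measurable delta T (fun t x => pscore t x 0 i).
Proof.
rewrite (_ : (fun t x => pscore t x 0 i) = (fun t x => score mu rad (m t) (v t) i x)).
  apply: (jointly_measurable_coef (f := fun a b => score mu rad a b i)) => mm vv m1 m2 h.
  by apply: measurable_score => //; exact: measurable_snd.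
by apply/funext => t; apply/funext => x; rewrite mxE.
Qed.

Lemma pjac_jointly_measurable i j : jointly_measurable delta T (fun t x => pjac t x i j).
Proof.
rewrite (_ : (fun t x => pjac t x i j) = (fun t x => score_jac mu rad (m t) (v t) i j x)).
  apply: (jointly_measurable_coef (f := fun a b => score_jac mu rad a b i j)) => mm vv m1 m2 h.
  by apply: measurable_score_jac => //; exact: measurable_snd.
by apply/funext => t; apply/funext => x; rewrite mxE.
Qed.

Let ae_itv (Q : R -> Prop) : (forall t, t \in I -> Q t) ->
  {ae (@lebesgue_measure R), forall t : R, t \in `]delta, T[ -> Q t}.
Proof. by move=> H; apply: aeW => t /itvW; exact: H. Qed.

Lemma pdens_S2 : S2 delta T pdens.
Proof.
exists pscore; split; first by apply: ae_itv => t; exact: weak_gradient_pdens.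
exists pjac; split.
- exact: pscore_jointly_measurable.
- exact: pjac_jointly_measurable.
- by apply: ae_itv => t; exact: weak_jacobian_pscore.
move=> r; have mDr : measurable (eball r : set 'rV[R]_n) by exact: measurable_eball.
have Loo : (L (eball r : set 'rV[R]_n) < +oo)%E.
  apply: (le_lt_trans _ (@lebesgue_cube_lty R n r)).
  apply: le_measure; rewrite ?inE//; [exact: measurable_cube|exact: eball_sub_cube].
pose K := vmin^-1 * (`|r| + mmax * rad) + \sum_(i < n) \sum_(j < n) pbound.
have b0 : 0 <= pbound by rewrite addr_ge0 ?invr_ge0 ?(ltW vmin0)// divr_ge0 ?sqr_ge0// mulr_ge0 ?sqr_ge0.
have K0 : 0 <= K.
  apply: addr_ge0; first by rewrite mulr_ge0 ?invr_ge0 ?(ltW vmin0)// addr_ge0// mulr_ge0.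
  by apply: sumr_ge0 => i _; apply: sumr_ge0.
have Lf : L (eball r : set 'rV[R]_n) \is a fin_num by rewrite ge0_fin_numE.
pose K' := K * fine (L (eball r : set 'rV[R]_n)).
have K'0 : 0 <= K' by rewrite mulr_ge0// fine_ge0.
apply: (@le_lt_trans _ _ (K'%:E * lebesgue_measure (`]delta, T[%classic : set R))%E).
  apply: ge0_integral_le_cst => // t /= /itvW tI; apply/andP; split.
    apply: integral_ge0 => x _; rewrite lee_fin addr_ge0 ?enorm_ge0//.
    by apply: sumr_ge0 => i _; apply: sumr_ge0.
  rewrite /K' EFinM fineK//; apply: ge0_integral_le_cst => // x xr.
  rewrite !lee_fin addr_ge0 ?enorm_ge0//=; last first.
    by apply: sumr_ge0 => i _; apply: sumr_ge0.
  apply: lerD; last by apply: ler_sum => i _; apply: ler_sum => j _; exact: pjac_le.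
  apply: le_trans (pscore_le x tI) _; rewrite ler_wpM2l ?invr_ge0 ?(ltW vmin0)// lerD2r.
  exact: le_trans xr (ler_norm r).
by rewrite lebesgue_measure_itv/= lte_fin dT -EFinB -EFinM ltry.
Qed.

Let L1_cst c : L1 delta T (fun=> c).
Proof.
by apply: (bounded_itv_integrable (M := `|c|)) => //; exact: lebesgue_itv_lty.
Qed.

Lemma pdens_S3 : (0 < n)%N -> S3 delta T pdens.
Proof.
move=> n0; exists (fun=> n%:R * mmax ^+ 2 * rad ^+ 2 / vmin ^+ 2); split; first exact: L1_cst.
apply: ae_itv => t tI; exists (pscore t), (pjac t); split.
- exact: weak_gradient_pdens.
- exact: weak_jacobian_pscore.
- rewrite (_ : (fun x => \tr (pjac t x)) = laplacian (fun x => ln (pdens t x))).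
    by apply: le_trans (laplacian_pos_le n0 tI) _; rewrite lee_fin; exact: laplacian_bound_le.
  by apply/funext => x; exact: trace_pjac.
Qed.

Lemma pdens_S4 : S4 delta T pdens.
Proof.
exists (fun=> vmin^-1 * Num.max 1 (mmax * rad)); split; first exact: L1_cst.
apply: ae_itv => t tI; exists (pscore t); first exact: weak_gradient_pdens.
by apply: aeW => x; exact: pscore_linear_growth.
Qed.

Lemma pdens_S1 : narrowly_continuous delta T pdens -> S1 delta T pdens.
Proof.
move=> nc; split => //.
- by move=> t tI; apply: aeW => x; exact: dens_gt0 muD (v0 tI) x.
- split; first exact: pdens_jointly_measurable.
  (* The L^1 norm is 1, and [C] is the peak of the kernel at the smallest variance; the maximum
     bounds both norms. *)
  pose C := ((Num.sqrt (vmin * pi *+ 2))^-1) ^+ n; exists (Num.max 1 C).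
  have C0 : 0 <= C by rewrite exprn_ge0// invr_ge0 sqrtr_ge0.
  apply: ae_itv => t tI; split.
    rewrite Lnorm1 (_ : (\int[L]_x _)%E = (\int[L]_x (pdens t x)%:E)%E); last first.
      by apply: eq_integral => x _; rewrite /= ger0_norm// (dens_ge0 _ muD (v0 tI)).
    by rewrite (integral_dens _ muD (v0 tI)) lee_fin le_max lexx.
  apply: Lnorm_oo_le; first by rewrite le_max ler01.
  move=> x; rewrite /= lee_fin ger0_norm; last exact: dens_ge0 muD (v0 tI) x.
  by rewrite le_max (dens_le_peak (m t) muD (v0 tI) x vmin0 (vI tI)) orbT.
- have [M M0 vM] := within_bounded cv.
  apply: (@le_lt_trans _ _ (2 * (Num.sqrt 2 ^+ n * (M *+ 4)) + 2 * (mmax ^+ 2 * rad ^+ 2))%:E).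
    apply: ub_ereal_sup => _ [t tI <-].
    apply: le_trans (second_moment_le (m t) muD (v0 tI)) _.
    have /andP[h1 h2] := mI tI.
    rewrite lee_fin lerD// ler_wpM2l//.
      rewrite ler_wpM2l ?exprn_ge0 ?sqrtr_ge0// lerMn2r/=.
      exact: le_trans (ler_norm _) (vM t tI).
    by rewrite ler_wpM2r ?sqr_ge0// lerXn2r ?nnegrE.
  by rewrite ltry.
Qed.

End density_family.

Theorem proposition5p3 (R : realType) (n : nat) (T delta eps rad : R)
  (beta sigma : R -> R) (mu0 : probability 'rV[R]_n R)
  (disp : measure_display) (Omega : measurableType disp)
  (P : probability Omega R) (F : R -> set (set Omega))
  (W X : R -> Omega -> 'rV[R]_n) :
  0 < T -> (1 <= n)%N ->
  Linfty 0 T sigma ->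
  0 < eps ->
  {ae lebesgue_measure, forall s : R, s \in `]0, T[ ->
    eps <= sigma s <= eps^-1} ->
  Linfty 0 T beta ->
  compact (msupport mu0) -> msupport mu0 `<=` eball rad ->
  filtration T F -> brownian_motion P T F W ->
  has_law P (X 0) mu0 -> sde_solution P T F W beta sigma X ->
  0 < delta < T ->
  let m := m_ beta in
  let v := vs2 beta sigma in
  let vmin := vs2_min beta sigma delta T in
  let mmax := m_max beta T in
  let L := lebesgue_rV R n in
  [/\ 0 < vmin,
      has_ubound [set m s | s in `[0, T]] &
  exists p : R -> 'rV[R]_n -> R,
  let logp s x := ln (p s x) in
  [/\ forall t, t \in `[delta, T] ->
        [/\ has_density P (X t) (p t), forall x, 0 < p t x & Ck 2 (logp t)],
      [/\ S1 delta T p, S2 delta T p, S3 delta T p & S4 delta T p] &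
  forall s, s \in `[delta, T] ->
  [/\ ('N[L]_+oo[EFin \o (laplacian (logp s))^\+%R]
        <= (n%:R * Num.max (m s ^+ 2 * rad ^+ 2 / v s ^+ 2 - (v s)^-1) 0)%:E)%E
      /\ n%:R * Num.max (m s ^+ 2 * rad ^+ 2 / v s ^+ 2 - (v s)^-1) 0
        <= n%:R * mmax ^+ 2 * rad ^+ 2 / vmin ^+ 2,
      (forall x, opnorm (hessian (logp s) x)
        <= (v s)^-1 + m s ^+ 2 * rad ^+ 2 / v s ^+ 2)
      /\ (v s)^-1 + m s ^+ 2 * rad ^+ 2 / v s ^+ 2
        <= vmin^-1 + mmax ^+ 2 * rad ^+ 2 / vmin ^+ 2,
      forall x, enorm (gradient (logp s) x)
        <= vmin^-1 * Num.max 1 (mmax * rad) * (1 + enorm x),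
      forall x, loewner_le (- (v s)^-1)%:M (hessian (logp s) x) &
      ('N[L]_+oo[EFin \o (laplacian (logp s))^\-%R] <= (n%:R / vmin)%:E)%E]]].
Proof.
move=> T0 n1 Ls e0 seps Lb _ mu0rad hF hW X0mu hX /andP[d0 dT] m v vmin mmax L.
have muD : mu0 (eball rad) = 1%E.
  have mD : measurable (eball rad : set 'rV[R]_n) by exact: measurable_eball.
  have := probability_setC mu0 (measurableC mD).
  by rewrite setCK (measure_setC_msupport mD mu0rad) sube0.
have cm : {within `[0, T], continuous m} by exact: (m_within Ls Lb seps).
have cv : {within `[0, T], continuous v} by exact: (vs2_within T0 Ls e0 Lb seps).
have [k k0 vk] : exists2 k, 0 < k & forall s, 0 <= s <= T -> k * s <= v s :=
  vs2_linear_lower T0 Ls e0 Lb seps.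
have kern := sde_kernel_version T0 Ls e0 Lb seps hF hW hX.
have dTI t : t \in `[delta, T] -> 0 < t <= T.
  by rewrite in_itv/= => /andP[/(lt_le_trans d0)-> ->].
have dTI' t : t \in `[delta, T] -> 0 <= t <= T by move=> /dTI/andP[/ltW-> ->].
have sub : `[delta, T] `<=` `[0, T]%classic by move=> t /dTI'; rewrite /= in_itv.
have mub : has_ubound [set m s | s in `[0, T]].
  have [M M0 mM] := within_bounded cm.
  by exists M => _ [s /= sT <-]; apply: le_trans (ler_norm _) (mM s sT).
have m0 s : 0 < m s by exact: m_gt0.
have mle s : 0 <= s <= T -> m s <= mmax.
  by move=> sT; apply: ub_le_sup => //; exists s => //=; rewrite in_itv.
have vlb s : s \in `[delta, T] -> k * delta <= v s.
  move=> sI; apply: le_trans (vk s (dTI' s sI)); rewrite ler_wpM2l ?(ltW k0)//.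
  by move: sI; rewrite in_itv/= => /andP[].
have vne : [set v s | s in `[delta, T]] !=set0.
  by exists (v delta); exists delta => //=; rewrite in_itv/= lexx ltW.
(* [k * delta] is a positive lower bound for the variances, and the infimum over a non-empty set
   inherits it. *)
have vmin0 : 0 < vmin.
  apply: (lt_le_trans (mulr_gt0 k0 d0)); apply: lb_le_inf => // _ [s sI <-].
  exact: vlb.
have vle s : s \in `[delta, T] -> vmin <= v s.
  move=> sI; apply: ge_inf; last by exists s.
  by exists (k * delta) => _ [u uI <-]; exact: vlb.
have mI t : t \in `[delta, T] -> 0 <= m t <= mmax by move=> /dTI' tT; rewrite (ltW (m0 t)) mle.
have cm' : {within `[delta, T], continuous m} := continuous_subspaceW sub cm.
have cv' : {within `[delta, T], continuous v} := continuous_subspaceW sub cv.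
have v0 t : t \in `[delta, T] -> 0 < v t by move=> /vle; exact: lt_le_trans.
split => //; exists (pdens mu0 rad m v) => logp.
have [aX cX _] := hX.
have dens_p t : t \in `[delta, T] -> has_density P (X t) (pdens mu0 rad m v t).
  move=> tI; apply: (dens_has_density muD (v0 t tI) X0mu).
    apply: (Fmeas_measurable hF (dTI' t tI)); apply/(FmeasP hF _ (dTI' t tI)).
    by apply: aX; move: (dTI' t tI); rewrite in_itv.
  by move=> a y a0; exact: kern (dTI t tI) a0.
split.
- move=> t tI; split; [exact: dens_p| |exact: (ln_pdens_Ck2 m muD vmin0 vle tI)].
  by move=> x; exact: dens_gt0 muD (v0 t tI) x.
- split.
  + apply: (pdens_S1 muD dT cm' cv' mI vmin0 vle).
    by apply: (density_narrowly_continuous _ dens_p cX); rewrite (ltW d0) ltW.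
  + exact: pdens_S2 muD dT cm' cv' mI vmin0 vle.
  + exact: (pdens_S3 muD mI vmin0 vle n1).
  + exact: (pdens_S4 muD mI vmin0 vle).
move=> s sI; split.
- split; first exact: (laplacian_pos_le m muD vmin0 vle n1 sI).
  exact: (laplacian_bound_le muD mI vmin0 vle sI).
- split; last exact: (hessian_bound_le muD mI vmin0 vle sI).
  by move=> x; exact: (hessian_opnorm (m s) muD (v0 s sI)).
- move=> x; rewrite /logp (gradient_ln_dens (m s) muD (v0 s sI)).
  exact: (pscore_linear_growth muD mI vmin0 vle x sI).
- by move=> x; exact: (hessian_lower (m s) muD (v0 s sI)).
- exact: (laplacian_neg_le m muD vmin0 vle sI).
Qed.
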